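(* Let $c:\mathbb{R}\times\mathbb{R}\to\mathbb{R}$ satisfy the martingale Spence-Mirrlees condition. Let $\mu\preceq\nu$ be probability measures on $\mathbb{R}$ with finite first moments, and suppose $c(x,y)\le a(x)+b(y)$ for all $(x,y)\in\mathbb{R}^2$, for some $a\in\mathbb{L}^1(\mu)$ and $b\in\mathbb{L}^1(\nu)$. Then any solution $\mathbb{P}^*$ of the martingale transport problem $\mathbf{P}(c)$ is left-monotone. In particular, for all probability measures $\mu\preceq\nu$ on $\mathbb{R}$ with finite first moments, there exists a left-monotone $\mathbb{P}\in\mathcal{M}(\mu,\nu)$.
   Context: $(X,Y)$ denotes the canonical process on $\Omega=\mathbb{R}\times\mathbb{R}$: $X(x,y)=x$, $Y(x,y)=y$. For probability measures $\mu,\nu$ on $\mathbb{R}$ with finite first moments, $\mu\preceq\nu$ (convex order) means $\mu(g)\le\nu(g)$ for every convex function $g$, where $\mu(g)=\int g\,d\mu$. $\mathcal{M}(\mu,\nu)$ is the set of probability measures $\mathbb{P}$ on $\Omega$ with $X\sim_{\mathbb{P}}\mu$, $Y\sim_{\mathbb{P}}\nu$ and $\mathbb{E}^{\mathbb{P}}[Y|X]=X$ $\mu$-a.s. For measurable $c$ with $c(x,y)\le a(x)+b(y)$, $a\in\mathbb{L}^1(\mu)$, $b\in\mathbb{L}^1(\nu)$, the expectation $\mathbb{E}^{\mathbb{P}}[c(X,Y)]\in\mathbb{R}\cup\{-\infty\}$ is well defined for $\mathbb{P}\in\mathcal{M}(\mu,\nu)$, and the martingale transport problem is $$\mathbf{P}(c):=\sup_{\mathbb{P}\in\mathcal{M}(\mu,\nu)}\mathbb{E}^{\mathbb{P}}[c(X,Y)].$$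 A solution of $\mathbf{P}(c)$ is a $\mathbb{P}^*\in\mathcal{M}(\mu,\nu)$ attaining this supremum: $\mathbb{E}^{\mathbb{P}^*}[c(X,Y)]=\mathbf{P}(c)$. Martingale Spence-Mirrlees condition: $c$ is measurable, continuously differentiable with respect to $x$, and $y\mapsto c_x(x,y)$ is strictly convex on $\mathbb{R}$ for every $x\in\mathbb{R}$, where $c_x$ is the partial derivative of $c$ in $x$. Left-monotone: $\mathbb{P}\in\mathcal{M}(\mu,\nu)$ is left-monotone if there exists a Borel set $\Gamma\subset\mathbb{R}\times\mathbb{R}$ with $\mathbb{P}[(X,Y)\in\Gamma]=1$ such that for all $(x,y_0),(x,y_1),(x',y')\in\Gamma$ with $x<x'$, one has $y'\notin(y_0,y_1)$.
   Formalization: The claim on solutions assumes P(c) > −∞: if P(c) = −∞, every element of M(μ,ν) attains the supremum and the claim can fail, e.g. for c(x,y) = tanh(x)·sqrt(1+y²) − y² when ν has infinite second moment. *)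

(* Defs.v *)
From HB Require Import structures.
From mathcomp Require Import all_boot all_order all_algebra.
From mathcomp Require Import all_classical all_reals all_analysis.

Set Implicit Arguments.
Unset Strict Implicit.
Unset Printing Implicit Defensive.

Import Order.TTheory GRing.Theory Num.Theory.
Import numFieldNormedType.Exports.

Local Open Scope classical_set_scope.
Local Open Scope ring_scope.

(* Probability measures for the Borel sigma-algebra of R and for the product
   sigma-algebra of R * R (which is its Borel sigma-algebra). *)
Notation probR R := (probability (measurableTypeR R) R).
Notation probR2 R :=
  (probability (measurableTypeR R * measurableTypeR R)%type R).

Section martingale_transport.
Local Open Scope ereal_scope.
Context {R : realType}.
Implicit Types (mu nu : probR R) (P : probR2 R) (c : R -> R -> R).

Definition finite_first_moment mu : Prop :=
  mu.-integrable [set: measurableTypeR R] (fun x => (x : R)%:E).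

(* Meaningful when mu and nu have finite first moments: the negative part of a
   convex g is then integrable, so both integrals are well defined in
   ]-oo, +oo]. *)
Definition convex_order mu nu : Prop :=
  forall g : R -> R, convex_function [set: convex_lmodType R^o] g ->
    \int[mu]_x (g x)%:E <= \int[nu]_x (g x)%:E.

(* The canonical process. *)
Definition procX (w : measurableTypeR R * measurableTypeR R) : measurableTypeR R
  := w.1.
Definition procY (w : measurableTypeR R * measurableTypeR R) : measurableTypeR R
  := w.2.

(* Equality of laws is required on measurable sets only: a measure of the
   library is a function on all sets, unspecified on nonmeasurable ones. *)
Definition has_law P (Z : measurableTypeR R * measurableTypeR R ->
    measurableTypeR R) mu : Prop :=
  forall A : set (measurableTypeR R), measurable A ->
    pushforward P Z A = mu A.

(* Z is a version of the conditional expectation of the integrable variable V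
   given the sigma-algebra generated by U. *)
Definition is_condexp d (T : measurableType d) (P : probability T R)
    (V U Z : T -> measurableTypeR R) : Prop :=
  let sigmaU := preimage_set_system [set: T] U measurable in
  [/\ P.-integrable [set: T] (fun w => (V w : R)%:E),
      P.-integrable [set: T] (fun w => (Z w : R)%:E),
      forall B : set (measurableTypeR R), measurable B -> sigmaU (Z @^-1` B)
    & forall A : set T, sigmaU A ->
        \int[P]_(w in A) (Z w : R)%:E = \int[P]_(w in A) (V w : R)%:E].

Definition martingale_couplings mu nu : set (probR2 R) :=
  [set P | [/\ has_law P procX mu, has_law P procY nu
             & is_condexp P procY procX procX]].

Definition expected_cost c P : \bar R :=
  'E_P[fun w => c (procX w) (procY w)].

(* The value may be -oo; then every element of martingale_couplings mu nu
   attains the supremum. *)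
Definition mot_value mu nu c : \bar R :=
  ereal_sup [set expected_cost c P | P in martingale_couplings mu nu].

Definition mot_solution mu nu c P : Prop :=
  martingale_couplings mu nu P /\ expected_cost c P = mot_value mu nu c.

Definition strictly_convex (f : R -> R) : Prop :=
  forall t y0 y1 : R, (0 < t < 1)%R -> y0 <> y1 ->
    (f (t * y0 + (1 - t) * y1) < t * f y0 + (1 - t) * f y1)%R.

Definition partial_x c (x y : R) : R := derive1 (c ^~ y) x.

Definition spence_mirrlees c : Prop :=
  [/\ measurable_fun [set: measurableTypeR R * measurableTypeR R]
        ((fun w => c w.1 w.2)
           : measurableTypeR R * measurableTypeR R -> measurableTypeR R),
      forall x y : R, derivable (c ^~ y : R -> R) x (1%R : R),
      forall y : R, continuous (partial_x c ^~ y)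
    & forall x : R, strictly_convex (partial_x c x)].

Definition left_monotone P : Prop :=
  exists Gamma : set (measurableTypeR R * measurableTypeR R),
    [/\ measurable Gamma, P Gamma = 1
      & forall x y0 y1 x' y' : R,
          Gamma (x, y0) -> Gamma (x, y1) -> Gamma (x', y') ->
          (x < x')%R -> ~ (y0 < y' < y1)%R].

End martingale_transport.

(* Main.v *)
Require Import Defs.
From HB Require Import structures.
From mathcomp Require Import all_boot all_order all_algebra.
From mathcomp Require Import all_classical all_reals all_analysis.
From mathcomp Require Import measurable_realfun.
From mathcomp Require Import ring lra.

(** Optimal couplings are left-monotone because a coupling that is not can be
    improved by exchanging mass. Left-monotonicity fails only if, for some
    rational [s < t] and [q], the mass over the abscissae [x < q] charges both
    sides of the interval from [s] to [t], while some mass over [x' > q] falls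
    inside it ([left_monotone_of_null_sets]). Draw two independent points [(x, y)]
    and [(x', y')] from such a coupling, with [y] outside and [y'] inside the
    interval, and let them exchange their second coordinates with a small
    probability [W]. The marginals do not change. If [W] weights the exchanges with
    a point below and with a point above according to their effect on the
    barycentres, the martingale property is kept as well: [y - y'] times [W] then
    integrates to 0 against every product of functions of [x] and of [x']
    ([balanced_swap_exists], [swapped_coupling]). The expected cost increases by the
    integral of [W * (h y - h y')] with [h = c x' - c x]. By the Spence-Mirrlees
    condition [h] is strictly convex, so that it is below its chord inside the
    interval and above it outside, and [h y - h y'] exceeds the slope of the chord
    times [y - y'] ([strictly_convex_gap]). The latter contributes 0 by balance.
    Hence an optimal coupling forces [W] to vanish ([optimal_swap_null]), and with
    it one of the masses above.

    The weights are conditional densities, given the first coordinate, of bounded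
    payoffs, multiplied by a positive function of [x] that makes them bounded. The
    crossed payoffs [c x y'] and [c x' y], which are bounded above through [a] and
    [b], are bounded below by the estimate of the gain, hence integrable.

    Existence holds without any cost function: the left-curtain coupling is built
    directly. Let [G] be the quantile function of [mu] and let [excess u] be the put
    function of [nu] minus that of the part of [mu] carried by the levels below
    [u]. Its lower convex envelope [hull (excess u)] is the put function of what
    remains of [nu] once these levels have been transported. The mass at level [u]
    goes to the ends of the maximal interval around [G u] over which the envelope
    is affine and below the excess, in the proportion that keeps the barycentre
    ([bracket], [curtain_bracket]). Estimates of the envelope at two levels, with
    an error of second order, show that it decreases at the rate given by the put
    function of this two-point law ([hull_excess_increment],
    [integral_of_monotone_increments]); as it decreases from the put function of
    [nu] to 0, the second marginal has the put function of [nu], hence is [nu]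
    ([integral_curtain_put], [left_curtain_procY]). A point where the excess touches
    its envelope remains one at all lower levels ([contact_antimono]); this gives
    the measurability of the construction and its left-monotonicity. *)

Set Implicit Arguments.
Unset Strict Implicit.
Unset Printing Implicit Defensive.

Import Order.TTheory GRing.Theory Num.Theory.
Import numFieldNormedType.Exports.

Local Open Scope classical_set_scope.
Local Open Scope ring_scope.

(** * Support lines and brackets *)

Section support_lines.
Context {R : realType}.
Implicit Types (f : R -> R) (a b g k s z : R).

Definition support_line f k s := forall z, f k + s * (z - k) <= f z.

Lemma support_line_mono f k k' s s' :
  support_line f k s -> support_line f k' s' -> s < s' -> k <= k'.
Proof.
move=> /(_ k') h /(_ k) h' ss'; rewrite leNgt; apply/negP => kk'.
have : 0 < (s' - s) * (k - k') by apply: mulr_gt0; lra.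
nra.
Qed.

(** Touching points and slopes pass to the limit, so suprema and infima of
    touching points are touching points. *)
Lemma support_line_closed f a s : continuous f ->
  (forall e, 0 < e -> exists k s', [/\ `|k - a| < e, `|s' - s| < e
     & support_line f k s']) -> support_line f a s.
Proof.
move=> cf happ z; rewrite leNgt; apply/negP => hlt.
pose d := (f a + s * (z - a) - f z) / 3.
have d0 : 0 < d by rewrite /d; lra.
have /cvgrPdist_lt /(_ _ d0) [e /= e0 he] := cf a.
(* Moving the line costs |s' - s| |z - a|, |s' - s| |k - a| and |s| |k - a|, in all
   at most B times the tolerance m. *)
pose B := `|z - a| + `|s| + 1.
have B0 : 0 < B by rewrite /B; have := normr_ge0 (z - a); have := normr_ge0 s; lra.
pose m := Num.min e (Num.min 1 (d / B)).
have m0 : 0 < m by rewrite /m !lt_min e0 ltr01 divr_gt0.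
have [k [s' [ka s's hk]]] := happ _ m0.
have me : m <= e by rewrite /m ge_min lexx.
have m1 : m <= 1 by rewrite /m !ge_min lexx !orbT.
have mB : m * B <= d by rewrite -ler_pdivlMr// /m !ge_min lexx !orbT.
have hfk : `|f a - f k| < d.
  by apply: he => /=; rewrite distrC; exact: lt_le_trans ka me.
have := hk z.
have : s * (z - a) - s' * (z - k) <= d.
  have -> : s * (z - a) - s' * (z - k) =
    (s - s') * (z - a) + (s - s') * (a - k) + s * (k - a) by ring.
  apply: le_trans mB; apply: le_trans (ler_norm _) _.
  apply: le_trans (ler_normD _ _) _; apply: le_trans (lerD (ler_normD _ _) (lexx _)) _.
  rewrite !normrM (distrC s) (distrC a).
  have h1 : `|s' - s| * `|z - a| <= m * `|z - a| by apply: ler_wpM2r => //; exact: ltW.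
  have h2 : `|s' - s| * `|k - a| <= m * 1.
    by apply: ler_pM => //; [exact: ltW | exact: le_trans (ltW ka) m1].
  have h3 : `|s| * `|k - a| <= m * `|s| by rewrite mulrC; apply: ler_wpM2r => //; exact: ltW.
  by rewrite /B; lra.
move: hfk; rewrite ltr_norml => /andP[h1 h2]; rewrite /d in h1 h2 *; lra.
Qed.

(** The function [f x - s * x] tends to infinity on both sides, hence has a
    minimum, and its minimizers are the touching points of slope [s]. *)
Lemma support_line_exists f r J s : continuous f -> (forall x, 0 <= f x) ->
  (forall x, r * x - J <= f x) -> 0 < s < r ->
  exists k, support_line f k s.
Proof.
move=> cf f0 fr /andP[s0 sr].
pose N := 1 + `|f 0| / s; pose M := 1 + (`|f 0| + `|J|) / (r - s).
have N0 : - N <= 0.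
  have : 0 <= `|f 0| / s by apply: divr_ge0 => //; exact: ltW.
  by rewrite /N; lra.
have M0 : 0 <= M.
  have : 0 <= (`|f 0| + `|J|) / (r - s).
    by apply: divr_ge0; [exact: addr_ge0 | lra].
  by rewrite /M; lra.
pose h x := f x - s * x.
have ch : continuous h.
  by move=> x; apply: cvgB; [exact: cf | apply: cvgM; [exact: cvg_cst | exact: cvg_id]].
have [k kin hk] := EVT_min (le_trans N0 M0) (continuous_subspaceT ch).
have h0 : h k <= f 0.
  by have := hk 0; rewrite in_itv/= N0 M0 => /(_ isT); rewrite {2}/h mulr0 subr0.
exists k => z; suff : h k <= h z by rewrite /h; lra.
have fle : f 0 <= `|f 0| by exact: ler_norm.
have Jle : J <= `|J| by exact: ler_norm.
have [zN|Nz] := ltP z (- N).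
  apply: le_trans h0 _; rewrite /h.
  have : s * z < s * (- N) by rewrite ltr_pM2l.
  rewrite /N mulrN mulrDr mulr1 mulrCA divff ?mulr1; last by lra.
  by have := f0 z; lra.
have [zM|Mz] := leP z M; first by apply: hk; rewrite in_itv/= Nz zM.
apply: le_trans h0 _; rewrite /h.
have : (r - s) * M < (r - s) * z by rewrite ltr_pM2l//; lra.
rewrite /M mulrDr mulr1 mulrCA divff ?mulr1; last by lra.
by have := fr z; lra.
Qed.

(** The interval from [a] to [b] is the one around [g] over which the convex
    hull of [f] is affine and lies below [f]. It shrinks to the point [g] when
    the hull touches [f] there. *)
Definition bracket f g a b s :=
  [/\ a <= g <= b, support_line f a s, support_line f b s,
      forall k s', a < k < b -> ~ support_line f k s'
    & a < b -> a < g < b].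

(** The touching points of slope [s] nearest to [g] on either side will do: as
    slopes increase with touching points, a touching point between them would
    have slope [s] as well. *)
Lemma bracket_of_tangent f g s a b : continuous f ->
  a <= g -> g <= b -> support_line f a s -> support_line f b s ->
  exists a b, bracket f g a b s.
Proof.
move=> cf ag gb fa fb.
pose A := [set k | k <= g /\ support_line f k s].
pose B := [set k | g <= k /\ support_line f k s].
have hA : has_sup A by split; [exists a | exists g => x []].
have hB : has_inf B by split; [exists b | exists g => x []].
have Asup : support_line f (sup A) s.
  apply: support_line_closed => // e e0.
  have [k [kg kA] hk] := sup_adherent e0 hA.
  exists k, s; split => //; last by rewrite subrr normr0.
  have : k <= sup A by apply: ub_le_sup => //; exact: hA.2.
  by move=> ?; rewrite distrC ger0_norm; lra.
have Binf : support_line f (inf B) s.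
  apply: support_line_closed => // e e0.
  have [k [kg kB] hk] := inf_adherent e0 hB.
  exists k, s; split => //; last by rewrite subrr normr0.
  have : inf B <= k by apply: ge_inf => //; exact: hB.2.
  by move=> ?; rewrite ger0_norm; lra.
have Ag : sup A <= g by apply: ge_sup => [|x []//]; exact: hA.1.
have gB : g <= inf B by apply: lb_le_inf => [|x []//]; exact: hB.1.
have Amax k : k <= g -> support_line f k s -> k <= sup A.
  by move=> *; apply: ub_le_sup => //; exact: hA.2.
have Bmin k : g <= k -> support_line f k s -> inf B <= k.
  by move=> *; apply: ge_inf => //; exact: hB.2.
exists (sup A), (inf B); split => //; first by rewrite Ag gB.
  move=> k s' /andP[ak kb] hk.
  have s's : s' = s.
    apply/eqP; rewrite eq_le; apply/andP; split; rewrite leNgt; apply/negP => ss'.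
      by have := support_line_mono Binf hk ss'; lra.
    by have := support_line_mono hk Asup ss'; lra.
  rewrite {}s's in hk.
  have [kg|gk] := leP k g; first by have := Amax _ kg hk; lra.
  by have := Bmin _ (ltW gk) hk; lra.
move=> ab; rewrite !lt_neqAle Ag gB !andbT; apply/andP; split; apply/eqP => e.
  have := Bmin (sup A); rewrite e lexx => /(_ isT); rewrite -{1}e => /(_ Asup).
  by move=> ?; lra.
have := Amax (inf B); rewrite -e lexx => /(_ isT); rewrite {1}e => /(_ Binf).
by move=> ?; lra.
Qed.

(** The slope is the supremum of the slopes between 0 and [r] that touch on the
    left of [g]. By closedness it touches on the left of [g], and, as the larger
    slopes touch on the right only, it touches there too. The last three
    hypotheses settle the extreme slopes 0 and [r], for which a minimum may not
    be attained. *)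
Lemma bracket_exists f g r J : continuous f -> 0 < r -> (forall x, 0 <= f x) ->
  (forall x, r * x - J <= f x) ->
  (forall e, 0 < e -> exists x, f x < e) ->
  (forall b, g < b -> 0 < f b) ->
  (forall e, 0 < e -> exists x, f x <= r * (x - g) + e) ->
  exists a b s, bracket f g a b s.
Proof.
move=> cf r0 f0 fr finf fpos ftop.
have main : exists s a b, [/\ a <= g, g <= b, support_line f a s & support_line f b s].
  pose S := [set s | 0 < s < r /\ exists2 k, k <= g & support_line f k s].
  pose K := [set k | k <= g /\ exists2 s, 0 < s < r & support_line f k s].
  (* Without touching points on the left of g for slopes in ]0, r[, take slope 0. *)
  pose s0 := if `[< S !=set0 >] then sup S else 0.
  have s0r : 0 <= s0 <= r.
    rewrite /s0; case: asboolP => [[s [sr hs]]|_]; last by rewrite lexx ltW.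
    apply/andP; split.
      apply: le_trans (_ : s <= _); first by case/andP: sr => /ltW.
      by apply: ub_le_sup => //; exists r => x [/andP[? /ltW]].
    by apply: ge_sup; [exists s|by move=> x [/andP[? /ltW]]].
  have hleft : 0 < s0 -> exists2 a, a <= g & support_line f a s0.
    rewrite /s0; case: asboolP => [S0 _|_]; last by rewrite ltxx.
    have hS : has_sup S by split => //; exists r => x [/andP[? /ltW]].
    have hK : has_sup K.
      split; last by exists g => x [].
      by case: S0 => s [sr [k kg hk]]; exists k; split=> //; exists s.
    have Kg : sup K <= g by apply: ge_sup => [|x []//]; exact: hK.1.
    exists (sup K) => //; apply: support_line_closed => // e e0.
    have [s1 [s1r [k1 k1g hk1]] hs1] := sup_adherent e0 hS.
    have [k2 [k2g [s2 s2r hk2]] hk2'] := sup_adherent e0 hK.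
    have k1K : k1 <= sup K by apply: ub_le_sup; [exact: hK.2|split=> //; exists s1].
    have k2K : k2 <= sup K by apply: ub_le_sup; [exact: hK.2|split=> //; exists s2].
    have s1S : s1 <= sup S by apply: ub_le_sup; [exact: hS.2|split=> //; exists k1].
    have s2S : s2 <= sup S by apply: ub_le_sup; [exact: hS.2|split=> //; exists k2].
    have [s12|s21] := leP s1 s2.
      exists k2, s2; split => //; rewrite distrC ger0_norm; lra.
    have k21 := support_line_mono hk2 hk1 s21.
    by exists k1, s1; split => //; rewrite distrC ger0_norm; lra.
  have hright : s0 < r -> exists2 b, g <= b & support_line f b s0.
    move=> s0lt.
    have big s k : s0 < s < r -> support_line f k s -> g <= k.
      move=> /andP[s0s sr] hk; rewrite leNgt; apply/negP => kg.
      have sS : S s.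
        by split; [lra|exists k => //; exact: ltW].
      move: s0s; rewrite /s0; case: asboolP => [S0|+ _]; last by apply; exists s.
      rewrite ltNge => /negP; apply; apply: ub_le_sup => //.
      by exists r => x [/andP[? /ltW]].
    pose K' := [set k | exists2 s, s0 < s < r & support_line f k s].
    have ex s : s0 < s < r -> exists k, support_line f k s.
      by move=> /andP[? ?]; apply: (support_line_exists cf f0 fr); lra.
    have hK : has_inf K'.
      split.
        have [|k hk] := ex ((s0 + r) / 2); first lra.
        by exists k; exists ((s0 + r) / 2) => //; lra.
      by exists g => x [s sr hk]; exact: big hk.
    have gK : g <= inf K'.
      by apply: lb_le_inf => [|x [s sr hk]]; [exact: hK.1|exact: big hk].
    exists (inf K') => //; apply: support_line_closed => // e e0.
    pose s1 := Num.min (s0 + e / 2) ((s0 + r) / 2).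
    have s1r : s0 < s1 < r.
      rewrite /s1 lt_min gt_min; apply/andP; split; first by apply/andP; split; lra.
      by apply/orP; right; lra.
    have s1e : s1 < s0 + e by rewrite /s1 gt_min; apply/orP; left; lra.
    have [k1 hk1] := ex _ s1r.
    have [k2 [s2 s2r hk2] hk2'] := inf_adherent e0 hK.
    have k1K : inf K' <= k1 by apply: ge_inf; [exact: hK.2|exists s1].
    have k2K : inf K' <= k2 by apply: ge_inf; [exact: hK.2|exists s2].
    have [s12|s21] := leP s2 s1.
      by exists k2, s2; split => //; rewrite ger0_norm; lra.
    have k21 := support_line_mono hk1 hk2 s21.
    by exists k1, s1; split => //; rewrite ger0_norm; lra.
  have [s00|s0pos] := leP s0 0.
    have s0E : s0 = 0 by lra.
    have [|b gb hb] := hright; first lra.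
    have fb0 : f b <= 0.
      rewrite leNgt; apply/negP => /finf[x].
      by have := hb x; rewrite s0E mul0r addr0; lra.
    have bg : b = g.
      apply/eqP; rewrite eq_le gb andbT leNgt; apply/negP => /fpos; lra.
    by exists s0, b, b; split => //; rewrite bg.
  have [a ag ha] := hleft s0pos.
  have [s0r'|rs0] := ltP s0 r.
    have [b gb hb] := hright s0r'.
    by exists s0, a, b.
  have s0E : s0 = r by lra.
  have fa : f a <= r * (a - g).
    rewrite leNgt; apply/negP => h.
    have [|x hx] := ftop ((f a - r * (a - g)) / 2); first lra.
    have := ha x; rewrite s0E; lra.
  have ga : g <= a.
    by have := f0 a; rewrite leNgt => ?; apply/negP => ?; nra.
  by exists s0, a, a.
have [s [a [b [ag gb ha hb]]]] := main.
have [a' [b' h]] := bracket_of_tangent cf ag gb ha hb.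
by exists a', b', s.
Qed.

End support_lines.

(** * Convex hulls *)

Section hull.
Context {R : realType}.
Implicit Types (f : R -> R) (a b g k s z : R).

Definition pos_part z := Num.max 0 z.

Lemma pos_part_ge0 z : 0 <= pos_part z.
Proof. by rewrite /pos_part le_max lexx. Qed.

Lemma pos_part_ge z : z <= pos_part z.
Proof. by rewrite /pos_part le_max lexx orbT. Qed.

Lemma pos_partE z : 0 <= z -> pos_part z = z.
Proof. by move=> h; rewrite /pos_part; apply/max_idPr. Qed.

Lemma pos_part0 z : z <= 0 -> pos_part z = 0.
Proof. by move=> h; rewrite /pos_part; apply/max_idPl. Qed.

Definition minorants f k := [set l | exists s, forall z, l + s * (z - k) <= f z].

(** Lower convex envelope. *)
Definition hull f k := sup (minorants f k).

Lemma minorants_ub f k : ubound (minorants f k) (f k).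
Proof. by move=> l [s /(_ k)]; rewrite subrr mulr0 addr0. Qed.

Lemma hull_ub f k l : minorants f k l -> l <= hull f k.
Proof. by move=> h; apply: ub_le_sup => //; exists (f k); exact: minorants_ub. Qed.

Lemma hull_le f k x : (forall z, 0 <= f z) ->
  (forall l, minorants f k l -> l <= x) -> hull f k <= x.
Proof.
move=> f0 h; apply: ge_sup; last by move=> l /h.
by exists 0, 0 => z; rewrite mul0r addr0.
Qed.

Lemma hull_ge0 f k : (forall z, 0 <= f z) -> 0 <= hull f k.
Proof. by move=> f0; apply: hull_ub; exists 0 => z; rewrite mul0r addr0. Qed.

Lemma hull_le_chord f k a b : (forall z, 0 <= f z) -> a < b -> a <= k <= b ->
  hull f k <= ((b - k) * f a + (k - a) * f b) / (b - a).
Proof.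
move=> f0 ab /andP[ak kb]; apply: hull_le => // l [s hl].
rewrite ler_pdivlMr; last by lra.
by have := hl a; have := hl b; nra.
Qed.

(** The put function of the law with mean [g] carried by [a] and [b]. *)
Definition two_point_put g a b k : R :=
  if a < b then ((b - g) * pos_part (k - a) + (g - a) * pos_part (k - b)) / (b - a)
  else pos_part (k - g).

Lemma two_point_put_lo g a b k : a <= g <= b -> k <= a -> two_point_put g a b k = 0.
Proof.
move=> gab ka; rewrite /two_point_put; case: ifP => [ab|_]; last by rewrite pos_part0; lra.
by rewrite !pos_part0; [rewrite !mulr0 add0r mul0r| lra..].
Qed.

Lemma two_point_put_hi g a b k : a <= g <= b -> b <= k -> two_point_put g a b k = k - g.
Proof.
move=> gab ka; rewrite /two_point_put; case: ifP => [ab|_]; last by rewrite pos_partE; lra.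
rewrite !pos_partE; [|lra..].
by field; lra.
Qed.

Lemma two_point_put_mid g a b k : a < k < b ->
  two_point_put g a b k = (b - g) * (k - a) / (b - a).
Proof.
move=> /andP[ak kb]; rewrite /two_point_put (lt_trans ak kb) pos_partE; last by lra.
by rewrite pos_part0 ?mulr0 ?addr0//; lra.
Qed.

(** When [f] loses at least [d * pos_part (z - g')], its hull loses at least [d]
    times the put value of the two-point law on the bracket of [f], up to an
    error of order [d * (g' - g)]. Outside the bracket an affine minorant of [f']
    is turned into one of [f]; inside it, the hull of [f] is the chord, and the
    minorant is estimated at both ends. *)
Lemma hull_step_up f f' g g' a b s d k : (forall z, 0 <= f' z) ->
  bracket f g a b s -> 0 <= d -> g <= g' ->
  (forall z, f' z + d * pos_part (z - g') <= f z) ->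
  hull f' k <= hull f k - d * two_point_put g a b k + d * (g' - g).
Proof.
move=> f'0 [gab ha hb _ _] d0 gg' ff'.
have f'f z : f' z <= f z.
  apply: le_trans (ff' z); rewrite lerDl; apply: mulr_ge0 => //; exact: pos_part_ge0.
have dg0 : 0 <= d * (g' - g) by apply: mulr_ge0; lra.
apply: hull_le => // l [s' hl].
have [ka|ak] := leP k a.
  rewrite two_point_put_lo//.
  have : l <= hull f k by apply: hull_ub; exists s' => z; exact: le_trans (hl z) (f'f z).
  by lra.
have [bk|kb] := leP b k.
  rewrite two_point_put_hi//.
  have : l + d * (k - g') <= hull f k.
    apply: hull_ub; exists (s' + d) => z; apply: le_trans (ff' z).
    have := hl z; have : d * (z - g') <= d * pos_part (z - g').
      by apply: ler_wpM2l => //; exact: pos_part_ge.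
    by lra.
  by lra.
rewrite two_point_put_mid; last by rewrite ak kb.
have hk : f a + s * (k - a) <= hull f k.
  by apply: hull_ub; exists s => z; apply: le_trans (ha z); lra.
have h1 := le_trans (hl a) (f'f a).
have h2 : l + s' * (b - k) + d * (b - g') <= f b.
  apply: le_trans (ff' b); apply: lerD (hl b) _.
  by apply: ler_wpM2l => //; exact: pos_part_ge.
have ab : 0 < b - a by lra.
suff : l + d * (b - g) * (k - a) / (b - a) <= f a + s * (k - a) + d * (g' - g) by rewrite !mulrA; lra.
have fb : f b <= f a + s * (b - a) by have := hb a; lra.
rewrite -(ler_pM2r ab) [X in X <= _]mulrDl divfK; last by lra.
have e1 : 0 <= (k - a) * (f a + s * (b - a) - (l + s' * (b - k) + d * (b - g'))).
  by apply: mulr_ge0; lra.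
have e2 : 0 <= (b - k) * (f a - (l + s' * (a - k))) by apply: mulr_ge0; lra.
have e3 : 0 <= (b - k) * (d * (g' - g)) by apply: mulr_ge0; lra.
by lra.
Qed.

(** The opposite direction is estimated with the bracket of the same function [f],
    so that both directions bound the increments of the hull by the put value at
    the starting point. *)
Lemma hull_step_down f f' g g' a b s d k : (forall z, 0 <= f' z) ->
  bracket f g a b s -> 0 <= d -> g' <= g ->
  (forall z, f' z <= f z + d * pos_part (z - g')) ->
  hull f' k <= hull f k + d * two_point_put g a b k + d * (g - g').
Proof.
move=> f'0 [gab ha hb _ _] d0 gg' ff'.
have dg0 : 0 <= d * (g - g') by apply: mulr_ge0; lra.
apply: hull_le => // l [s' hl].
have [ka|ak] := leP k a.
  rewrite two_point_put_lo// mulr0 addr0.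
  have lo z : z <= a -> l + s' * (z - k) - d * (g - g') <= f z.
    move=> za; have := hl z; have := ff' z.
    have : d * pos_part (z - g') <= d * (g - g').
      by apply: ler_wpM2l => //; rewrite /pos_part ge_max; apply/andP; split; lra.
    by lra.
  have [s's|ss'] := leP s' s.
    suff : l - d * (g - g') <= hull f k by lra.
    apply: hull_ub; exists s' => z.
    have [za|az] := leP z a; first by have := lo z za; lra.
    have := lo a (lexx a); have := ha z.
    have : s' * (z - a) <= s * (z - a) by apply: ler_wpM2r; lra.
    by lra.
  have : f a + s * (k - a) <= hull f k.
    by apply: hull_ub; exists s => z; apply: le_trans (ha z); lra.
  have := lo a (lexx a).
  have : s * (a - k) <= s' * (a - k) by apply: ler_wpM2r; lra.
  by lra.
have [bk|kb] := leP b k.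
  rewrite two_point_put_hi//.
  have hi z : b <= z -> l + s' * (z - k) - d * (z - g') <= f z.
    move=> bz; have := hl z; have := ff' z.
    by rewrite pos_partE; lra.
  have [s's|ss'] := leP s (s' - d).
    suff : l - d * (k - g') <= hull f k by lra.
    apply: hull_ub; exists (s' - d) => z.
    have [za|az] := leP b z; first by have := hi z za; lra.
    have := hi b (lexx b); have := hb z.
    have : s * (b - z) <= (s' - d) * (b - z) by apply: ler_wpM2r; lra.
    by lra.
  have : f b + s * (k - b) <= hull f k.
    by apply: hull_ub; exists s => z; apply: le_trans (hb z); lra.
  have := hi b (lexx b).
  have : (s' - d) * (k - b) <= s * (k - b) by apply: ler_wpM2r; lra.
  by lra.
rewrite two_point_put_mid; last by rewrite ak kb.
have hk : f a + s * (k - a) <= hull f k.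
  by apply: hull_ub; exists s => z; apply: le_trans (ha z); lra.
have h1 : l + s' * (a - k) <= f a + d * (g - g').
  have := hl a; have := ff' a.
  have : d * pos_part (a - g') <= d * (g - g').
    by apply: ler_wpM2l => //; rewrite /pos_part ge_max; apply/andP; split; lra.
  by lra.
have h2 : l + s' * (b - k) - d * (b - g') <= f b.
  by have := hl b; have := ff' b; rewrite pos_partE; lra.
have ab : 0 < b - a by lra.
suff : l <= f a + s * (k - a) + d * (g - g') + d * (b - g) * (k - a) / (b - a) by rewrite !mulrA; lra.
have fb : f b <= f a + s * (b - a) by have := hb a; lra.
rewrite -(ler_pM2r ab) [X in _ <= X]mulrDl divfK; last by lra.
have e1 : 0 <= (k - a) * (f a + s * (b - a) - (l + s' * (b - k) - d * (b - g'))).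
  by apply: mulr_ge0; lra.
have e2 : 0 <= (b - k) * (f a + d * (g - g') - (l + s' * (a - k))) by apply: mulr_ge0; lra.
by lra.
Qed.

End hull.

(** * A primitive from estimates of increments *)

Section telescoping.
Context {R : realType}.

(** On a subdivision into equal steps the right-hand sides telescope to the step
    times [M be - M al], which tends to 0. *)
Lemma telescoping_constant (psi M : R -> R) (al be : R) : al <= be ->
  (forall u v, al <= u -> u <= v -> v <= be ->
     `|psi v - psi u| <= (v - u) * (M v - M u)) ->
  psi be = psi al.
Proof.
move=> ab h; apply/eqP; rewrite -subr_eq0 -normr_le0 leNgt; apply/negP => lt0.
have h' n : `|psi be - psi al| <= (be - al) / n.+1%:R * (M be - M al).
  pose d := (be - al) / n.+1%:R.
  have n0 : 0 < n.+1%:R :> R by rewrite ltr0n.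
  have d0 : 0 <= d by apply: divr_ge0; [lra | exact: ltW].
  pose t i := al + d * i%:R.
  have dn : d * n.+1%:R = be - al by rewrite /d divfK// lt0r_neq0.
  have tle i : (i <= n.+1)%N -> t i <= be.
    move=> i_n; have : d * i%:R <= d * n.+1%:R by apply: ler_wpM2l => //; rewrite ler_nat.
    by rewrite /t; lra.
  have : forall i, (i <= n.+1)%N -> `|psi (t i) - psi al| <= d * (M (t i) - M al).
    elim => [_|i IH i_n]; first by rewrite /t mulr0 addr0 !subrr normr0 mulr0.
    have := IH (ltnW i_n).
    have tS : t i.+1 - t i = d by rewrite /t -natr1; lra.
    have := h (t i) (t i.+1); rewrite tS => h1.
    have t0 : al <= t i by rewrite /t lerDl; apply: mulr_ge0.
    have := h1 t0; have -> : t i <= t i.+1 by lra.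
    move=> /(_ isT (tle _ i_n)) h2 h3.
    have := ler_normD (psi (t i.+1) - psi (t i)) (psi (t i) - psi al).
    by rewrite addrA subrK; lra.
  by move=> /(_ _ (leqnn _)); have -> : t n.+1 = be by rewrite /t dn; lra.
pose x := `|psi be - psi al|; pose B := (be - al) * (M be - M al).
have [n hn] : exists n : nat, B / x < n.+1%:R.
  exists (Num.truncn (B / x)); exact: truncnS_gt.
have := h' n; rewrite mulrAC leNgt => /negP; apply.
by rewrite ltr_pdivrMr ?ltr0n// -/B mulrC -ltr_pdivrMr.
Qed.

Lemma nondecreasing_on_measurable (D : set R) (f : R -> R) : is_interval D ->
  (forall x y, D x -> D y -> x <= y -> f x <= f y) -> measurable_fun D f.
Proof.
move=> iD fD; apply: (measurability (@RGenCInfty.G R)) => [|/= _ [_] [r] -> <-].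
  exact: RGenCInfty.measurableE.
apply: is_interval_measurable => s t/= [Ds rs] [Dt rt] z szt.
have Dz : D z by exact: (iD s t).
split=> //; move: rs; rewrite !in_itv/= !andbT => /le_trans; apply.
by apply: fD => //; case/andP: szt.
Qed.

Let unit_itv (u : R) := 0 < u < 1.

(** Adding the hypothesis to the one with [u] and [v] exchanged shows that
    [p + 2 * G] is nondecreasing, which makes [p] measurable. Then [h] plus a
    primitive of [p] has increments of second order, hence is constant. *)
Lemma integral_of_monotone_increments (h p G : R -> R) :
  (forall u, unit_itv u -> 0 <= p u) ->
  (forall u v, unit_itv u -> unit_itv v -> u <= v -> G u <= G v) ->
  (forall u v, unit_itv u -> unit_itv v ->
     h v - h u + (v - u) * p u <= `|v - u| * `|G v - G u|) ->
  measurable_fun `]0:R, 1[%classic p /\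
  forall al be, 0 < al -> al <= be -> be < 1 ->
    (\int[lebesgue_measure]_(u in `]al, be]) (p u)%:E = (h al - h be)%:E)%E.
Proof.
move=> p0 Gnd key.
have key' u v : unit_itv u -> unit_itv v -> u <= v ->
    [/\ G u <= G v, h v - h u <= (v - u) * (G v - G u - p u) &
        - ((v - u) * (G v - G u + p v)) <= h v - h u].
  move=> iu iv uv; have Guv := Gnd _ _ iu iv uv; split => //.
    by have := key u v iu iv; rewrite !ger0_norm; lra.
  have := key v u iv iu; rewrite (distrC u) (distrC (G u)) !ger0_norm; lra.
have mono u v : unit_itv u -> unit_itv v -> u <= v ->
    p u + 2 * G u <= p v + 2 * G v.
  move=> iu iv; rewrite le_eqVlt => /predU1P[->//|uv].
  have [_ h1 h2] := key' u v iu iv (ltW uv).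
  have : 0 <= (v - u) * (2 * (G v - G u) + p v - p u) by lra.
  by rewrite pmulr_rge0; lra.
have mp : measurable_fun `]0:R, 1[%classic p.
  have -> : p = (fun u => (p u + 2 * G u) - 2 * G u).
    by apply/funext => u; rewrite addrK.
  have i01 : is_interval (`]0, 1[ : set R) by exact: interval_is_interval.
  apply: measurable_funB.
    apply: nondecreasing_on_measurable => //= x y; rewrite !in_itv/=; exact: mono.
  apply: nondecreasing_on_measurable => //= x y; rewrite !in_itv/= => ix iy xy.
  by have := Gnd _ _ ix iy xy; lra.
split => // al be al0 ab be1.
pose J (u v : R) := (\int[lebesgue_measure]_(w in `]u, v]) (p w)%:E)%E.
have sub (u v : R) : 0 < u -> v < 1 -> `]u, v] `<=` `]0, 1[.
  move=> u0 v1 x /=; rewrite !in_itv/= => /andP[ux xv]; lra.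
have mpuv (u v : R) : 0 < u -> v < 1 -> measurable_fun `]u, v] (EFin \o p).
  move=> u0 v1; apply/measurable_EFinP; apply: measurable_funS mp => //; exact: sub.
have p0uv (u v : R) : 0 < u -> v < 1 -> forall x, `]u, v]%classic x -> (0 <= (p x)%:E)%E.
  by move=> u0 v1 x /(sub _ _ u0 v1)/=; rewrite in_itv/= lee_fin => /p0.
have Jge (u v c : R) : 0 < u -> u <= v -> v < 1 -> 0 <= c ->
    (forall w, u < w <= v -> c <= p w) -> (((v - u) * c)%:E <= J u v)%E.
  move=> u0 uv v1 c0 hc.
  have -> : (((v - u) * c)%:E = \int[lebesgue_measure]_(w in `]u, v]) (cst c%:E) w)%E.
    rewrite integral_cst//= lebesgue_measure_itv/= lte_fin.
    case: ltP => [_|vu]; first by rewrite -EFinB -EFinM mulrC.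
    by rewrite (_ : v - u = 0) ?mul0r ?mule0//; lra.
  apply: ge0_le_integral => //.
  - by apply: mpuv.
have Jle (u v c : R) : 0 < u -> u <= v -> v < 1 -> 0 <= c ->
    (forall w, u < w <= v -> p w <= c) -> (J u v <= ((v - u) * c)%:E)%E.
  move=> u0 uv v1 c0 hc.
  have -> : (((v - u) * c)%:E = \int[lebesgue_measure]_(w in `]u, v]) (cst c%:E) w)%E.
    rewrite integral_cst//= lebesgue_measure_itv/= lte_fin.
    case: ltP => [_|vu]; first by rewrite -EFinB -EFinM mulrC.
    by rewrite (_ : v - u = 0) ?mul0r ?mule0//; lra.
  apply: ge0_le_integral => //.
  - by apply: p0uv.
  - by apply: mpuv.
have i01 u : al <= u -> u <= be -> unit_itv u by rewrite /unit_itv; lra.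
have Jub u v : al <= u -> u <= v -> v <= be ->
    (J u v <= ((v - u) * (p v + 2 * (G v - G u)))%:E)%E.
  move=> au uv vb.
  have Guv : G u <= G v by apply: Gnd => //; apply: i01; lra.
  have pv : 0 <= p v by apply: p0; apply: i01; lra.
  apply: Jle; [lra..|].
  move=> w uwv.
  have [iu iv iw] : [/\ unit_itv u, unit_itv v & unit_itv w] by split; apply: i01; lra.
  have Guw : G u <= G w by apply: Gnd => //; lra.
  have := mono w v iw iv; rewrite (_ : w <= v); last by lra.
  by move=> /(_ isT); lra.
have Jlb u v : al <= u -> u <= v -> v <= be ->
    (((v - u) * (p u - 2 * (G v - G u)))%:E <= J u v)%E.
  move=> au uv vb.
  have Guv : G u <= G v by apply: Gnd => //; apply: i01; lra.
  have [c0|c0] := leP 0 (p u - 2 * (G v - G u)); last first.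
    apply: (@le_trans _ _ 0%E); last by apply: integral_ge0 => x; apply: p0uv; lra.
    by rewrite lee_fin; apply: mulr_ge0_le0; lra.
  apply: Jge; [lra..|].
  move=> w uwv.
  have [iu iv iw] : [/\ unit_itv u, unit_itv v & unit_itv w] by split; apply: i01; lra.
  have Gwv : G w <= G v by apply: Gnd => //; lra.
  have := mono u w iu iw; rewrite (_ : u <= w); last by lra.
  by move=> /(_ isT); lra.
have Jfin u v : al <= u -> u <= v -> v <= be -> J u v \is a fin_num.
  move=> au uv vb; rewrite fin_numE; apply/andP; split.
    by rewrite gt_eqF// (lt_le_trans _ (Jlb _ _ au uv vb))// ltNyr.
  by rewrite lt_eqF// (le_lt_trans (Jub _ _ au uv vb))// ltry.
have JD v u : al <= u -> u <= v -> v <= be -> J al v = (J al u + J u v)%E.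
  move=> au uv vb; rewrite /J.
  rewrite (@itv_bndbnd_setU _ _ (BRight al) (BRight u) (BRight v))//.
  rewrite ge0_integral_setU//.
  - by rewrite -(@itv_bndbnd_setU _ _ (BRight al) (BRight u) (BRight v))//; apply: mpuv; lra.
  - by rewrite -(@itv_bndbnd_setU _ _ (BRight al) (BRight u) (BRight v))//; apply: p0uv; lra.
  - apply/disj_setPS => x [/=]; rewrite !in_itv/= => /andP[_ xu] /andP[ux _]; lra.
pose psi v := h v + fine (J al v).
have J0 : J al al = 0%E by rewrite /J set_itvoc0 integral_set0.
have : psi be = psi al.
  apply: (@telescoping_constant _ (fun u => p u + 3 * G u)) => // u v au uv vb.
  have [Guv h1 h2] := key' u v (i01 u au (le_trans uv vb)) (i01 v (le_trans au uv) vb) uv.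
  have fJ : fine (J al v) - fine (J al u) = fine (J u v).
    rewrite (JD v u)// fineD; first by lra.
    by apply: Jfin => //; exact: le_trans vb.
  exact: Jfin.
  have := Jlb u v au uv vb; have := Jub u v au uv vb.
  rewrite -(fineK (Jfin u v au uv vb)) !lee_fin => j1 j2.
  rewrite ler_norml /psi; apply/andP; split; lra.
rewrite /psi J0 /= addr0 => e.
by rewrite -/(J al be) -(fineK (Jfin al be _ _ _))//; congr EFin; lra.
Qed.

End telescoping.

(** * Put functions and laws on the line *)

Section measurable_inverse.
Context {R : realType}.

Lemma measurable_inv_gt0 : measurable_fun [set: measurableTypeR R]
  ((fun x : R => x^-1) \_ `]0, +oo[%classic : measurableTypeR R -> measurableTypeR R).
Proof.
apply: (iffLR (measurable_restrictT _ _)) => //.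
have i0y : is_interval (`]0, +oo[%classic : set R) by exact: interval_is_interval.
have : measurable_fun (`]0, +oo[%classic : set (measurableTypeR R)) (fun x : R => - x^-1).
  apply: (nondecreasing_on_measurable i0y) => x y; rewrite /= !in_itv/= !andbT => x0 y0 xy.
  by rewrite lerN2 lef_pV2.
move=> h0.
have h : measurable_fun (`]0, +oo[%classic : set (measurableTypeR R)) (fun x : R => - - x^-1).
  exact: measurableT_comp h0.
by apply: eq_measurable_fun h => x _ /=; rewrite opprK.
Qed.

End measurable_inverse.

Section measurable_booleans.
Context {R : realType} d (T : measurableType d).
Implicit Types b : T -> bool.

Lemma measurable_bool_natr b : measurable_fun [set: T] b ->
  measurable_fun [set: T] (fun t => (b t)%:R : R).
Proof.
move=> mb; have -> : (fun t => (b t)%:R : R) = (fun t => if b t then 1 else 0).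
  by apply/funext => t; case: (b t).
by apply: measurable_fun_ifT => //; exact: measurable_cst.
Qed.

Lemma measurable_bool_set b : measurable_fun [set: T] b -> measurable [set t | b t].
Proof. by move=> mb; rewrite -[X in measurable X]setTI; exact: mb. Qed.

End measurable_booleans.

Section laws_on_the_line.
Context {R : realType}.
Implicit Types (m : probR R) (x y k : R).
Local Open Scope ereal_scope.

Lemma eq_probability_of_cdf m m' :
  (forall x, m `]-oo, x]%classic = m' `]-oo, x]%classic) ->
  forall A, measurable A -> m A = m' A.
Proof.
move=> h A mA.
have mC (p : probR R) x : p `]x, +oo[%classic = 1 - p `]-oo, x]%classic.
  rewrite -(@probability_setT _ _ _ p).
  have <- : (~` `]-oo, x]%classic) = `]x, +oo[%classic :> set R by rewrite setCitvl.
  by rewrite probability_setC// probability_setT.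
apply: (@measure_unique _ R (measurableTypeR R) (@RGenOInfty.G R)
  (fun n => `](- n%:R)%R, +oo[%classic) _ _ _ _ m m') => //.
- exact: RGenOInfty.measurableE.
- move=> _ _ [x ->] [y ->]; exists (Num.max x y).
  apply/seteqP; split => z /=; rewrite !in_itv/= !andbT gt_max.
    by move=> [-> ->].
  by move=> /andP[].
- by move=> i; exists (- i%:R)%R.
- rewrite -subTset => z _; exists (Num.truncn `|z|%R).+1 => //=.
  rewrite in_itv/= andbT ltrNl.
  by apply: le_lt_trans (truncnS_gt _); rewrite -normrN ler_norm.
- move=> _ [x ->]; transitivity (1 - m' `]-oo, x]%classic); last by rewrite -mC.
  by rewrite -h -mC.
- by move=> k; rewrite (le_lt_trans (probability_le1 _ _)) ?ltry.
Qed.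

Lemma cdf_right_closed m x (c : \bar R) :
  (forall e : R, (0 < e)%R -> c <= m `]-oo, (x + e)%R]%classic) -> c <= m `]-oo, x]%classic.
Proof.
move=> h.
have -> : `]-oo, x]%classic = \bigcap_n `]-oo, (x + n.+1%:R^-1)%R]%classic :> set R.
  apply/seteqP; split => z /=; rewrite ?in_itv/=.
    move=> zx n _ /=; rewrite in_itv/=; apply: (le_trans zx).
    by rewrite lerDl invr_ge0.
  move=> hz; rewrite leNgt; apply/negP => xz.
  pose n := Num.truncn (z - x)^-1.
  have /= := hz n I; rewrite in_itv/= leNgt => /negP; apply.
  rewrite -ltrBrDl invf_plt ?posrE ?subr_gt0 ?ltr0n//.
  exact: truncnS_gt.
have cvg : m `]-oo, (x + n.+1%:R^-1)%R]%classic @[n --> \oo] -->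
    m (\bigcap_n `]-oo, (x + n.+1%:R^-1)%R]%classic).
  apply: nonincreasing_cvg_mu => //.
  - by rewrite (le_lt_trans (probability_le1 _ _)) ?ltry.
  - exact: bigcapT_measurable.
  - move=> n p np; apply/subsetPset => z /=; rewrite !in_itv/= => /le_trans; apply.
    by rewrite lerD2l lef_pV2 ?posrE ?ltr0n// ler_nat.
rewrite -(cvg_lim _ cvg)//.
apply: lime_ge; first by apply/cvg_ex; eexists; exact: cvg.
by apply: nearW => n; apply: h; rewrite invr_gt0.
Qed.

Lemma cdf_gt m (c : R) : (c < 1)%R -> exists x, c%:E < m `]-oo, x]%classic.
Proof.
move=> c1.
have cvg : m `]-oo, (n%:R : R)]%classic @[n --> \oo] --> m (\bigcup_n `]-oo, (n%:R : R)]%classic).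
  apply: nondecreasing_cvg_mu => //; first exact: bigcup_measurable.
  move=> n p np; apply/subsetPset => z /=; rewrite !in_itv/= => /le_trans; apply.
  by rewrite ler_nat.
apply: contrapT => /forallNP h.
have : m (\bigcup_n `]-oo, (n%:R : R)]%classic) <= c%:E.
  rewrite -(cvg_lim _ cvg)//; apply: lime_le; first by apply/cvg_ex; eexists; exact: cvg.
  by apply: nearW => n; rewrite leNgt; apply/negP; exact: h.
have -> : \bigcup_n `]-oo, (n%:R : R)]%classic = setT :> set R.
  rewrite -subTset => z _; exists (Num.truncn z).+1 => //=.
  by rewrite in_itv/= ltW// truncnS_gt.
by rewrite probability_setT lee_fin leNgt c1.
Qed.

Lemma cdf_lt m (c : R) : (0 < c)%R -> exists x, m `]-oo, x]%classic < c%:E.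
Proof.
move=> c0.
have cvg : m `]-oo, (- n%:R : R)%R]%classic @[n --> \oo] --> m (\bigcap_n `]-oo, (- n%:R : R)%R]%classic).
  apply: nonincreasing_cvg_mu => //.
  - by rewrite (le_lt_trans (probability_le1 _ _)) ?ltry.
  - exact: bigcapT_measurable.
  - move=> n p np; apply/subsetPset => z /=; rewrite !in_itv/= => /le_trans; apply.
    by rewrite lerN2 ler_nat.
apply: contrapT => /forallNP h.
have : c%:E <= m (\bigcap_n `]-oo, (- n%:R : R)%R]%classic).
  rewrite -(cvg_lim _ cvg)//; apply: lime_ge; first by apply/cvg_ex; eexists; exact: cvg.
  by apply: nearW => n; rewrite leNgt; apply/negP; exact: h.
have -> : \bigcap_n `]-oo, (- n%:R : R)%R]%classic = set0 :> set R.
  rewrite -subset0 => z /(_ (Num.truncn (- z)).+1 I) /=.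
  rewrite in_itv/= lerNr leNgt => /negP; apply; exact: truncnS_gt.
by rewrite measure0 lee_fin leNgt c0.
Qed.

Lemma measurable_pos_part d (T : measurableType d) (D : set T) (f : T -> R) :
  measurable_fun D f -> measurable_fun D (fun w => pos_part (f w)).
Proof. by move=> mf; apply: measurable_funD_maxr || apply: measurable_maxr => //; exact: measurable_cst. Qed.

Lemma indic_ray x z : (\1_(`]-oo, x]%classic) z = (z <= x)%R%:R :> R)%R.
Proof. by rewrite indicE mem_setE in_itv. Qed.

(** Up to a multiple and an affine term, the potential of [m]. *)
Definition put m k := \int[m]_x (pos_part (k - x))%:E.

Lemma measurable_put_payoff k :
  measurable_fun [set: measurableTypeR R] (fun x : measurableTypeR R => (pos_part (k - x))%:E).
Proof.
by apply/measurable_EFinP; apply: measurable_pos_part; apply: measurable_funB => //; exact: measurable_cst.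
Qed.

(** The difference quotients of the put function squeeze the distribution
    function, which is recovered as the step tends to 0. *)
Lemma put_cdf_bounds m k (e : R) : (0 < e)%R ->
  put m k + e%:E * m `]-oo, k]%classic <= put m (k + e)%R /\
  put m (k + e)%R <= put m k + e%:E * m `]-oo, (k + e)%R]%classic.
Proof.
move=> e0.
have ind x : (e%:E * m `]-oo, x]%classic = \int[m]_z (e * \1_(`]-oo, x]) z)%:E).
  under eq_integral do rewrite EFinM.
  by rewrite ge0_integralZl//= ?integral_indic ?setIT//; [exact/measurable_EFinP|rewrite lee_fin ltW].
have mi x : measurable_fun [set: measurableTypeR R] (fun z : measurableTypeR R => (e * \1_(`]-oo, x]) z)%:E).
  by apply/measurable_EFinP; apply: measurable_funM => //; exact: measurable_cst.
have i0 (x z : R) : 0 <= (e * \1_(`]-oo, x]) z)%:E by rewrite lee_fin mulr_ge0// ltW.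
have p0 (x z : R) : 0 <= (pos_part (x - z))%:E by rewrite lee_fin pos_part_ge0.
have msum x y : measurable_fun [set: measurableTypeR R]
    (fun z : measurableTypeR R => (pos_part (x - z))%:E + (e * \1_(`]-oo, y]) z)%:E).
  by apply: emeasurable_funD => //; exact: measurable_put_payoff.
split; rewrite ind /put -ge0_integralD//; try exact: measurable_put_payoff.
  apply: ge0_le_integral => [//|x _|//||x _]; first by rewrite adde_ge0.
    exact: measurable_put_payoff.
  rewrite -EFinD lee_fin indic_ray; case: (leP x k) => xk /=.
    by rewrite !pos_partE ?mulr1; lra.
  by rewrite mulr0 addr0 pos_part0; [exact: pos_part_ge0|lra].
apply: ge0_le_integral => [//|x _||//|x _]; first by rewrite p0.
  exact: measurable_put_payoff.
rewrite -EFinD lee_fin indic_ray; case: (leP x (k + e)%R) => xk /=.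
  rewrite (pos_partE (z := _ + _ - _)%R); last lra.
  by have := pos_part_ge (k - x)%R; rewrite mulr1; lra.
by rewrite mulr0 addr0 pos_part0; [exact: pos_part_ge0|lra].
Qed.

Lemma eq_probability_of_put m m' : (forall k, put m k = put m' k) ->
  (forall k, put m k \is a fin_num) ->
  forall A, measurable A -> m A = m' A.
Proof.
move=> h hfin; apply: eq_probability_of_cdf => x.
have main (p q : probR R) : (forall k, put p k = put q k) ->
    (forall k, put p k \is a fin_num) -> p `]-oo, x]%classic <= q `]-oo, x]%classic.
  move=> pq pfin; apply: cdf_right_closed => e e0.
  have [h1 _] := put_cdf_bounds p x e0; have [_ h2] := put_cdf_bounds q x e0.
  have := le_trans h1 (eq_ind_r (fun z => z <= _) h2 (pq _)).
  by rewrite -pq leeD2lE// lee_pmul2l.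
by apply/eqP; rewrite eq_le !main// => k; rewrite -h.
Qed.

End laws_on_the_line.

(** * Put values and the convex order *)

Section put_values.
Context {R : realType}.
Implicit Types (m mu nu : probR R) (x y k : R).

Lemma dominated_to_zero d (T : measurableType d) (m : {measure set T -> \bar R})
    (f : nat -> T -> R) (g : T -> R) (e : R) :
  (forall n, measurable_fun setT (f n)) -> m.-integrable setT (EFin \o g) ->
  (forall n t, 0 <= f n t <= g t) ->
  (forall t, exists N, forall n, (N <= n)%N -> f n t = 0) -> 0 < e ->
  exists n, \int[m]_t f n t < e.
Proof.
move=> mf ig fg f0 e0.
have [_ _ cvg] : [/\ m.-integrable setT (cst 0%E),
    (\int[m]_(t in setT) `|(EFin \o f n) t - cst 0 t| @[n --> \oo] --> 0)%E &
    (\int[m]_(t in setT) (EFin \o f n) t @[n --> \oo] --> \int[m]_(t in setT) cst 0 t)%E].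
  apply: (@dominated_convergence _ _ _ m _ measurableT (fun n => EFin \o f n)
    (cst 0%E) (EFin \o g)) => //.
  - by move=> n; exact/measurable_EFinP.
  - apply: aeW => t _; have [N hN] := f0 t.
    apply: cvg_near_cst; exists N => // n /= Nn; by rewrite hN.
  - by apply: aeW => t n _ /=; have /andP[? ?] := fg n t; rewrite lee_fin ger0_norm.
rewrite integral0 in cvg.
have cvg' : (\int[m]_t f n t) @[n --> \oo] --> (0 : R) by exact: (fine_cvg cvg).
move/cvgrPdist_lt : cvg' => /(_ _ e0) [N _ /(_ N (leqnn N))].
rewrite /= sub0r normrN => h; exists N.
by apply: le_lt_trans (ler_norm _) _.
Qed.

Lemma Rintegral_cst_prob d (T : measurableType d) (m : probability T R) (c : R) :
  \int[m]_x c = c.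
Proof.
rewrite Rintegral_cst// -[RHS]mulr1; congr (_ * _).
by have /(congr1 fine) := probability_setT m.
Qed.

Definition rput m k : R := \int[m]_x pos_part (k - x).

Section moments.
Variable m : probR R.
Hypothesis mfm : finite_first_moment m.

Lemma integrable_le_affine (f : R -> R) (c : R) :
  measurable_fun [set: measurableTypeR R] f -> (forall x, `|f x| <= c + `|x|) ->
  m.-integrable [set: measurableTypeR R] (EFin \o f).
Proof.
move=> mf hf.
have ic : m.-integrable [set: measurableTypeR R] (EFin \o cst c).
  by apply: finite_measure_integrable_cst.
have := integrableD measurableT ic (integrable_abse mfm).
apply: le_integrable => //; first exact/measurable_EFinP.
by move=> x _ /=; rewrite lee_fin; apply: le_trans (hf x) (ler_norm _).
Qed.

Lemma integrable_put k :
  m.-integrable [set: measurableTypeR R] (EFin \o (fun x => pos_part (k - x))).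
Proof.
apply: (@integrable_le_affine _ `|k|).
  by apply: measurable_pos_part; apply: measurable_funB => //; exact: measurable_cst.
move=> x; rewrite ger0_norm ?pos_part_ge0// /pos_part ge_max; apply/andP; split.
  by rewrite addr_ge0.
by apply: le_trans (ler_norm _) _; exact: (@ler_normB R R).
Qed.

Lemma integrable_call k :
  m.-integrable [set: measurableTypeR R] (EFin \o (fun x => pos_part (x - k))).
Proof.
apply: (@integrable_le_affine _ `|k|).
  by apply: measurable_pos_part; apply: measurable_funB => //; exact: measurable_cst.
move=> x; rewrite ger0_norm ?pos_part_ge0// /pos_part ge_max; apply/andP; split.
  by rewrite addr_ge0.
by apply: le_trans (ler_norm _) _; rewrite (addrC `|k|); exact: (@ler_normB R R).
Qed.

Lemma rputE k : put m k = (rput m k)%:E.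
Proof. by rewrite /rput /Rintegral fineK//; apply: integrable_fin_num => //; exact: integrable_put. Qed.

Lemma rput_ge0 k : 0 <= rput m k.
Proof. by apply: Rintegral_ge0 => x _; exact: pos_part_ge0. Qed.

Lemma rput_lipschitz k k' : k <= k' -> rput m k <= rput m k' <= rput m k + (k' - k).
Proof.
move=> kk'; apply/andP; split.
  apply: le_Rintegral => //; try exact: integrable_put.
  move=> x _; rewrite /pos_part ge_max; apply/andP; split; first exact: pos_part_ge0.
  by apply: le_trans (pos_part_ge _); lra.
have -> : k' - k = \int[m]_x (k' - k).
  by rewrite Rintegral_cst_prob.
have ic : m.-integrable [set: measurableTypeR R] (EFin \o cst (k' - k)).
  exact: finite_measure_integrable_cst.
rewrite -RintegralD//; last exact: integrable_put.
apply: le_Rintegral => //; first exact: integrable_put.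
  by apply: (integrableD measurableT (integrable_put k) ic).
move=> x _; rewrite /pos_part ge_max; apply/andP; split.
  by have := pos_part_ge0 (k - x); rewrite /pos_part; lra.
by have := pos_part_ge (k - x); rewrite /pos_part; lra.
Qed.

Lemma rput_small e : 0 < e -> exists k, rput m k < e.
Proof.
move=> e0.
suff [n hn] : exists n : nat, \int[m]_x pos_part (- n%:R - x) < e by exists (- n%:R).
apply: (@dominated_to_zero _ _ m (fun n x => pos_part (- n%:R - x)) (fun x => `|x|) e) => //.
- move=> n; apply: measurable_pos_part; apply: measurable_funB => //; exact: measurable_cst.
- exact: integrable_abse mfm.
- move=> n x; rewrite pos_part_ge0 /pos_part ge_max normr_ge0 /=.
  have := ler_norm (- x); rewrite normrN; have : 0 <= n%:R :> R by [].
  by lra.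
- move=> x; exists (Num.truncn (- x)).+1 => n hn; apply: pos_part0.
  have := truncnS_gt (- x).
  have : (Num.truncn (- x)).+1%:R <= n%:R :> R by rewrite ler_nat.
  by lra.
Qed.

Lemma rcall_small e : 0 < e -> exists2 k, 0 <= k & \int[m]_x pos_part (x - k) < e.
Proof.
move=> e0.
suff [n hn] : exists n : nat, \int[m]_x pos_part (x - n%:R) < e by exists n%:R.
apply: (@dominated_to_zero _ _ m (fun n x => pos_part (x - n%:R)) (fun x => `|x|) e) => //.
- move=> n; apply: measurable_pos_part; apply: measurable_funB => //; exact: measurable_cst.
- exact: integrable_abse mfm.
- move=> n x; rewrite pos_part_ge0 /pos_part ge_max normr_ge0 /=.
  have := ler_norm x; have : 0 <= n%:R :> R by [].
  by lra.
- move=> x; exists (Num.truncn x).+1 => n hn; apply: pos_part0.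
  have := truncnS_gt x.
  have : (Num.truncn x).+1%:R <= n%:R :> R by rewrite ler_nat.
  by lra.
Qed.

Lemma put_call_parity k :
  rput m k = \int[m]_x pos_part (x - k) + k - \int[m]_x x.
Proof.
have ic : m.-integrable [set: measurableTypeR R] (EFin \o cst k).
  exact: finite_measure_integrable_cst.
have ick : m.-integrable [set: measurableTypeR R] (EFin \o (fun x => pos_part (x - k) + k)).
  exact: (integrableD measurableT (integrable_call k) ic).
have -> : k = \int[m]_x (cst k x) :> R.
  by rewrite Rintegral_cst_prob.
rewrite -RintegralD//; last exact: integrable_call.
rewrite Rintegral_cst_prob.
rewrite -RintegralB//.
apply: eq_Rintegral => x _; rewrite /cst; case: (leP x k) => xk.
  by rewrite pos_partE ?pos_part0; lra.
by rewrite pos_part0 ?pos_partE; lra.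
Qed.

End moments.

Section in_convex_order.
Variables mu nu : probR R.
Hypotheses (mfm : finite_first_moment mu) (nfm : finite_first_moment nu).
Hypothesis mn : convex_order mu nu.

Lemma convex_order_Rintegral (g : R -> R) :
  mu.-integrable [set: measurableTypeR R] (EFin \o g) ->
  nu.-integrable [set: measurableTypeR R] (EFin \o g) ->
  (forall t x y, 0 <= t <= 1 -> g (t * x + (1 - t) * y) <= t * g x + (1 - t) * g y) ->
  \int[mu]_x g x <= \int[nu]_x g x.
Proof.
move=> im ik cg; apply: fine_le; try exact: integrable_fin_num.
apply: mn => t x y _ _; rewrite !convRE; apply: cg.
by apply/andP; split.
Qed.

Lemma convex_order_mean : \int[mu]_x x = \int[nu]_x x.
Proof.
apply/eqP; rewrite eq_le; apply/andP; split.
  by apply: convex_order_Rintegral.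
have imN : mu.-integrable [set: measurableTypeR R] (EFin \o -%R).
  exact: integrableN mfm.
have inN : nu.-integrable [set: measurableTypeR R] (EFin \o -%R).
  exact: integrableN nfm.
have := convex_order_Rintegral imN inN.
have e (p : probR R) : finite_first_moment p -> \int[p]_x - x = - \int[p]_x x.
  move=> pf; rewrite -mulN1r -RintegralZl//.
  by apply: eq_Rintegral => x _; rewrite mulN1r.
rewrite !e// lerN2; apply => t x y _; lra.
Qed.

Definition put_gap k := rput nu k - rput mu k.

Lemma put_gap_ge0 k : 0 <= put_gap k.
Proof.
rewrite subr_ge0; apply: convex_order_Rintegral; try exact: integrable_put.
move=> t x y /andP[t0 t1]; rewrite {1}/pos_part ge_max; apply/andP; split.
  by rewrite addr_ge0// mulr_ge0 ?pos_part_ge0//; lra.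
have h1 : t * (k - x) <= t * pos_part (k - x) by apply: ler_wpM2l => //; exact: pos_part_ge.
have h2 : (1 - t) * (k - y) <= (1 - t) * pos_part (k - y).
  by apply: ler_wpM2l; [lra|exact: pos_part_ge].
lra.
Qed.

(** By put-call parity and equality of the means, the gap is also a difference of
    call values. *)
Lemma put_gap_le_call k : put_gap k <= \int[nu]_x pos_part (x - k).
Proof.
rewrite /put_gap !put_call_parity// convex_order_mean.
have : 0 <= \int[mu]_x pos_part (x - k) by apply: Rintegral_ge0 => x _; exact: pos_part_ge0.
lra.
Qed.

Lemma put_gap_lipschitz k k' : `|put_gap k - put_gap k'| <= `|k - k'|.
Proof.
wlog kk' : k k' / k <= k'.
  by move=> h; case: (leP k k') => [|/ltW] /h //; rewrite distrC (distrC k').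
rewrite (distrC k) (ger0_norm (_ : 0 <= k' - k)); last lra.
have /andP[? ?] := rput_lipschitz mfm kk'; have /andP[? ?] := rput_lipschitz nfm kk'.
by rewrite ler_norml /put_gap; apply/andP; split; lra.
Qed.

End in_convex_order.

End put_values.

(** * Quantile functions *)

Section quantile.
Context {R : realType}.
Implicit Types (mu : probR R) (x u v : R).

Definition unit_prob : probR R := uniform_prob (@ltr01 R).

Lemma integral_unit_prob (f : R -> \bar R) :
  measurable_fun [set: measurableTypeR R] f -> (forall x : R, 0%E <= f x)%E ->
  (\int[unit_prob]_u f u = \int[lebesgue_measure]_(u in `]0%R:R, 1%R[) f u)%E.
Proof.
move=> mf f0; rewrite integral_uniform// subr0 invr1 mul1e.
rewrite -integral_itv_bndo_bndc; last exact: measurable_funTS.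
by rewrite -integral_itv_obnd_cbnd//; exact: measurable_funTS.
Qed.

Lemma unit_probE (A : set (measurableTypeR R)) : measurable A ->
  unit_prob A = lebesgue_measure (A `&` `]0%R:R, 1%R[).
Proof.
move=> mA; have := @integral_unit_prob (EFin \o \1_A).
rewrite !integral_indic ?setIT//; apply => //; first exact/measurable_EFinP.
by move=> x; rewrite lee_fin.
Qed.

Section quantile_of.
Variable mu : probR R.

(** The strict inequality makes this the right-continuous inverse of
    the distribution function; right-continuity is what [excess_gt0] uses. *)
Definition quantile : R -> R :=
  (fun u => inf [set x | (u%:E < mu `]-oo, x]%classic)%E]) \_ `]0%R:R, 1%R[%classic.

Let above u := [set x | (u%:E < mu `]-oo, x]%classic)%E].

Let quantileE u : 0 < u < 1 -> quantile u = inf (above u).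
Proof. by move=> u01; rewrite /quantile patchE mem_setE in_itv/= u01. Qed.

Let cdf_mono x y : x <= y -> (mu `]-oo, x]%classic <= mu `]-oo, y]%classic)%E.
Proof.
move=> xy; apply: le_measure; rewrite ?inE//.
by move=> z /=; rewrite !in_itv/= => /le_trans; apply.
Qed.

Let has_inf_above u : 0 < u < 1 -> has_inf (above u).
Proof.
move=> /andP[u0 u1]; split; first exact: cdf_gt.
have [x xu] := cdf_lt mu u0; exists x => y /=.
move=> uy; rewrite leNgt; apply/negP => yx.
by have := lt_trans (lt_le_trans uy (cdf_mono (ltW yx))) xu; rewrite ltxx.
Qed.

Lemma quantile_le u x : 0 < u < 1 -> (u%:E < mu `]-oo, x]%classic)%E -> quantile u <= x.
Proof.
by move=> u01 ux; rewrite quantileE//; apply: ge_inf => //; exact: (has_inf_above u01).2.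
Qed.

Lemma quantile_lt u x : 0 < u < 1 -> quantile u < x -> (u%:E < mu `]-oo, x]%classic)%E.
Proof.
move=> u01; rewrite quantileE// => /(inf_lt (has_inf_above u01).1)[y uy yx].
exact: lt_le_trans uy (cdf_mono (ltW yx)).
Qed.

Lemma quantile_mono u v : 0 < u < 1 -> 0 < v < 1 -> u <= v -> quantile u <= quantile v.
Proof.
move=> u01 v01 uv; rewrite leNgt; apply/negP => vu.
pose x := (quantile u + quantile v) / 2.
have : (v%:E < mu `]-oo, x]%classic)%E by apply: quantile_lt => //; rewrite /x; lra.
move=> /(le_lt_trans _)-/(_ u%:E); rewrite lee_fin => /(_ uv) /quantile_le -/(_ u01).
by rewrite /x; lra.
Qed.

Lemma quantile_right_continuous u b : 0 < u < 1 -> quantile u < b ->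
  exists w, u < w < 1 /\ quantile w < b.
Proof.
move=> u01 ub; pose b' := (quantile u + b) / 2.
have ub' : quantile u < b' by rewrite /b'; lra.
have := quantile_lt u01 ub'.
have fin : mu `]-oo, b']%classic \is a fin_num by exact: fin_num_measure.
have le1 := probability_le1 mu (measurable_itv `]-oo, b']).
rewrite -(fineK fin) lte_fin => h; rewrite -(fineK fin) lee_fin in le1.
pose w := (u + fine (mu `]-oo, b']%classic)) / 2.
have w01 : u < w < 1 by apply/andP; split; rewrite /w; lra.
exists w; split => //; apply: (@le_lt_trans _ _ b'); last by rewrite /b'; lra.
apply: quantile_le; first by lra.
by rewrite -(fineK fin) lte_fin /w; lra.
Qed.

Lemma measurable_quantile : measurable_fun [set: measurableTypeR R]
  (quantile : measurableTypeR R -> measurableTypeR R).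
Proof.
have i01 : is_interval (`]0, 1[%classic : set R) by exact: interval_is_interval.
apply: (iffLR (measurable_restrictT _ _)) => //.
apply: (@nondecreasing_on_measurable R `]0, 1[%classic (fun u => inf (above u)) i01).
move=> x y; rewrite /= !in_itv/= => x01 y01 xy.
by have := quantile_mono x01 y01 xy; rewrite !quantileE.
Qed.

Lemma quantile_law x : unit_prob (quantile @^-1` `]-oo, x]) = mu `]-oo, x]%classic.
Proof.
have mq : measurable (quantile @^-1` `]-oo, x]).
  by rewrite -[X in measurable X]setTI; exact: measurable_quantile.
rewrite unit_probE//.
have fin : mu `]-oo, x]%classic \is a fin_num by exact: fin_num_measure.
have le1 := probability_le1 mu (measurable_itv `]-oo, x]).
have ge0 : (0 <= mu `]-oo, x]%classic)%E by [].
move: le1 ge0; rewrite -(fineK fin) !lee_fin; set F := fine _ => F1 F0.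
have lm b : lebesgue_measure [set` Interval (BRight 0) (BSide b F)] = F%:E.
  rewrite lebesgue_measure_itv/= lte_fin; case: ltP => [_|]; first by rewrite sube0.
  by move=> ?; congr EFin; lra.
apply/eqP; rewrite eq_le; apply/andP; split.
  rewrite -(lm false); apply: le_measure; rewrite ?inE//=; first exact: measurableI.
  move=> u /= [ux]; move: ux; rewrite !in_itv/= => ux u01.
  rewrite (_ : 0 < u); last by lra.
  rewrite -lee_fin /F (fineK fin); apply: cdf_right_closed => e e0.
  by apply/ltW/quantile_lt => //; lra.
rewrite -(lm true); apply: le_measure; rewrite ?inE//=; first exact: measurableI.
move=> u /=; rewrite !in_itv/= => /andP[u0 uF].
have u01 : 0 < u < 1 by lra.
by split => //; apply: quantile_le => //; rewrite -(fineK fin) lte_fin.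
Qed.

Lemma quantile_law_measurable A : measurable A -> unit_prob (quantile @^-1` A) = mu A.
Proof.
move=> mA.
pose q : {mfun (measurableTypeR R) >-> (measurableTypeR R)} :=
  HB.pack quantile
    (@isMeasurableFun.Build _ _ (measurableTypeR R) (measurableTypeR R) quantile measurable_quantile).
exact: (@eq_probability_of_cdf _ (distribution unit_prob q) mu quantile_law A mA).
Qed.

Lemma integral_quantile (f : R -> \bar R) :
  measurable_fun [set: measurableTypeR R] f -> (forall x : R, 0%E <= f x)%E ->
  (\int[lebesgue_measure]_(u in `]0%R:R, 1%R[) f (quantile u) = \int[mu]_x f x)%E.
Proof.
move=> mf f0; rewrite -integral_unit_prob//; last first.
  exact: measurableT_comp mf measurable_quantile.
rewrite -[LHS](@ge0_integral_pushforward _ _ _ _ _ _ measurable_quantile unit_prob setT)//.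
apply: eq_measure_integral => [|mq A mA _]; [exact: measurable_quantile|exact: quantile_law_measurable].
Qed.

End quantile_of.
End quantile.

(** * Put functions of parts of the first law *)

Section curtain.
Context {R : realType}.
Variables mu nu : probR R.
Hypotheses (mfm : finite_first_moment mu) (nfm : finite_first_moment nu).
Hypothesis mn : convex_order mu nu.
Implicit Types (u v x k c : R).

Local Notation lam := (@lebesgue_measure R).
Local Notation G := (quantile mu).

Lemma integrable_quantile (f : R -> R) :
  measurable_fun [set: measurableTypeR R] f ->
  mu.-integrable [set: measurableTypeR R] (EFin \o f) ->
  lam.-integrable `]0, 1[ (EFin \o (fun w => f (G w))).
Proof.
move=> mf /integrableP[_ fi]; apply/integrableP; split.
  apply/measurable_EFinP/measurable_funTS.
  exact: measurableT_comp mf (measurable_quantile mu).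
have -> : (\int[lam]_(w in `]0%R : R, 1%R[) `|(EFin \o (fun w => f (G w))) w| = \int[mu]_x `|(EFin \o f) x|)%E.
  apply: (@integral_quantile _ mu (fun x => `|(f x)%:E|)%E) => //.
  by do 2 apply: measurableT_comp => //.
exact: fi.
Qed.

Lemma integrable_quantile_put x :
  lam.-integrable `]0, 1[ (EFin \o (fun w => pos_part (x - G w))).
Proof.
apply: (@integrable_quantile (fun z => pos_part (x - z))); last exact: integrable_put.
by apply: measurable_pos_part; apply: measurable_funB => //; exact: measurable_cst.
Qed.

(** With the next definition: put functions of the parts of [mu] carried by the
    quantile levels above [u], and between [u] and [v]. *)
Definition tail_put u x := \int[lam]_(w in `]u, 1[) pos_part (x - G w).
Definition slice_put u v x := \int[lam]_(w in `]u, v]) pos_part (x - G w).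

Lemma slice_sub u v : 0 <= u -> v < 1 -> `]u, v] `<=` `]0 : R, 1[.
Proof. by move=> u0 v1 w /=; rewrite !in_itv/= => /andP[? ?]; apply/andP; split; lra. Qed.

Lemma tail_sub u : 0 <= u -> `]u, 1[ `<=` `]0 : R, 1[.
Proof. by move=> u0 w /=; rewrite !in_itv/= => /andP[? ?]; apply/andP; split; lra. Qed.

Lemma integrable_slice u v (f : R -> R) : 0 <= u -> v < 1 ->
  lam.-integrable `]0, 1[ (EFin \o f) -> lam.-integrable `]u, v] (EFin \o f).
Proof. by move=> u0 v1; apply: integrableS => //; exact: slice_sub. Qed.

Lemma integrable_tail u (f : R -> R) : 0 <= u ->
  lam.-integrable `]0, 1[ (EFin \o f) -> lam.-integrable `]u, 1[ (EFin \o f).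
Proof. by move=> u0; apply: integrableS => //; exact: tail_sub. Qed.

Lemma integrable_cst_itv (i : interval R) (c : R) :
  [set` i] `<=` `]0 : R, 1[%classic -> lam.-integrable [set` i] (EFin \o cst c).
Proof.
move=> h.
have ic : lam.-integrable `]0 : R, 1[ (EFin \o cst c).
  apply: measurable_bounded_integrable => //.
  - by rewrite /= lebesgue_measure_itv/= lte_fin ltr01 -EFinB ltry.
  - exact: bounded_cst.
by move: ic; apply: integrableS.
Qed.

Lemma Rintegral_cst_slice u v c : 0 <= u -> u <= v -> \int[lam]_(w in `]u, v]) c = (v - u) * c.
Proof.
move=> u0 uv; rewrite Rintegral_cst// mulrC; congr (_ * _).
rewrite /= lebesgue_measure_itv/= lte_fin; case: ltP => [_|?]; first by rewrite -EFinB.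
by rewrite /=; lra.
Qed.

Lemma Rintegral_cst_tail u c : 0 <= u -> u < 1 -> \int[lam]_(w in `]u, 1[) c = (1 - u) * c.
Proof.
move=> u0 u1; rewrite Rintegral_cst// mulrC; congr (_ * _).
by rewrite /= lebesgue_measure_itv/= lte_fin u1 -EFinB.
Qed.

Lemma slice_put_bounds u v x : 0 < u -> u <= v -> v < 1 ->
  (v - u) * pos_part (x - G v) <= slice_put u v x <= (v - u) * pos_part (x - G u).
Proof.
move=> u0 uv v1.
have ui : 0 <= u by exact: ltW.
have hG w : u < w <= v -> G u <= G w <= G v.
  by move=> ?; apply/andP; split; apply: quantile_mono; lra.
have pm a b : a <= b -> pos_part (x - b) <= pos_part (x - a).
  move=> ab; rewrite {1}/pos_part ge_max pos_part_ge0/=.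
  by apply: le_trans (pos_part_ge _); lra.
rewrite -!Rintegral_cst_slice//; apply/andP; split; apply: le_Rintegral => //.
- by apply: integrable_cst_itv; exact: slice_sub.
- by apply: integrable_slice => //; exact: integrable_quantile_put.
- by move=> w /=; rewrite in_itv/= => /hG/andP[_ /pm].
- by apply: integrable_slice => //; exact: integrable_quantile_put.
- by apply: integrable_cst_itv; exact: slice_sub.
- by move=> w /=; rewrite in_itv/= => /hG/andP[/pm].
Qed.

(** The mass that the slice puts on the left of [k] is a subgradient at [k]. *)
Lemma slice_put_subgradient u v k : 0 <= u -> u <= v -> v < 1 ->
  exists s, forall x, slice_put u v k + s * (x - k) <= slice_put u v x.
Proof.
move=> u0 uv v1.
pose f w : R := \1_(G @^-1` `]-oo, k]) w.
have mf : measurable_fun [set: measurableTypeR R] f.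
  apply: measurable_indic; rewrite -[X in measurable X]setTI.
  exact: (measurable_quantile mu).
have fi : lam.-integrable `]u, v] (EFin \o f).
  apply: measurable_bounded_integrable => //.
  - by rewrite /= lebesgue_measure_itv/= lte_fin; case: ifP => // _; rewrite -EFinB ltry.
  - exact: measurable_funTS.
  - exists 1; split => // M M1 w _ /=; rewrite /f indicE ger0_norm//.
    by apply: le_trans (ltW M1); rewrite lern1 leq_b1.
exists (\int[lam]_(w in `]u, v]) f w) => x.
have mI : measurable (`]u, v]%classic : set (measurableTypeR R)) by exact: measurable_itv.
have ip z : lam.-integrable `]u, v] (EFin \o (fun w => pos_part (z - G w))).
  by apply: integrable_slice => //; exact: integrable_quantile_put.
have fix' : lam.-integrable `]u, v] (EFin \o (fun w => f w * (x - k))).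
  exact: (integrableZr mI (x - k) fi).
rewrite -RintegralZr// /slice_put -RintegralD//.
apply: le_Rintegral => //.
  exact: (integrableD mI (ip k) fix').
move=> w _; have -> : f w = (G w <= k)%R%:R.
  by rewrite /f indicE; congr (nat_of_bool _)%:R; apply/idP/idP; rewrite inE /= in_itv.
case: (leP (G w) k) => h /=.
  by rewrite mul1r pos_partE; [apply: le_trans (pos_part_ge _)|]; lra.
by rewrite mul0r addr0 pos_part0; [exact: pos_part_ge0|lra].
Qed.

Lemma tail_put_split u v x : 0 <= u -> u <= v -> v < 1 ->
  tail_put u x = slice_put u v x + tail_put v x.
Proof.
move=> u0 uv v1; rewrite /tail_put.
have e := @itv_bndbnd_setU _ _ (BRight u) (BRight v) (BLeft (1 : R)).
rewrite e//= Rintegral_setU//.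
  by rewrite -e//; apply: integrable_tail => //; exact: integrable_quantile_put.
apply/disj_setPS => w [/=]; rewrite !in_itv/= => /andP[_ wv] /andP[vw _]; lra.
Qed.

Lemma tail_put0 x : tail_put 0 x = rput mu x.
Proof.
congr fine; apply: (@integral_quantile _ mu (fun z => (pos_part (x - z))%:E)).
  exact: measurable_put_payoff.
by move=> z; rewrite lee_fin pos_part_ge0.
Qed.

Lemma tail_put_ge0 u x : 0 <= tail_put u x.
Proof. by apply: Rintegral_ge0 => w _; exact: pos_part_ge0. Qed.

Lemma tail_put_le u x : 0 < u < 1 -> tail_put u x <= (1 - u) * pos_part (x - G u).
Proof.
move=> /andP[u0 u1]; rewrite -(Rintegral_cst_tail _ (ltW u0) u1).
apply: le_Rintegral => //.
- by apply: integrable_tail; [exact: ltW|exact: integrable_quantile_put].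
- by apply: integrable_cst_itv; apply: tail_sub; exact: ltW.
move=> w /=; rewrite in_itv/= => uw; rewrite {1}/pos_part ge_max pos_part_ge0/=.
apply: le_trans (pos_part_ge _); rewrite lerD2l lerN2.
by apply: quantile_mono; lra.
Qed.

(** The tail has mass [1 - u], so its put function lies above the line of this
    slope given by its first moment. *)
Lemma tail_put_ge_affine u : 0 <= u -> u < 1 ->
  exists J, forall x, (1 - u) * x - J <= tail_put u x.
Proof.
move=> u0 u1; exists (\int[lam]_(w in `]u, 1[) G w) => x.
have iG : lam.-integrable `]u, 1[ (EFin \o G).
  apply: integrable_tail => //; apply: (@integrable_quantile idfun) => //.
  exact: measurable_id.
have mI : measurable (`]u, 1[%classic : set (measurableTypeR R)) by exact: measurable_itv.
have ic : lam.-integrable `]u, 1[ (EFin \o cst x).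
  by apply: integrable_cst_itv; exact: tail_sub.
rewrite -Rintegral_cst_tail// -RintegralB//; apply: le_Rintegral => //.
- exact: (integrableB mI ic iG).
- by apply: integrable_tail => //; exact: integrable_quantile_put.
by move=> w _; exact: pos_part_ge.
Qed.

Lemma slice_put_small k e : 0 < e -> exists2 u, 0 < u < 1 & slice_put 0 u k < e.
Proof.
move=> e0.
pose F (n : nat) : set R := `]n.+2%:R^-1, 1[%classic.
have Fcup : \bigcup_n F n = `]0, 1[%classic.
  apply/seteqP; split => w /=.
    move=> [n _]; rewrite /F/= !in_itv/= => /andP[nw ->]; rewrite andbT.
    by apply: lt_trans nw; rewrite invr_gt0 ltr0n.
  rewrite in_itv/= => /andP[w0 w1]; exists (Num.truncn w^-1) => //.
  rewrite /F/= in_itv/= w1 andbT invf_plt ?posrE//.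
  apply: lt_trans (truncnS_gt _) _; by rewrite ltr_nat.
have cvg : (\int[lam]_(w in F n) (pos_part (k - G w))%:E @[n --> \oo] -->
   \int[lam]_(w in \bigcup_n F n) (pos_part (k - G w))%:E)%E.
  apply: ge0_nondecreasing_set_cvg_integral => //.
  - move=> n m nm; apply/subsetPset => w; rewrite /F/= !in_itv/= => /andP[nw ->].
    rewrite andbT; apply: le_lt_trans nw.
    by rewrite lef_pV2 ?posrE ?ltr0n// ler_nat.
  - move=> n; exact: measurable_itv.
  - move=> n; apply/measurable_funTS/measurable_EFinP/measurable_pos_part.
    apply: measurable_funB; first exact: measurable_cst.
    exact: measurable_quantile.
  - by move=> n w _; rewrite lee_fin pos_part_ge0.
rewrite Fcup -[X in _ --> X]fineK in cvg; last first.
  by apply: integrable_fin_num => //; exact: integrable_quantile_put.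
have cvg' : tail_put n.+2%:R^-1 k @[n --> \oo] --> tail_put 0 k.
  exact: (fine_cvg cvg).
move/cvgrPdist_lt : cvg' => /(_ _ e0) [N _ /(_ N (leqnn N))] /=.
have n01 : 0 < (N.+2%:R^-1 : R) < 1.
  by rewrite invr_gt0 ltr0n invf_lt1 ?ltr1n ?ltr0n.
have := @tail_put_split 0 N.+2%:R^-1 k (lexx _).
have /andP[n0 n1] := n01.
move=> /(_ (ltW n0) n1) ->.
rewrite addrK => h; exists N.+2%:R^-1 => //.
by apply: le_lt_trans h; exact: ler_norm.
Qed.

End curtain.

(** * The brackets of the left curtain *)

Section curtain_ends.
Context {R : realType}.
Variables mu nu : probR R.
Hypotheses (mfm : finite_first_moment mu) (nfm : finite_first_moment nu).
Hypothesis mn : convex_order mu nu.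
Implicit Types (u v x k c : R).

Local Notation lam := (@lebesgue_measure R).
Local Notation G := (quantile mu).
Local Notation tail := (tail_put mu).
Local Notation slice := (slice_put mu).

Lemma pos_part_shift (x y z : R) : pos_part (y - z) <= pos_part (x - z) + pos_part (y - x).
Proof.
rewrite {1}/pos_part ge_max addr_ge0 ?pos_part_ge0//=.
by have := pos_part_ge (x - z); have := pos_part_ge (y - x); lra.
Qed.

Lemma tail_put_shift u x y : 0 <= u < 1 -> tail u y <= tail u x + (1 - u) * pos_part (y - x).
Proof.
move=> /andP[u0 u1].
have mI : measurable (`]u, 1[%classic : set (measurableTypeR R)) by exact: measurable_itv.
have ip z : lam.-integrable `]u, 1[ (EFin \o (fun w => pos_part (z - G w))).
  by apply: integrable_tail => //; exact: integrable_quantile_put.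
have ic : lam.-integrable `]u, 1[ (EFin \o cst (pos_part (y - x))).
  by apply: integrable_cst_itv; exact: tail_sub.
rewrite -Rintegral_cst_tail// /tail_put -RintegralD//.
apply: le_Rintegral => //; first exact: (integrableD mI (ip x) ic).
by move=> w _; exact: pos_part_shift.
Qed.

Lemma slice_put_shift u x y : 0 <= u < 1 -> slice 0 u y <= slice 0 u x + u * pos_part (y - x).
Proof.
move=> /andP[u0 u1].
have mI : measurable (`]0, u]%classic : set (measurableTypeR R)) by exact: measurable_itv.
have ip z : lam.-integrable `]0, u] (EFin \o (fun w => pos_part (z - G w))).
  by apply: integrable_slice => //; exact: integrable_quantile_put.
have ic : lam.-integrable `]0, u] (EFin \o cst (pos_part (y - x))).
  by apply: integrable_cst_itv; exact: slice_sub.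
have -> : u * pos_part (y - x) = (u - 0) * pos_part (y - x) by rewrite subr0.
rewrite -Rintegral_cst_slice// /slice_put -RintegralD//.
apply: le_Rintegral => //; first exact: (integrableD mI (ip x) ic).
by move=> w _; exact: pos_part_shift.
Qed.

(** What remains of the put function of [nu] once the levels below [u] are
    removed (see [excess_put]). The present form is a sum of two nonnegative
    terms, which the hull needs. *)
Definition excess u x := put_gap mu nu x + tail u x.

Lemma slice_put_ge0 u v x : 0 <= slice u v x.
Proof. by apply: Rintegral_ge0 => w _; exact: pos_part_ge0. Qed.

Lemma excess_ge0 u x : 0 <= excess u x.
Proof. by apply: addr_ge0; [exact: put_gap_ge0|exact: tail_put_ge0]. Qed.

Lemma excess_split u v x : 0 <= u -> u <= v -> v < 1 ->
  excess u x = slice u v x + excess v x.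
Proof. by move=> u0 uv v1; rewrite /excess (tail_put_split mfm x u0 uv v1); lra. Qed.

Lemma excess_put u x : 0 <= u < 1 -> excess u x = rput nu x - slice 0 u x.
Proof.
move=> /andP[u0 u1]; have := excess_split x (lexx _) u0 u1.
by rewrite {1}/excess tail_put0 /put_gap; lra.
Qed.

Lemma excess_le_put u x : 0 <= u < 1 -> excess u x <= rput nu x.
Proof. by move=> u01; rewrite excess_put//; have := slice_put_ge0 0 u x; lra. Qed.

Lemma excess_continuous u : 0 <= u < 1 -> continuous (excess u).
Proof.
move=> u01 x; apply/cvgrPdist_lt => e e0; near=> y.
have h a b : a <= b -> excess u b - excess u a <= 2 * `|b - a|.
  move=> ab; have := tail_put_shift a b u01.
  have := put_gap_lipschitz mfm nfm b a; rewrite /excess.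
  have := ler_norm (put_gap mu nu b - put_gap mu nu a).
  have : (1 - u) * pos_part (b - a) <= `|b - a|.
    by rewrite pos_partE ?ger0_norm ?subr_ge0// ler_piMl ?subr_ge0//; lra.
  lra.
have h' a b : a <= b -> excess u a - excess u b <= 2 * `|b - a|.
  move=> ab.
  have := put_gap_lipschitz mfm nfm a b; rewrite /excess.
  have := ler_norm (put_gap mu nu a - put_gap mu nu b).
  have : tail u a <= tail u b.
    have := tail_put_shift b a u01; rewrite pos_part0 ?mulr0 ?addr0//; lra.
  have := normr_ge0 (b - a); rewrite (distrC a); lra.
have yx : 2 * `|y - x| < e.
  rewrite mulrC -ltr_pdivlMr// distrC; near: y.
  by apply: cvgr_dist_lt => //; rewrite divr_gt0.
apply: le_lt_trans yx; rewrite ler_norml; apply/andP; split.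
  rewrite lerNl opprB; case: (leP x y) => [/h//|/ltW /h']; by rewrite distrC.
case: (leP x y) => [/h'//|/ltW /h]; by rewrite distrC.
Unshelve. all: by end_near. Qed.

(** By right-continuity of the quantile function, levels slightly above [u]
    still have their quantile below [b], and contribute to the tail. *)
Lemma excess_gt0 u b : 0 < u < 1 -> G u < b -> 0 < excess u b.
Proof.
move=> u01 /(quantile_right_continuous u01)[w [/andP[uw w1] wb]].
have /andP[u0 u1] := u01.
rewrite (excess_split _ (ltW u0) (ltW uw) w1).
have /andP[h _] := slice_put_bounds mfm b u0 (ltW uw) w1.
have : 0 < (w - u) * pos_part (b - G w) by rewrite pos_partE; [apply: mulr_gt0|]; lra.
by have := excess_ge0 w b; lra.
Qed.

Lemma call_mono (m : probR R) x y : finite_first_moment m -> x <= y ->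
  \int[m]_z pos_part (z - y) <= \int[m]_z pos_part (z - x).
Proof.
move=> mf xy; apply: le_Rintegral => //; try exact: integrable_call.
move=> z _; rewrite {1}/pos_part ge_max pos_part_ge0/=.
by have := pos_part_ge (z - x); lra.
Qed.

(** The excess has asymptotic slope [1 - u]. On the right it comes arbitrarily
    close to the line of this slope through [G u], because the gap is below the
    call values of [nu], which vanish at infinity. *)
Lemma excess_bracket u : 0 < u < 1 -> exists a b s, bracket (excess u) (G u) a b s.
Proof.
move=> u01; have /andP[u0 u1] := u01; have u01' : 0 <= u < 1 by rewrite ltW.
have [J hJ] := tail_put_ge_affine mfm (ltW u0) u1.
apply: (@bracket_exists _ _ (G u) (1 - u) J).
- exact: excess_continuous.
- lra.
- exact: excess_ge0.
- by move=> x; have := put_gap_ge0 mfm nfm mn x; have := hJ x; rewrite /excess; lra.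
- move=> e /(rput_small nfm)[k hk]; exists k; apply: le_lt_trans hk.
  exact: excess_le_put.
- by move=> b; exact: excess_gt0.
- move=> e /(rcall_small nfm)[k _ hk]; exists (Num.max k (G u)).
  have h1 := put_gap_le_call mfm nfm mn (Num.max k (G u)).
  have h2 := @call_mono nu k (Num.max k (G u)) nfm (ltac:(by rewrite le_max lexx)).
  have h3 := tail_put_le mfm (Num.max k (G u)) u01.
  rewrite pos_partE in h3; last by rewrite subr_ge0 le_max lexx orbT.
  by rewrite /excess; lra.
Qed.

Definition ends u : R * R :=
  xget (0, 0) [set p : R * R | exists s, bracket (excess u) (G u) p.1 p.2 s].

Definition lower : R -> R := (fun u => (ends u).1) \_ `]0, 1[%classic.
Definition upper : R -> R := (fun u => (ends u).2) \_ `]0, 1[%classic.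

Lemma curtain_bracket u : 0 < u < 1 ->
  exists s, bracket (excess u) (G u) (lower u) (upper u) s.
Proof.
move=> u01; rewrite /lower /upper !patchE !mem_setE !in_itv/= u01 /ends.
case: xgetP => [p _ //|h].
have [a [b [s hs]]] := excess_bracket u01.
by have := h (a, b); case; exists s.
Qed.

Definition curtain_put k u := two_point_put (G u) (lower u) (upper u) k.

Lemma two_point_put_ge0 (g a b k : R) : a <= g <= b -> 0 <= two_point_put g a b k.
Proof.
move=> gab; rewrite /two_point_put; case: ifP => ab; last exact: pos_part_ge0.
by apply: divr_ge0; [apply: addr_ge0; apply: mulr_ge0; rewrite ?pos_part_ge0|]; lra.
Qed.

Lemma curtain_put_ge0 k u : 0 < u < 1 -> 0 <= curtain_put k u.
Proof. by move=> /curtain_bracket[s [? _ _ _ _]]; exact: two_point_put_ge0. Qed.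

(** Two excesses differ by a slice, which [slice_put_bounds] compares with a
    point mass at [G v]; the error in the hull is then of second order. *)
Lemma hull_excess_increment k u v : 0 < u < 1 -> 0 < v < 1 ->
  hull (excess v) k - hull (excess u) k + (v - u) * curtain_put k u
  <= `|v - u| * `|G v - G u|.
Proof.
move=> u01 v01; have [s hs] := curtain_bracket u01.
have /andP[u0 u1] := u01; have /andP[v0 v1] := v01.
have [uv|vu] := leP u v.
  have Guv := quantile_mono mu u01 v01 uv.
  have := @hull_step_up _ (excess u) (excess v) (G u) (G v) (lower u) (upper u) s (v - u) k
    (excess_ge0 v) hs.
  rewrite !ger0_norm ?subr_ge0// => /(_ uv Guv) h.
  suff /h : forall z, excess v z + (v - u) * pos_part (z - G v) <= excess u z.
    by rewrite -lerBrDr lerBlDr addrC addrA addrAC.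
  move=> z; rewrite (excess_split z (ltW u0) uv v1).
  by rewrite addrC lerD2r; have /andP[] := slice_put_bounds mfm z u0 uv v1.
have Gvu := quantile_mono mu v01 u01 (ltW vu).
have := @hull_step_down _ (excess u) (excess v) (G u) (G v) (lower u) (upper u) s (u - v) k
    (excess_ge0 v) hs.
rewrite (distrC v) (distrC (G v)) !ger0_norm ?subr_ge0 ?(ltW vu)// => /(_ isT Gvu) h.
suff /h : forall z, excess v z <= excess u z + (u - v) * pos_part (z - G v).
  by rewrite -(opprB u v) mulNr !lerBlDr addrC addrCA addrC (addrC _ (hull _ _)).
move=> z; rewrite (excess_split z (ltW v0) (ltW vu) u1).
by rewrite addrC lerD2l; have /andP[] := slice_put_bounds mfm z v0 (ltW vu) u1.
Qed.

Lemma rput_subgradient (m : probR R) k : finite_first_moment m ->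
  exists2 s, 0 <= s & forall x, rput m k + s * (x - k) <= rput m x.
Proof.
move=> mf.
have fin : m `]-oo, k]%classic \is a fin_num by exact: fin_num_measure.
exists (fine (m `]-oo, k]%classic)); first by rewrite fine_ge0.
move=> x; have [xk|kx|->] := ltgtP x k; last by rewrite subrr mulr0 addr0.
  have [_] := @put_cdf_bounds _ m x (k - x) (ltac:(by rewrite subr_gt0)).
  rewrite (_ : x + (k - x) = k); last by lra.
  by rewrite !rputE// -(fineK fin) -EFinM -EFinD lee_fin; lra.
have [+ _] := @put_cdf_bounds _ m k (x - k) (ltac:(by rewrite subr_gt0)).
rewrite (_ : k + (x - k) = x); last by lra.
by rewrite !rputE// -(fineK fin) -EFinM -EFinD lee_fin; lra.
Qed.

(** For small [u] the excess is close to the put function of [nu], which is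
    convex. One of its subgradients at [k], decreased by [u] to absorb the slice,
    gives an affine minorant of the excess. *)
Lemma hull_excess_near0 k e : 0 < e ->
  exists2 u, 0 < u < 2^-1 & rput nu k - e <= hull (excess u) k.
Proof.
move=> e0; pose P := rput nu k.
have P0 : 0 <= P by exact: rput_ge0.
have [s s0 hs] := rput_subgradient k nfm.
have [Pe|eP] := leP P e.
  exists 4^-1; first lra.
  have := @hull_ge0 _ (excess 4^-1) k (excess_ge0 _); rewrite -/P; lra.
have sp : 0 < s.
  rewrite lt_neqAle s0 andbT; apply/eqP => s_0.
  have [x] := rput_small nfm e0; have := hs x; rewrite -s_0 -/P; lra.
have [u1 u101 hu1] := slice_put_small mfm k (ltac:(lra) : 0 < e / 2).
(* The bounds make the slice small, keep u below 1/4 and s - u above s / 2, and make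
   the loss u * P / (s - u) of the tilted line at most e / 2. *)
pose u := Num.min (Num.min u1 4^-1) (Num.min (s / 2) (e * s / (4 * (P + 1)))).
have u0 : 0 < u.
  rewrite /u !lt_min; apply/andP; split; apply/andP; split; try lra.
  by apply: divr_gt0; [exact: mulr_gt0|lra].
have uu1 : u <= u1 by rewrite /u !ge_min lexx.
have u4 : u <= 4^-1 by rewrite /u !ge_min lexx orbT.
have us : u <= s / 2 by rewrite /u !ge_min lexx !orbT.
have uP : u * (4 * (P + 1)) <= e * s.
  by rewrite -ler_pdivlMr; [rewrite /u !ge_min lexx !orbT|lra].
have u01 : 0 <= u < 1 by apply/andP; split; lra.
have su : 0 < s - u by lra.
exists u; first by apply/andP; split; lra.
have hsl : slice 0 u k < e / 2.
  apply: le_lt_trans hu1.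
  have h1 := excess_split k (lexx 0) (ltW u0) (ltac:(lra) : u < 1).
  have h2 := excess_split k (lexx 0) (ltac:(lra) : 0 <= u1) (ltac:(lra) : u1 < 1).
  have h3 := excess_split k (ltW u0) uu1 (ltac:(lra) : u1 < 1).
  by have := slice_put_ge0 u u1 k; lra.
have hP : u * P / (s - u) <= e / 2.
  rewrite ler_pdivrMr//.
  have : u * P <= u * (P + 1) by apply: ler_wpM2l; lra.
  have : e * (s / 2) <= e * (s - u) by apply: ler_wpM2l; lra.
  lra.
apply: le_trans (_ : P - slice 0 u k - u * P / (s - u) <= _); first by rewrite -/P; lra.
apply: hull_ub; exists (s - u) => x.
have hx := slice_put_shift k x u01.
have hsx := hs x; rewrite -/P in hsx.
have q0 : 0 <= u * P / (s - u) by apply: divr_ge0; [apply: mulr_ge0; lra|lra].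
have [kx|xk] := leP k x.
  rewrite excess_put//; rewrite pos_partE in hx; lra.
rewrite pos_part0 in hx; last lra.
have [near|far] := leP ((k - x) * (s - u)) P.
  have : u * (k - x) <= u * P / (s - u).
    rewrite ler_pdivlMr// -mulrA; apply: ler_wpM2l => //; exact: ltW.
  rewrite excess_put//; lra.
have := excess_ge0 u x; have := slice_put_ge0 0 u k; lra.
Qed.

(** Near level 1 the excess is small at two points around [k], hence so is the
    chord between them. *)
Lemma hull_excess_near1 k e : 0 < e ->
  exists2 u, 2^-1 <= u < 1 & hull (excess u) k <= e.
Proof.
move=> e0; have e2 : 0 < e / 2 by lra.
have [a0 ha0] := rput_small nfm e2.
have [b0 _ hb0] := rcall_small nfm e2.
pose a := Num.min a0 (k - 1); pose b := Num.max b0 (k + 1).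
have ak : a < k by rewrite /a gt_min; apply/orP; right; lra.
have kb : k < b by rewrite /b lt_max; apply/orP; right; lra.
have ha : rput nu a < e / 2.
  have aa0 : a <= a0 by rewrite /a ge_min lexx.
  by apply: le_lt_trans ha0; have /andP[] := rput_lipschitz nfm aa0.
have hb : put_gap mu nu b < e / 2.
  apply: le_lt_trans (put_gap_le_call mfm nfm mn b) _; apply: le_lt_trans hb0.
  by apply: call_mono => //; rewrite /b le_max lexx.
pose B := pos_part (b - G 2^-1) + 1.
have B0 : 0 < B by have := pos_part_ge0 (b - G 2^-1); rewrite /B; lra.
pose u := Num.max 2^-1 (1 - e / 2 / B).
have u2 : 2^-1 <= u by rewrite /u le_max lexx.
have u1 : u < 1.
  rewrite /u gt_max; apply/andP; split; first lra.
  by rewrite ltrBlDr ltrDl; exact: divr_gt0.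
have uB : (1 - u) * B <= e / 2.
  have : 1 - e / 2 / B <= u by rewrite /u le_max lexx orbT.
  by move=> h; rewrite -ler_pdivlMr//; lra.
exists u; first by rewrite u2 u1.
have hc := @hull_le_chord _ (excess u) k a b (excess_ge0 u) (lt_trans ak kb)
   (ltac:(by apply/andP; split; exact: ltW)).
apply: le_trans hc _; rewrite ler_pdivrMr; last lra.
have ea : excess u a <= e by have := @excess_le_put u a (ltac:(lra)); lra.
have eb : excess u b <= e.
  have u01 : 0 < u < 1 by lra.
  have := tail_put_le mfm b u01; rewrite /excess.
  have : (1 - u) * pos_part (b - G u) <= (1 - u) * B.
    apply: ler_wpM2l; first lra.
    rewrite /B; have G2 : G 2^-1 <= G u by apply: quantile_mono; lra.
    apply: le_trans (_ : pos_part (b - G 2^-1) <= _); last lra.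
    rewrite {1}/pos_part ge_max pos_part_ge0/=.
    by apply: le_trans (pos_part_ge _); lra.
  lra.
have : (b - k) * excess u a <= (b - k) * e by apply: ler_wpM2l; lra.
have : (k - a) * excess u b <= (k - a) * e by apply: ler_wpM2l; lra.
lra.
Qed.

(** As [u] runs through the levels, the hull of the excess decreases from the put
    function of [nu] to 0, at the rate [curtain_put]. *)
Lemma integral_curtain_put k :
  measurable_fun `]0 : R, 1[%classic (curtain_put k) /\
  (\int[lam]_(u in `]0%R : R, 1%R[) (curtain_put k u)%:E = put nu k)%E.
Proof.
have [mp hp] := @integral_of_monotone_increments _ (fun u => hull (excess u) k)
  (curtain_put k) G (@curtain_put_ge0 k) (fun u v => @quantile_mono _ mu u v)
  (@hull_excess_increment k).
split => //; rewrite (rputE nfm); apply/eqP; rewrite eq_le; apply/andP; split.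
  pose F (n : nat) : set R := `]n.+2%:R^-1, 1 - n.+2%:R^-1]%classic.
  have nn (n : nat) : 0 < (n.+2%:R^-1 : R) <= 2^-1.
    by rewrite invr_gt0 ltr0n lef_pV2 ?posrE ?ltr0n// ler_nat.
  have FE n : (\int[lam]_(u in F n) (curtain_put k u)%:E <= (rput nu k)%:E)%E.
    have := nn n; set q := n.+2%:R^-1 => q01.
    rewrite /F -/q hp; [|lra..].
    rewrite lee_fin lerBlDr; apply: ler_wpDr; first by apply: hull_ge0; exact: excess_ge0.
    apply: hull_le; first exact: excess_ge0.
    move=> l /minorants_ub h; apply: le_trans h _; apply: excess_le_put; lra.
  have Fcup : \bigcup_n F n = `]0, 1[%classic.
    apply/seteqP; split => w /=.
      move=> [n _]; rewrite /F/= !in_itv/=; move: (nn n); set q := n.+2%:R^-1; lra.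
    rewrite in_itv/= => /andP[w0 w1]; exists (Num.truncn (w^-1 + (1 - w)^-1)) => //.
    set N := Num.truncn _.
    have i0 : 0 < w^-1 by rewrite invr_gt0.
    have i1 : 0 < (1 - w)^-1 by rewrite invr_gt0; lra.
    have hN : w^-1 + (1 - w)^-1 < N.+2%:R.
      by apply: lt_trans (truncnS_gt _) _; rewrite ltr_nat.
    have h1 : N.+2%:R^-1 < w.
      rewrite invf_plt ?posrE//; apply: le_lt_trans hN; rewrite lerDl; exact: ltW.
    have h2 : N.+2%:R^-1 < 1 - w.
      rewrite invf_plt ?posrE ?subr_gt0//; apply: le_lt_trans hN; rewrite lerDr; exact: ltW.
    move: h1 h2; rewrite /F/= in_itv/=; set q := N.+2%:R^-1 => h1 h2.
    by apply/andP; split; lra.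
  rewrite -Fcup.
  have sub n : F n `<=` `]0, 1[.
    by rewrite -Fcup => w Fw; exists n.
  have cvg : (\int[lam]_(u in F n) (curtain_put k u)%:E @[n --> \oo] -->
     \int[lam]_(u in \bigcup_n F n) (curtain_put k u)%:E)%E.
    apply: ge0_nondecreasing_set_cvg_integral => //.
    - move=> n m nm; apply/subsetPset => w; rewrite /F/= !in_itv/= => /andP[nw wn].
      have : m.+2%:R^-1 <= n.+2%:R^-1 :> R by rewrite lef_pV2 ?posrE ?ltr0n// ler_nat.
      move: nw wn; set q := n.+2%:R^-1; set q' := m.+2%:R^-1 => nw wn q'q.
      by apply/andP; split; lra.
    - move=> n; exact: measurable_itv.
    - move=> n; apply/measurable_EFinP; exact: measurable_funS (sub n) mp.
    - move=> n w /sub; rewrite /= in_itv/= lee_fin; exact: curtain_put_ge0.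
  rewrite -(cvg_lim _ cvg)//; apply: lime_le; first by apply/cvg_ex; eexists; exact: cvg.
  by apply: nearW => n; exact: FE.
apply/lee_addgt0Pr => e e0.
have [al al01 hal] := @hull_excess_near0 k (e / 2) (ltac:(lra)).
have [be be01 hbe] := @hull_excess_near1 k (e / 2) (ltac:(lra)).
apply: (@le_trans _ _ ((hull (excess al) k - hull (excess be) k)%:E + e%:E)%E).
  by rewrite -EFinD lee_fin -lerBlDr [in X in X <= _](splitr e) opprD addrA lerB.
have /andP[al0 al2] := al01; have /andP[be2 be1] := be01.
rewrite leeD2r// -(hp al be al0 (le_trans (ltW al2) be2) be1).
apply: ge0_subset_integral => //.
- exact/measurable_EFinP.
- by move=> u /=; rewrite in_itv/= lee_fin; exact: curtain_put_ge0.
- move=> u /=; rewrite !in_itv/= => /andP[alu ube].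
  by rewrite (lt_trans al0 alu) (le_lt_trans ube be1).
Qed.

End curtain_ends.

(** * Mixtures directed by a coin *)

Section dominated_integrability.
Context d (T : measurableType d) {R : realType} (m : {measure set T -> \bar R}).

Lemma integrable_dominated (f g : T -> R) : measurable_fun [set: T] f ->
  (forall t, `|f t| <= g t) -> m.-integrable [set: T] (EFin \o g) ->
  m.-integrable [set: T] (EFin \o f).
Proof.
move=> mf fg; apply: le_integrable => //; first exact/measurable_EFinP.
by move=> t _ /=; rewrite lee_fin; apply: le_trans (fg t) (ler_norm _).
Qed.

Lemma integrable_mul01 (v g : T -> R) : measurable_fun [set: T] v ->
  (forall t, 0 <= v t <= 1) -> m.-integrable [set: T] (EFin \o g) ->
  m.-integrable [set: T] (EFin \o (fun t => v t * g t)).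
Proof.
move=> mv v01 ig; apply: (integrable_dominated _ _ (integrable_abse ig)).
  by apply: measurable_funM => //; apply/measurable_EFinP; case/integrableP: ig.
move=> t /=; rewrite normrM; have /andP[v0 v1] := v01 t.
by rewrite (ger0_norm v0) ler_piMl.
Qed.

End dominated_integrability.

Section coin_mixture.
Context d d' (T : measurableType d) (T' : measurableType d') {R : realType}.
Variables (m : probability T R) (w : T -> R) (f0 f1 : T -> T').
Hypotheses (mw : measurable_fun [set: T] w) (mf0 : measurable_fun [set: T] f0)
  (mf1 : measurable_fun [set: T] f1) (w01 : forall t, 0 <= w t <= 1).

Let coin (tz : T * measurableTypeR R) : T' := if tz.2 < w tz.1 then f1 tz.1 else f0 tz.1.

Let measurable_coin : measurable_fun [set: T * measurableTypeR R] coin.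
Proof.
apply: measurable_fun_ifT => /=.
- apply: measurable_fun_ltr; first exact: measurable_snd.
  exact: measurableT_comp mw measurable_fst.
- exact: measurableT_comp mf1 measurable_fst.
- exact: measurableT_comp mf0 measurable_fst.
Qed.

Let coinRV : {mfun (T * measurableTypeR R)%type >-> T'} :=
  HB.pack coin (@isMeasurableFun.Build _ _ _ _ coin measurable_coin).

(** The law of [f1 t] with probability [w t] and of [f0 t] otherwise, where [t] has
    law [m]; the coin is an independent uniform variable compared with [w t]. *)
Definition coin_mixture : probability T' R :=
  distribution (m \x (@unit_prob R))%E coinRV.

Lemma unit_prob_ray c : 0 <= c <= 1 -> unit_prob `]-oo, c[%classic = c%:E :> \bar R.
Proof.
move=> /andP[c0 c1]; rewrite unit_probE//.
rewrite (_ : _ `&` _ = `]0, c[%classic).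
  by rewrite lebesgue_measure_itv/= lte_fin; case: ltP => [_|?]; rewrite ?sube0//; congr EFin; lra.
apply/seteqP; split => x /=; rewrite !in_itv/=.
  by move=> [? /andP[-> _]].
move=> /andP[? ?]; split => //; apply/andP; split => //; lra.
Qed.

Lemma ge0_integral_coin_mixture (phi : T' -> \bar R) : measurable_fun [set: T'] phi ->
  (forall x, 0 <= phi x)%E ->
  (\int[coin_mixture]_x phi x =
   \int[m]_t ((w t)%:E * phi (f1 t) + (1 - w t)%:E * phi (f0 t)))%E.
Proof.
move=> mphi phi0.
have mpc : measurable_fun [set: T * measurableTypeR R] (phi \o coinRV).
  exact: measurableT_comp mphi measurable_coin.
rewrite /coin_mixture ge0_integral_distribution// fubini_tonelli1//; last first.
  by move=> x; exact: phi0.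
apply: eq_integral => t _; rewrite /fubini_F/=.
have /andP[w0 w1] := w01 t.
have mray : measurable (`]-oo, w t[%classic : set (measurableTypeR R)) by exact: measurable_itv.
have mrayC : measurable (`[w t, +oo[%classic : set (measurableTypeR R)) by exact: measurable_itv.
have cup : [set: measurableTypeR R] = `]-oo, w t[ `|` `[w t, +oo[.
  by rewrite -setCitvl setUv.
have mc : measurable_fun [set: measurableTypeR R] (fun z : measurableTypeR R => phi (coin (t, z))).
  apply: measurableT_comp mphi _; apply: measurableT_comp measurable_coin _.
  exact: pair1_measurable.
rewrite [in LHS]cup ge0_integral_setU//; last first.
- by apply/disj_setPS => z [/=]; rewrite !in_itv/= => ? /andP[? _]; lra.
- by rewrite -cup.
congr (_ + _)%E.
- under eq_integral => z.
    rewrite inE/= in_itv/= /coin/= => ->; over.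
  by rewrite integral_cst// muleC; congr (_ * _)%E; exact: unit_prob_ray.
- under eq_integral => z.
    rewrite inE/= in_itv/= andbT /coin/= leNgt => /negbTE ->; over.
  rewrite integral_cst// muleC; congr (_ * _)%E.
  rewrite -setCitvl -[LHS]/(unit_prob _) probability_setC//.
  by rewrite unit_prob_ray// -EFinB.
Qed.

Section signed.
Variable phi : T' -> R.
Hypotheses (mphi : measurable_fun [set: T'] phi)
  (i1 : m.-integrable [set: T] (EFin \o (fun t => w t * phi (f1 t))))
  (i0 : m.-integrable [set: T] (EFin \o (fun t => (1 - w t) * phi (f0 t)))).

Let mix (g : T' -> R) t := w t * g (f1 t) + (1 - w t) * g (f0 t).

Let measurable_mix (g : T' -> R) : measurable_fun [set: T'] g -> measurable_fun [set: T] (mix g).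
Proof.
move=> mg; apply: measurable_funD; apply: measurable_funM => //.
- exact: measurableT_comp mg mf1.
- by apply: measurable_funB => //; exact: measurable_cst.
- exact: measurableT_comp mg mf0.
Qed.

Let integrable_mix_norm : m.-integrable [set: T] (EFin \o mix (fun x => `|phi x|)).
Proof.
have := integrableD measurableT (integrable_abse i1) (integrable_abse i0).
apply: eq_integrable => // t _; rewrite /= -EFinD /mix; congr EFin.
by have /andP[? ?] := w01 t; rewrite !normrM !(ger0_norm (x := _ - _)) ?(ger0_norm (x := w t))//; lra.
Qed.

Let integrable_mix (g : T' -> R) : measurable_fun [set: T'] g -> (forall x, `|g x| <= `|phi x|) ->
  m.-integrable [set: T] (EFin \o mix g).
Proof.
move=> mg gphi; apply: (integrable_dominated (measurable_mix mg) _ integrable_mix_norm) => t.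
have /andP[? ?] := w01 t.
rewrite ler_norml /mix; apply/andP; split.
  rewrite lerNl opprD -!mulrN; apply: lerD; apply: ler_wpM2l; rewrite ?subr_ge0//.
    by apply: le_trans (gphi _); rewrite -normrN ler_norm.
  by apply: le_trans (gphi _); rewrite -normrN ler_norm.
by apply: lerD; apply: ler_wpM2l; rewrite ?subr_ge0//; exact: le_trans (ler_norm _) (gphi _).
Qed.

Let Rintegral_ge0_mix (g : T' -> R) : measurable_fun [set: T'] g -> (forall x, 0 <= g x) ->
  \int[coin_mixture]_x g x = \int[m]_t mix g t.
Proof.
move=> mg g0; congr fine; rewrite ge0_integral_coin_mixture//; last exact/measurable_EFinP.
Qed.

Lemma integrable_coin_mixture : coin_mixture.-integrable [set: T'] (EFin \o phi).
Proof.
apply/integrableP; split; first exact/measurable_EFinP.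
rewrite ge0_integral_coin_mixture//; last by do 2 apply: measurableT_comp => //.
have /integrableP[_] := integrable_mix_norm; apply: le_lt_trans.
apply: ge0_le_integral => //.
- move=> t _ /=; have /andP[? ?] := w01 t.
  by rewrite -!EFinM -EFinD lee_fin; apply: addr_ge0; apply: mulr_ge0; rewrite ?subr_ge0.
- apply/measurable_EFinP; exact: (@measurable_mix (fun x => `|phi x|) (measurableT_comp _ _)).
- apply: measurableT_comp => //; apply/measurable_EFinP.
  exact: (@measurable_mix (fun x => `|phi x|) (measurableT_comp _ _)).
- by move=> t _; exact: ler_norm.
Qed.

Lemma Rintegral_coin_mixture :
  \int[coin_mixture]_x phi x = \int[m]_t (w t * phi (f1 t) + (1 - w t) * phi (f0 t)).
Proof.
have mp : measurable_fun [set: T'] (fun x => pos_part (phi x)) by exact: measurable_pos_part.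
have mn : measurable_fun [set: T'] (fun x => pos_part (- phi x)).
  by apply: measurable_pos_part; exact: measurableT_comp.
have pE x : phi x = pos_part (phi x) - pos_part (- phi x).
  have [h|h] := leP 0 (phi x).
    by rewrite pos_partE// pos_part0 ?subr0//; lra.
  by rewrite (pos_part0 (ltW h)) pos_partE; lra.
have bp x : `|pos_part (phi x)| <= `|phi x|.
  by rewrite ger0_norm ?pos_part_ge0// /pos_part ge_max normr_ge0 ler_norm.
have bn x : `|pos_part (- phi x)| <= `|phi x|.
  by rewrite ger0_norm ?pos_part_ge0// /pos_part ge_max normr_ge0/= -normrN ler_norm.
have ip : coin_mixture.-integrable [set: T'] (EFin \o (fun x => pos_part (phi x))).
  exact: integrable_dominated mp bp (integrable_abse integrable_coin_mixture).
have in' : coin_mixture.-integrable [set: T'] (EFin \o (fun x => pos_part (- phi x))).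
  exact: integrable_dominated mn bn (integrable_abse integrable_coin_mixture).
transitivity (\int[coin_mixture]_x (pos_part (phi x) - pos_part (- phi x))).
  by apply: eq_Rintegral => x _; exact: pE.
rewrite RintegralB// !Rintegral_ge0_mix//; try by move=> x; exact: pos_part_ge0.
rewrite -RintegralB//; [|exact: integrable_mix..].
apply: eq_Rintegral => t _; rewrite /mix [X in _ = w t * X + _]pE [X in _ = _ + _ * X]pE.
by ring.
Qed.

End signed.

End coin_mixture.

(** * Martingale couplings and left-monotonicity *)

Section plane.
Context {R : realType}.
Local Notation Om := (measurableTypeR R * measurableTypeR R)%type.
Implicit Types (P : probR2 R) (mu nu m : probR R).

Lemma measurable_procX : measurable_fun [set: Om] (@procX R).
Proof. exact: measurable_fst. Qed.

Lemma measurable_procY : measurable_fun [set: Om] (@procY R).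
Proof. exact: measurable_snd. Qed.

Lemma ge0_integral_law P (Z : Om -> measurableTypeR R) m (f : R -> \bar R) :
  measurable_fun [set: Om] Z -> has_law P Z m ->
  measurable_fun [set: measurableTypeR R] f -> (forall x : R, (0 <= f x)%E) ->
  (\int[P]_w f (Z w) = \int[m]_x f x)%E.
Proof.
move=> mZ hl mf f0.
rewrite -[LHS](@ge0_integral_pushforward _ _ _ _ _ Z mZ P setT)//.
apply: eq_measure_integral => A mA _; exact: hl.
Qed.

Lemma integrable_law P (Z : Om -> measurableTypeR R) m (f : R -> R) :
  measurable_fun [set: Om] Z -> has_law P Z m ->
  m.-integrable [set: measurableTypeR R] (EFin \o f) ->
  P.-integrable [set: Om] (EFin \o (fun w => f (Z w))).
Proof.
move=> mZ hl /integrableP[mf fi]; apply/integrableP; split.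
  exact: measurableT_comp mf mZ.
have := @ge0_integral_law P Z m (fun x => `|(f x)%:E|)%E mZ hl.
move=> -> //; by apply: measurableT_comp.
Qed.

Lemma measurable_indic_X (B : set (measurableTypeR R)) : measurable B ->
  measurable_fun [set: Om] (fun w => \1_B (procX w) : R).
Proof. by move=> mB; apply: measurableT_comp measurable_procX; exact: measurable_indic. Qed.

Lemma indicX_le1 (B : set (measurableTypeR R)) (w : Om) : 0 <= (\1_B (procX w) : R) <= 1.
Proof. by rewrite indicE; case: (_ \in _); rewrite /= ?lexx ler01. Qed.

Section martingale_property.
Variable P : probR2 R.
Hypotheses (iX : P.-integrable [set: Om] (fun w => (procX w : R)%:E))
  (iY : P.-integrable [set: Om] (fun w => (procY w : R)%:E)).

Let indic_int (B : set (measurableTypeR R)) (Z : Om -> R) : measurable B ->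
  P.-integrable [set: Om] (EFin \o Z) ->
  P.-integrable [set: Om] (EFin \o (fun w => \1_B (procX w) * Z w)).
Proof. by move=> mB; apply: integrable_mul01 (measurable_indic_X mB) _; exact: indicX_le1. Qed.

Lemma integrable_indic_increment (B : set (measurableTypeR R)) : measurable B ->
  P.-integrable [set: Om] (EFin \o (fun w => \1_B (procX w) * (procY w - procX w))).
Proof.
move=> mB; apply: indic_int => //.
exact: (integrableB measurableT iY iX).
Qed.

Lemma condexp_incrementP : is_condexp P (@procY R) (@procX R) (@procX R) <->
  (forall B : set (measurableTypeR R), measurable B ->
     \int[P]_w (\1_B (procX w) * (procY w - procX w)) = 0).
Proof.
have key (B : set (measurableTypeR R)) (Z : Om -> R) : measurable B ->
    measurable_fun [set: Om] Z ->
    P.-integrable [set: Om] (EFin \o Z) ->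
    (\int[P]_(w in (@procX R) @^-1` B) (Z w)%:E = (\int[P]_w (\1_B (procX w) * Z w))%:E)%E.
  move=> mB mZ iZ.
  rewrite /Rintegral fineK; last by apply: integrable_fin_num => //; exact: indic_int.
  rewrite [LHS]integral_mkcond; apply: eq_integral => w _.
  rewrite patchE indicE; case: ifPn; rewrite ?inE ?notin_setE/= => h.
    by rewrite mem_set// mul1r.
  by rewrite memNset// mul0r.
have incr (B : set (measurableTypeR R)) : measurable B ->
    \int[P]_w (\1_B (procX w) * (procY w - procX w)) =
    \int[P]_w (\1_B (procX w) * (procY w)) - \int[P]_w (\1_B (procX w) * (procX w)).
  move=> mB; rewrite -RintegralB//.
  - by apply: eq_Rintegral => w _; rewrite mulrBr.
  - exact: indic_int.
  - exact: indic_int.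
split.
  move=> [_ _ _ h] B mB; rewrite incr//.
  have sB : preimage_set_system [set: Om] (@procX R) measurable ((@procX R) @^-1` B).
    by exists B => //; rewrite setTI.
  have := h _ sB; rewrite !key//; [|exact: measurable_procY|exact: measurable_procX].
  by move=> [->]; rewrite subrr.
move=> h; split => //.
  by move=> B mB; exists B => //; rewrite setTI.
move=> _ [B mB <-]; rewrite setTI !key//; [|exact: measurable_procY|exact: measurable_procX].
by congr EFin; apply/eqP; rewrite eq_sym -subr_eq0 -incr// h.
Qed.

End martingale_property.

(** Rational numbers separate the strict inequalities of a forbidden
    configuration, so countably many null sets remove all of them. *)
Lemma left_monotone_of_null_sets P :
  (forall s t q : R, s < t -> exists N : set Om, [/\ measurable N, P N = 0%E &
     forall x y0 y1 x' y', y0 < s -> s < y' -> y' < t -> t < y1 -> x < q -> q < x' ->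
       [\/ N (x, y0), N (x, y1) | N (x', y')]]) ->
  left_monotone P.
Proof.
move=> h.
pose good (a : rat * rat * rat) (N : set Om) := [/\ measurable N, P N = 0%E &
     forall x y0 y1 x' y', y0 < ratr a.1.1 -> ratr a.1.1 < y' -> y' < ratr a.1.2 ->
       ratr a.1.2 < y1 -> x < ratr a.2 -> ratr a.2 < x' ->
       [\/ N (x, y0), N (x, y1) | N (x', y')]].
have /choice[N hN] : forall a, exists N, ratr a.1.1 < (ratr a.1.2 : R) -> good a N.
  move=> a; have [st|ts] := ltP (ratr a.1.1) (ratr a.1.2 : R).
    by have [N [? ? ?]] := h _ _ (ratr a.2) st; exists N => _; split.
  by exists set0.
pose M (n : nat) : set Om := if (unpickle n : option (rat * rat * rat)) is Some a
   then if ratr a.1.1 < (ratr a.1.2 : R) then N a else set0 else set0.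
have mM n : measurable (M n).
  by rewrite /M; case: unpickle => [a|//]; case: ifP => // /hN[].
have P0 n : P (M n) = 0%E.
  by rewrite /M; case: unpickle => [a|]; rewrite ?measure0//; case: ifP => [/hN[]//|]; rewrite measure0.
have mU : measurable (\bigcup_n M n) by exact: bigcupT_measurable.
exists (~` (\bigcup_n M n)); split; first exact: measurableC.
  rewrite probability_setC// (_ : P _ = 0%E) ?sube0//.
  apply: measure_negligible => //; apply: negligible_bigcup => n.
  exact: (negligibleP _ (mM n)).2 (P0 n).
move=> x y0 y1 x' y' h0 h1 h' xx' /andP[yy' y'y].
have [s] := rat_in_itvoo yy'; rewrite in_itv/= => /andP[s0 s1].
have [t] := rat_in_itvoo y'y; rewrite in_itv/= => /andP[t0 t1].
have [q] := rat_in_itvoo xx'; rewrite in_itv/= => /andP[q0 q1].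
have st : ratr s < (ratr t : R) by exact: lt_trans t0.
have [_ _ /(_ x y0 y1 x' y' s0 s1 t0 t1 q0 q1)] := hN (s, t, q) st.
have inM z : N (s, t, q) z -> (\bigcup_n M n) z.
  move=> Nz; have MN : M (pickle (s, t, q)) = N (s, t, q) by rewrite /M pickleK st.
  by apply: (@bigcup_sup _ _ (pickle (s, t, q)) setT M); [exact: I|rewrite MN].
by move=> [/inM/h0|/inM/h1|/inM/h'].
Qed.

End plane.

(** * The left-curtain coupling *)

Section left_curtain.
Context {R : realType}.
Variables mu nu : probR R.
Hypotheses (mfm : finite_first_moment mu) (nfm : finite_first_moment nu).
Hypothesis mn : convex_order mu nu.
Implicit Types (u v x k q : R).

Local Notation G := (quantile mu).
Local Notation lo := (lower mu nu).
Local Notation up := (upper mu nu).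
Local Notation exc := (excess mu nu).
Local Notation Om := (measurableTypeR R * measurableTypeR R)%type.

Definition contact u k := exists s, support_line (exc u) k s.

(** Lowering the level adds to the excess a slice, which is convex, and
    subgradients add up. *)
Lemma contact_antimono u v k : 0 <= u -> u <= v -> v < 1 -> contact v k -> contact u k.
Proof.
move=> u0 uv v1 [s hs]; have [s' hs'] := slice_put_subgradient mfm k u0 uv v1.
exists (s + s') => z; rewrite !(excess_split nu mfm _ u0 uv v1).
by have := hs z; have := hs' z; lra.
Qed.

Lemma contact_lower u : 0 < u < 1 -> contact u (lo u).
Proof. by move=> /(curtain_bracket mfm nfm mn)[s [_ ? _ _ _]]; exists s. Qed.

Lemma contact_upper u : 0 < u < 1 -> contact u (up u).
Proof. by move=> /(curtain_bracket mfm nfm mn)[s [_ _ ? _ _]]; exists s. Qed.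

Lemma lower_quantile_upper u : lo u <= G u <= up u.
Proof.
have [u01|u01] := boolP (0 < u < 1).
  by have [s [? _ _ _ _]] := curtain_bracket mfm nfm mn u01.
rewrite /lower /upper /quantile !patchE !mem_setE !in_itv/= (negbTE u01); exact/andP.
Qed.

Lemma upper_minimal u k : 0 < u < 1 -> contact u k -> G u <= k -> up u <= k.
Proof.
move=> u01 [s' hk] gk; have [s [/andP[lg gu] _ _ nok hab]] := curtain_bracket mfm nfm mn u01.
rewrite leNgt; apply/negP => ku; apply: (nok k s') => //.
by have /andP[? ?] := hab (le_lt_trans lg (le_lt_trans gk ku)); apply/andP; split; lra.
Qed.

Lemma lower_maximal u k : 0 < u < 1 -> contact u k -> k <= G u -> k <= lo u.
Proof.
move=> u01 [s' hk] kg; have [s [/andP[lg gu] _ _ nok hab]] := curtain_bracket mfm nfm mn u01.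
rewrite leNgt; apply/negP => lk; apply: (nok k s') => //.
by have /andP[? ?] := hab (lt_le_trans lk (le_trans kg gu)); apply/andP; split; lra.
Qed.

Lemma degenerate_bracket u : 0 < u < 1 -> lo u = G u -> up u = G u.
Proof.
move=> u01 e; have [s [/andP[lg gu] _ _ _ hab]] := curtain_bracket mfm nfm mn u01.
apply/eqP; rewrite eq_le gu andbT leNgt; apply/negP => h.
by have := hab (le_lt_trans lg h); rewrite e ltxx.
Qed.

Lemma upper_mono u v : 0 < u < 1 -> 0 < v < 1 -> u <= v -> up u <= up v.
Proof.
move=> u01 v01 uv; apply: upper_minimal => //.
  by apply: (contact_antimono (v := v)); [lra..|exact: contact_upper].
have /andP[_] := lower_quantile_upper v; apply: le_trans; exact: quantile_mono.
Qed.

Lemma measurable_upper : measurable_fun [set: measurableTypeR R]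
  (up : measurableTypeR R -> measurableTypeR R).
Proof.
have i01 : is_interval (`]0, 1[%classic : set R) by exact: interval_is_interval.
apply: (iffLR (measurable_restrictT _ _)) => //.
apply: (@nondecreasing_on_measurable R `]0, 1[%classic _ i01).
move=> x y; rewrite /= !in_itv/= => x01 y01 xy.
by have := upper_mono x01 y01 xy; rewrite /upper !patchE !mem_setE !in_itv/= x01 y01.
Qed.

(** The lower end is not monotone in the level. It is at least [r] when some
    contact point lies between [r] and a rational number below the quantile, or
    when the bracket is a single point with quantile at least [r]. Contact points
    persist at lower levels and quantiles increase, so the sets of levels that
    occur are intervals. *)
Lemma measurable_lower : measurable_fun [set: measurableTypeR R]
  (lo : measurableTypeR R -> measurableTypeR R).
Proof.
apply: (iffLR (measurable_restrictT _ _)) => //.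
apply: (measurability (@RGenCInfty.G R)) => [|/= _ [_] [r] -> <-].
  exact: RGenCInfty.measurableE.
pose A q : set (measurableTypeR R) := [set u | 0 < u < 1 /\ q <= G u].
pose B q : set (measurableTypeR R) :=
  [set u | 0 < u < 1 /\ exists2 z, r <= z <= q & contact u z].
pose D : set (measurableTypeR R) := [set u | up u == G u].
have mA q : measurable (A q).
  apply: is_interval_measurable => a b [a01 qa] [b01 _] u aub.
  have u01 : 0 < u < 1 by lra.
  split => //; apply: le_trans qa _; apply: quantile_mono => //; lra.
have mB q : measurable (B q).
  apply: is_interval_measurable => a b [a01 _] [b01 [z rzq hz]] u aub.
  split; first lra.
  by exists z => //; apply: contact_antimono hz; lra.
have mD : measurable D.
  rewrite -[D]setTI; apply: (measurable_fun_eqr measurable_upper (measurable_quantile mu)) => //.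
rewrite (_ : _ `&` _ = (\bigcup_(p : rat) (A (ratr p) `&` B (ratr p))) `|` (A r `&` D)).
  apply: measurableU; last exact: measurableI.
  by apply: bigcupT_measurable_rat => p; exact: measurableI.
apply/seteqP; split => u.
  rewrite /= !in_itv/= andbT => [[u01]].
  have -> : (ends mu nu u).1 = lo u by rewrite /lower patchE mem_setE in_itv/= u01.
  move=> ru; have /andP[lg gu] := lower_quantile_upper u.
  have [lG|Gl] := ltP (lo u) (G u); last first.
    right; split; first by split => //; exact: le_trans lg.
    by rewrite /D/=; apply/eqP/degenerate_bracket => //; apply/eqP; rewrite eq_le lg.
  left; have [p] := rat_in_itvoo lG; rewrite in_itv/= => /andP[lp pg].
  exists p => //; split; split => //; first exact: ltW.
  by exists (lo u); [rewrite ru ltW|exact: contact_lower].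
rewrite /= !in_itv/= andbT => h.
have u01 : 0 < u < 1 by case: h => [[p _ [[]]]|[[]]].
have -> : (ends mu nu u).1 = lo u by rewrite /lower patchE mem_setE in_itv/= u01.
split => //; case: h => [[p _ [[_ pG] [_ [z /andP[rz zp] cz]]]]|[[_ rG] /eqP uG]].
  by apply: le_trans rz _; apply: lower_maximal => //; exact: le_trans pG.
apply: le_trans rG _; apply: lower_maximal => //.
by rewrite -uG; exact: contact_upper.
Qed.

(** If both ends coincide, they are the quantile itself, and the weight, which is
    then 0 since division by 0 gives 0, does not influence the law. *)
Definition up_weight u : R := (G u - lo u) / (up u - lo u).

Lemma up_weight01 u : 0 <= up_weight u <= 1.
Proof.
have /andP[lg gu] := lower_quantile_upper u; rewrite /up_weight.
have [e|ne] := eqVneq (up u) (lo u); first by rewrite e subrr invr0 mulr0 lexx ler01.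
have ul : 0 < up u - lo u by rewrite subr_gt0 lt_neqAle eq_sym ne; lra.
apply/andP; split; first by apply: divr_ge0; lra.
by rewrite ler_pdivrMr// mul1r; lra.
Qed.

Lemma up_weight_mean u : up_weight u * (up u - G u) = (1 - up_weight u) * (G u - lo u).
Proof.
have /andP[lg gu] := lower_quantile_upper u; rewrite /up_weight.
have [e|ne] := eqVneq (up u) (lo u).
  have e1 : G u = lo u by lra.
  by rewrite e e1 !subrr !(mul0r, mulr0).
by field; rewrite subr_eq0.
Qed.

Lemma curtain_putE u k : 0 < u < 1 ->
  curtain_put mu nu k u = up_weight u * pos_part (k - up u) + (1 - up_weight u) * pos_part (k - lo u).
Proof.
move=> u01; have /andP[lg gu] := lower_quantile_upper u.
rewrite /curtain_put /two_point_put /up_weight; case: ltP => lu.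
  by field; lra.
have e1 : lo u = G u by lra. have e2 : up u = G u by lra.
by rewrite e1 e2 subrr mul0r mul0r add0r subr0 mul1r.
Qed.

Lemma measurable_up_weight : measurable_fun [set: measurableTypeR R] up_weight.
Proof.
have -> : up_weight = (fun u => (G u - lo u) * ((fun x => x^-1) \_ `]0, +oo[%classic) (up u - lo u)).
  apply/funext => u; rewrite /up_weight patchE mem_setE in_itv/= andbT subr_gt0.
  case: ltP => // ul; have /andP[lg gu] := lower_quantile_upper u.
  by rewrite (_ : G u - lo u = 0) ?mul0r//; lra.
apply: measurable_funM.
  by apply: measurable_funB; [exact: measurable_quantile|exact: measurable_lower].
apply: measurableT_comp; first exact: measurable_inv_gt0.
by apply: measurable_funB; [exact: measurable_upper|exact: measurable_lower].
Qed.

Let pair_with (f : R -> R) (u : measurableTypeR R) : Om := (G u, f u).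

Let measurable_pair_with (f : R -> R) :
  measurable_fun [set: measurableTypeR R] (f : measurableTypeR R -> measurableTypeR R) ->
  measurable_fun [set: measurableTypeR R] (pair_with f).
Proof. by move=> mf; apply/measurable_fun_pairP; split => //; exact: measurable_quantile. Qed.

(** A uniform level [u] is sent to its quantile paired with one of the two ends of
    the bracket at this level, with mean the quantile. *)
Definition left_curtain : probR2 R :=
  coin_mixture (@unit_prob R) measurable_up_weight
    (measurable_pair_with measurable_lower) (measurable_pair_with measurable_upper).

Lemma ge0_integral_left_curtain (phi : Om -> \bar R) :
  measurable_fun [set: Om] phi -> (forall w, 0%E <= phi w)%E ->
  (\int[left_curtain]_w phi w = \int[unit_prob]_u
     ((up_weight u)%:E * phi (G u, up u) + (1 - up_weight u)%:E * phi (G u, lo u)))%E.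
Proof. by move=> mphi phi0; rewrite ge0_integral_coin_mixture//; exact: up_weight01. Qed.

Lemma left_curtain_procX : has_law left_curtain (@procX R) mu.
Proof.
move=> A mA.
have mXA : measurable ((@procX R) @^-1` A).
  by rewrite -[X in measurable X]setTI; exact: measurable_procX.
have := @ge0_integral_left_curtain (fun w => (\1_A w.1)%:E).
rewrite -(quantile_law_measurable mu mA).
have -> : (fun w : Om => (\1_A w.1)%:E) = (fun w => (\1_((@procX R) @^-1` A) w)%:E) :> (Om -> \bar R).
  by apply/funext => w; rewrite !indicE.
rewrite integral_indic// setIT => h; rewrite /pushforward; rewrite h; last first.
- by move=> w; rewrite lee_fin.
- exact/measurable_EFinP/measurable_indic.
have mGA : measurable (G @^-1` A : set (measurableTypeR R)).
  by rewrite -[X in measurable X]setTI; exact: measurable_quantile.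
transitivity (\int[unit_prob]_u (\1_(G @^-1` A) u)%:E)%E; last by rewrite integral_indic// setIT.
apply: eq_integral => u _.
have e : \1_A (G u) = \1_(G @^-1` A) u :> R.
  by rewrite !indicE; congr (nat_of_bool _)%:R; apply/idP/idP; rewrite !inE.
rewrite /= e -!EFinM -EFinD; congr EFin.
by rewrite -mulrDl addrC subrK mul1r.
Qed.

Let procY_mfun : {mfun Om >-> measurableTypeR R} :=
  HB.pack (@procY R) (@isMeasurableFun.Build _ _ Om (measurableTypeR R) (@procY R) (@measurable_procY R)).

(** The put function of the second marginal is the integral of those of the
    two-point laws, and the put function determines the law. *)
Lemma left_curtain_procY : has_law left_curtain (@procY R) nu.
Proof.
have putE k : put (distribution left_curtain procY_mfun) k = put nu k.
  rewrite {1}/put ge0_integral_distribution//; last first.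
  - by move=> y; rewrite lee_fin pos_part_ge0.
  - exact: measurable_put_payoff.
  rewrite ge0_integral_left_curtain; last first.
  - by move=> w; rewrite lee_fin pos_part_ge0.
  - exact: measurableT_comp (measurable_put_payoff k) (@measurable_procY R).
  have [_ <-] := integral_curtain_put mfm nfm mn k.
  rewrite integral_unit_prob; last first.
  - move=> u /=; rewrite -!EFinM -EFinD lee_fin; have /andP[? ?] := up_weight01 u.
    by apply: addr_ge0; apply: mulr_ge0; rewrite ?pos_part_ge0 ?subr_ge0.
  - rewrite [X in measurable_fun _ X](_ : _ = EFin \o (fun u => up_weight u * pos_part (k - up u) +
      (1 - up_weight u) * pos_part (k - lo u))) //.
    apply/measurable_EFinP; apply: measurable_funD; apply: measurable_funM.
    + exact: measurable_up_weight.
    + apply: measurable_pos_part; apply: measurable_funB; [exact: measurable_cst|exact: measurable_upper].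
    + apply: measurable_funB; [exact: measurable_cst|exact: measurable_up_weight].
    + apply: measurable_pos_part; apply: measurable_funB; [exact: measurable_cst|exact: measurable_lower].
  apply: eq_integral => u; rewrite inE/= in_itv/= => u01.
  by rewrite curtain_putE// EFinD !EFinM.
have pfin k : put (distribution left_curtain procY_mfun) k \is a fin_num.
  by rewrite putE rputE.
exact: (eq_probability_of_put putE pfin).
Qed.

Lemma left_curtain_condexp : is_condexp left_curtain (@procY R) (@procX R) (@procX R).
Proof.
have iX : left_curtain.-integrable [set: Om] (fun w => (procX w : R)%:E).
  exact: (@integrable_law _ left_curtain (@procX R) mu idfun (@measurable_procX R) left_curtain_procX).
have iY : left_curtain.-integrable [set: Om] (fun w => (procY w : R)%:E).
  exact: (@integrable_law _ left_curtain (@procY R) nu idfun (@measurable_procY R) left_curtain_procY).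
apply/(condexp_incrementP iX iY) => B mB.
pose part (s : R) (w : Om) : R := \1_B (procX w) * pos_part (s * (procY w - procX w)).
have mpart s : measurable_fun [set: Om] (part s).
  apply: measurable_funM; first exact: measurable_indic_X.
  apply: measurable_pos_part; apply: measurable_funM; first exact: measurable_cst.
  by apply: measurable_funB; [exact: measurable_procY|exact: measurable_procX].
have part0 s w : 0 <= part s w.
  by apply: mulr_ge0; [have /andP[] := indicX_le1 B w|exact: pos_part_ge0].
have ipart s : `|s| = 1 -> left_curtain.-integrable [set: Om] (EFin \o part s).
  move=> s1; have := integrable_abse (integrable_indic_increment iX iY mB).
  apply: integrable_dominated => // w.
  rewrite /= ger0_norm// normrM; have /andP[b0 _] := indicX_le1 B w.
  rewrite (ger0_norm b0); apply: ler_wpM2l => //.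
  rewrite /pos_part ge_max normr_ge0/= -[leRHS]mul1r -s1 -normrM; exact: ler_norm.
have E s : \int[left_curtain]_w part s w = fine (\int[unit_prob]_u
     ((up_weight u)%:E * (part s (G u, up u))%:E + (1 - up_weight u)%:E * (part s (G u, lo u))%:E))%E.
  congr fine; rewrite (@ge0_integral_left_curtain (EFin \o part s))//.
    exact/measurable_EFinP.
  by move=> w; rewrite lee_fin.
transitivity (\int[left_curtain]_w (part 1 w - part (-1) w)).
  apply: eq_Rintegral => w _; rewrite /part mul1r mulN1r -mulrBr; congr (_ * _).
  by case: (leP 0 (procY w - procX w)) => h; [rewrite pos_partE// pos_part0 ?subr0//|
    rewrite (pos_part0 (ltW h)) pos_partE]; lra.
rewrite RintegralB//; [|by apply: ipart; rewrite ?normrN normr1..].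
apply/eqP; rewrite subr_eq0; apply/eqP; rewrite !E; congr fine.
apply: eq_integral => u _; rewrite /part /procX /procY /= !mul1r !mulN1r.
have /andP[lg gu] := lower_quantile_upper u.
rewrite -!EFinM -!EFinD; congr EFin.
rewrite (pos_partE (z := up u - G u)) ?(pos_part0 (z := - (up u - G u)))
  ?(pos_part0 (z := lo u - G u)) ?(pos_partE (z := - (lo u - G u))); try lra.
rewrite !mulr0 addr0 add0r mulrCA up_weight_mean opprB.
by ring.
Qed.

Lemma left_curtain_coupling : martingale_couplings mu nu left_curtain.
Proof.
split; [exact: left_curtain_procX|exact: left_curtain_procY|exact: left_curtain_condexp].
Qed.

Lemma left_curtain_null (N : set Om) : measurable N ->
  (forall u, 0 < u < 1 -> ~ N (G u, up u) /\ ~ N (G u, lo u)) -> left_curtain N = 0%E.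
Proof.
move=> mN hN.
have := @ge0_integral_left_curtain (fun w => (\1_N w)%:E).
rewrite integral_indic// setIT => ->; last first.
- by move=> w; rewrite lee_fin.
- exact/measurable_EFinP/measurable_indic.
rewrite integral_unit_prob; last first.
- move=> u /=; rewrite -!EFinM -EFinD lee_fin; have /andP[? ?] := up_weight01 u.
  by apply: addr_ge0; apply: mulr_ge0; rewrite ?subr_ge0// indicE ler0n.
- have mI (f : R -> R) : measurable_fun [set: measurableTypeR R] (f : measurableTypeR R -> measurableTypeR R) ->
    measurable_fun [set: measurableTypeR R] (fun u : measurableTypeR R => \1_N (pair_with f u) : R).
    move=> mf; apply: measurableT_comp (measurable_pair_with mf); exact: measurable_indic.
  rewrite [X in measurable_fun _ X](_ : _ = EFin \o (fun u => up_weight u * \1_N (G u, up u) +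
      (1 - up_weight u) * \1_N (G u, lo u))) //.
  apply/measurable_EFinP; apply: measurable_funD; apply: measurable_funM.
  + exact: measurable_up_weight.
  + exact: mI measurable_upper.
  + apply: measurable_funB; [exact: measurable_cst|exact: measurable_up_weight].
  + exact: mI measurable_lower.
apply: integral0_eq => u; rewrite /= in_itv/= => /hN[h1 h2].
by rewrite !indicE !memNset// !mule0 adde0.
Qed.

(** If a level with quantile at least [q] has a contact point [z] between [s] and
    [t], then so have all levels with quantile below [q], and their brackets do
    not cross [z]. If there is no such level, nothing above [q] is sent between [s]
    and [t], because the ends of brackets are contact points. *)
Lemma left_curtain_left_monotone : left_monotone left_curtain.
Proof.
apply: left_monotone_of_null_sets => s t q st.
have mX (D : set (measurableTypeR R)) : measurable D -> measurable ((@procX R) @^-1` D).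
  by move=> mD; rewrite -[X in measurable X]setTI; exact: measurable_procX.
have mY (D : set (measurableTypeR R)) : measurable D -> measurable ((@procY R) @^-1` D).
  by move=> mD; rewrite -[X in measurable X]setTI; exact: measurable_procY.
pose touched := exists u z, [/\ 0 < u < 1, q <= G u, s < z < t & contact u z].
have [[u [z [u01 qu szt cz]]]|free] := pselect touched.
  have below v : 0 < v < 1 -> G v < q -> contact v z.
    move=> v01 vq; apply: contact_antimono cz; [lra| |lra].
    rewrite leNgt; apply/negP => uv.
    by have := quantile_mono mu u01 v01 (ltW uv); lra.
  exists ((@procX R) @^-1` `]-oo, q[ `&`
    ((@procX R) @^-1` `]-oo, z] `&` (@procY R) @^-1` `]t, +oo[ `|`
     (@procX R) @^-1` `[z, +oo[ `&` (@procY R) @^-1` `]-oo, s[)); split.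
  - by apply: measurableI; [|apply: measurableU; apply: measurableI]; (apply: mX || apply: mY); exact: measurable_itv.
  - apply: left_curtain_null.
      by apply: measurableI; [|apply: measurableU; apply: measurableI]; (apply: mX || apply: mY); exact: measurable_itv.
    move=> v v01; rewrite /procX /procY /= !in_itv/= !andbT.
    have /andP[lg gu] := lower_quantile_upper v.
    split.
      move=> [vq [[gz tu]|[zg us]]]; last by lra.
      by have := upper_minimal v01 (below v v01 vq) gz; lra.
    move=> [vq [[gz tu]|[zg us]]]; first by lra.
    by have := lower_maximal v01 (below v v01 vq) zg; lra.
  - move=> x y0 y1 x' y' h1 h2 h3 h4 xq qx'.
    have [xz|zx] := leP x z.
      by apply: Or32; rewrite /procX /procY /= !in_itv/= !andbT; split => //; left.
    by apply: Or31; rewrite /procX /procY /= !in_itv/= !andbT; split => //; right; split => //; exact: ltW.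
exists ((@procX R) @^-1` `]q, +oo[ `&` (@procY R) @^-1` `]s, t[); split.
- by apply: measurableI; (apply: mX || apply: mY); exact: measurable_itv.
- apply: left_curtain_null.
    by apply: measurableI; (apply: mX || apply: mY); exact: measurable_itv.
  move=> v v01; rewrite /procX /procY /= !in_itv/= !andbT; split => -[qv yst]; apply: free.
    by exists v, (up v); split => //; [exact: ltW|exact: contact_upper].
  by exists v, (lo v); split => //; [exact: ltW|exact: contact_lower].
- move=> x y0 y1 x' y' h1 h2 h3 h4 xq qx'; apply: Or33.
  by rewrite /procX /procY /= !in_itv/= !andbT; split => //; apply/andP; split.
Qed.

End left_curtain.

(** * Conditional densities given the first coordinate *)

Section integrals_from_sets.
Context d d' (T : measurableType d) (T' : measurableType d') {R : realType}.
Variables (m : {measure set T -> \bar R}) (X : T -> T').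
Hypothesis mX : measurable_fun [set: T] X.
Local Open Scope ereal_scope.
Import HBNNSimple.

Let integral_nnsfun_comp (Z : T -> \bar R) (h : {nnsfun T' >-> R}) :
  measurable_fun [set: T] Z -> (forall t, 0 <= Z t) ->
  \int[m]_t ((h (X t))%:E * Z t) =
  \sum_(r \in range h) r%:E * \int[m]_t ((\1_(h @^-1` [set r]) (X t))%:E * Z t).
Proof.
move=> mZ Z0.
have mi r : measurable_fun [set: T] (fun t => (\1_(h @^-1` [set r]) (X t))%:E * Z t).
  apply: emeasurable_funM => //; apply/measurable_EFinP.
  by apply: measurableT_comp mX; exact: measurable_indic.
have i0 r t : 0 <= (\1_(h @^-1` [set r]) (X t))%:E * Z t by rewrite mule_ge0// lee_fin.
have ri0 r t : 0 <= r%:E * ((\1_(h @^-1` [set r]) (X t))%:E * Z t).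
  by rewrite muleA mule_ge0// -EFinM nnfun_muleindic_ge0.
under eq_integral => t _.
  rewrite fimfunE -fsumEFin// ge0_mule_fsuml; last first.
    by move=> r; rewrite EFinM nnfun_muleindic_ge0.
  under eq_fsbigr do rewrite EFinM -muleA.
  over.
rewrite ge0_integral_fsum//; last by move=> r; exact: emeasurable_funM.
apply: eq_fsbigr => r _; have [r0|r0] := leP 0%R r.
  by rewrite ge0_integralZl.
rewrite integral0_eq ?integral0_eq ?mule0//.
  by move=> t _; rewrite preimage_nnfun0// indic0 mul0e.
by move=> t _; rewrite preimage_nnfun0// indic0 mul0e mule0.
Qed.

Lemma ge0_eq_integral_comp (Z1 Z2 : T -> \bar R) :
  measurable_fun [set: T] Z1 -> (forall t, 0 <= Z1 t) ->
  measurable_fun [set: T] Z2 -> (forall t, 0 <= Z2 t) ->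
  (forall t, Z1 t \is a fin_num) -> (forall t, Z2 t \is a fin_num) ->
  (forall A : set T', measurable A ->
     \int[m]_t ((\1_A (X t))%:E * Z1 t) = \int[m]_t ((\1_A (X t))%:E * Z2 t)) ->
  forall g : T' -> \bar R, measurable_fun [set: T'] g -> (forall x, 0 <= g x) ->
  \int[m]_t (g (X t) * Z1 t) = \int[m]_t (g (X t) * Z2 t).
Proof.
move=> mZ1 Z10 mZ2 Z20 Z1f Z2f h12 g mg g0.
pose g_ := nnsfun_approx measurableT mg.
have lim Z : measurable_fun [set: T] Z -> (forall t, 0 <= Z t) ->
    (forall t, Z t \is a fin_num) ->
    \int[m]_t (g (X t) * Z t) = limn (fun n => \int[m]_t ((g_ n (X t))%:E * Z t)).
  move=> mZ Z0 Zf.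
  have mgn n : measurable_fun [set: T] (fun t => (g_ n (X t))%:E).
    by apply/measurable_EFinP; exact: measurableT_comp mX.
  rewrite -monotone_convergence//; last 3 first.
  - by move=> n; exact: emeasurable_funM.
  - by move=> n t _; rewrite mule_ge0// lee_fin.
  - move=> t _ a b ab; apply: lee_wpmul2r => //; rewrite lee_fin.
    exact/lefP/nd_nnsfun_approx.
  apply: eq_integral => t _; apply/esym/cvg_lim => //.
  apply: cvgeZr => //; exact: (cvg_nnsfun_approx measurableT mg).
rewrite !lim//; congr (limn _); apply/funext => n.
by rewrite !integral_nnsfun_comp//; apply: eq_fsbigr => r _; rewrite h12.
Qed.

End integrals_from_sets.

Section conditional_density.
Context {R : realType}.
Local Notation Om := (measurableTypeR R * measurableTypeR R)%type.
Variable P : probR2 R.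

Let Xmfun : {mfun Om >-> measurableTypeR R} :=
  HB.pack (@procX R) (@isMeasurableFun.Build _ _ Om (measurableTypeR R) (@procX R) (@measurable_procX R)).

(** The conditional expectation of [Z] given the first coordinate, as a function
    on the line. Testing against nonnegative functions keeps all integrals
    meaningful. *)
Definition conditional_density (Z : Om -> R) (f : R -> R) :=
  [/\ measurable_fun [set: measurableTypeR R] f, forall x, 0 <= f x &
    forall g : R -> R, measurable_fun [set: measurableTypeR R] g -> (forall x, 0 <= g x) ->
    (\int[P]_w (g (procX w) * Z w)%:E = \int[P]_w (g (procX w) * f (procX w))%:E)%E].

(** Radon-Nikodym derivative, with respect to the first marginal, of the image
    under the first coordinate of the measure with density [Z]. *)
Lemma conditional_density_exists (Z : Om -> R) : measurable_fun [set: Om] Z ->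
  (forall w, 0 <= Z w) -> P.-integrable [set: Om] (EFin \o Z) ->
  exists f, conditional_density Z f.
Proof.
move=> mZ Z0 iZ.
pose nu := pushforward (induced_charge iZ) Xmfun.
pose m : probability (measurableTypeR R) R := distribution P Xmfun.
have dom0 : induced_charge iZ `<< P.
  have := dominates_induced iZ; rewrite (_ : induced_charge _ = induced_charge iZ)//.
  apply/funext => A; rewrite /induced_charge; apply: eq_integral => w _ /=.
  by rewrite ger0_norm.
have dom : nu `<< m by exact: (dominates_pushforward (@measurable_procX R) dom0).
pose rn := Radon_Nikodym nu m.
pose f0 := rn (@measurable_procX R).
have numu (A : set (measurableTypeR R)) : measurable A ->
    nu A = (\int[m]_(x in A) f0 x)%E by move=> mA; exact: Radon_Nikodym_integral.
have if0 : m.-integrable setT f0 by exact: Radon_Nikodym_integrable.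
have f0fin x : f0 x \is a fin_num by exact: Radon_Nikodym_fin_num.
have mf0 : measurable_fun [set: measurableTypeR R] f0 by exact: measurable_int if0.
pose f x := pos_part (fine (f0 x)).
have mf : measurable_fun [set: measurableTypeR R] f.
  by apply: measurable_pos_part; apply: measurableT_comp mf0; exact: fine_measurable.
have mXA (A : set (measurableTypeR R)) : measurable A -> measurable ((@procX R) @^-1` A).
  by move=> mA; rewrite -[X in measurable X]setTI; exact: measurable_procX.
pose D : set (measurableTypeR R) := [set x | (0 <= f0 x)%E].
have mD : measurable D.
  by rewrite -[D]setTI; exact: emeasurable_fun_c_infty.
exists f; split => //; first by move=> x; exact: pos_part_ge0.
move=> g mg g0.
have mfX : measurable_fun [set: Om] (fun w => f (procX w)).
  exact: measurableT_comp mf (@measurable_procX R).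
under eq_integral do rewrite EFinM; under [RHS]eq_integral do rewrite EFinM.
apply: (@ge0_eq_integral_comp _ _ _ _ _ P (@procX R) (@measurable_procX R)
  (EFin \o Z) (fun w => (f (procX w))%:E) _ _ _ _ _ _ _ (EFin \o g)) => //.
- exact/measurable_EFinP.
- exact/measurable_EFinP.
- by move=> w; rewrite lee_fin pos_part_ge0.
- move=> A mA.
  have nuE (B : set (measurableTypeR R)) : nu B = (\int[P]_(w in (@procX R) @^-1` B) (Z w)%:E)%E.
    by [].
  have indE (h : Om -> R) : (\int[P]_w ((\1_A (procX w))%:E * (h w)%:E) =
      \int[P]_(w in (@procX R) @^-1` A) (h w)%:E)%E.
    rewrite [RHS]integral_mkcond; apply: eq_integral => w _.
    rewrite patchE indicE; case: ifPn; rewrite ?inE ?notin_setE/= => hA.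
      by rewrite mem_set// mul1e.
    by rewrite memNset// mul0e.
  rewrite !indE -nuE.
  rewrite -[RHS](@ge0_integral_pushforward _ _ _ _ _ (@procX R) (@measurable_procX R) P A
     (fun x => (f x)%:E))//; last 2 first.
  - by apply/measurable_funTS/measurable_EFinP.
  - by move=> x _; rewrite lee_fin pos_part_ge0.
  rewrite -[RHS]/(\int[m]_(x in A) (f x)%:E)%E.
  have mAD : measurable (A `&` D) by exact: measurableI.
  have mAC : measurable (A `&` ~` D) by apply: measurableI => //; exact: measurableC.
  have AE : A = (A `&` D) `|` (A `&` ~` D) by rewrite -setIUr setUv setIT.
  have dis : [disjoint A `&` D & A `&` ~` D] by apply/disj_setPS => x [[_ ?] [_]].
  have nuC0 : nu (A `&` ~` D) = 0%E.
    apply/eqP; rewrite eq_le; apply/andP; split.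
      rewrite numu// -(integral0 m (A `&` ~` D)); apply: le_integral => //.
      + exact: integrableS if0.
      + exact: integrable0.
      + by move=> x; rewrite inE => -[_] /negP; rewrite -ltNge; exact: ltW.
    by rewrite nuE; apply: integral_ge0 => w _; rewrite lee_fin.
  have nuA : nu A = nu (A `&` D).
    rewrite [LHS]numu// {1}AE integral_setU//.
    + by rewrite -!numu// nuC0 adde0.
    + exact: measurable_funTS.
  rewrite nuA numu// [in RHS]AE ge0_integral_setU//; last 2 first.
  + by apply/measurable_funTS/measurable_EFinP.
  + by move=> x _; rewrite lee_fin pos_part_ge0.
  rewrite [X in (_ + X)%E]integral0_eq ?adde0; last first.
    move=> x [_] /negP; rewrite -ltNge => f0x; congr EFin; apply: pos_part0.
    by rewrite -lee_fin fineK//; exact: ltW.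
  apply: eq_integral => x; rewrite inE => -[_ f0x].
  by rewrite /f pos_partE ?fineK// -lee_fin fineK.
- exact/measurable_EFinP.
Qed.

End conditional_density.

(** * Integrals over two independent copies *)

Section independent_copies.
Context d (T : measurableType d) {R : realType}.
Variable P : probability T R.
Local Notation PP := (P \x P)%E.

Lemma bounded_integrable d0 (T0 : measurableType d0) (Q : probability T0 R) (f : T0 -> R) (c : R) :
  measurable_fun [set: T0] f -> (forall t, `|f t| <= c) ->
  Q.-integrable [set: T0] (EFin \o f).
Proof.
move=> mf fc; apply: (integrable_dominated (g := cst c) mf fc).
exact: finite_measure_integrable_cst.
Qed.

Lemma integrable_copy1 (f : T -> R) : P.-integrable [set: T] (EFin \o f) ->
  PP.-integrable [set: T * T] (EFin \o (fun z => f z.1)).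
Proof.
move=> /integrableP[mf fi].
have mf1 : measurable_fun [set: T * T] (EFin \o (fun z => f z.1)).
  exact: measurableT_comp mf measurable_fst.
apply/integrable12ltyP => //=.
under eq_integral => x _ do rewrite integral_cst//= probability_setT mule1.
exact: fi.
Qed.

Lemma integrable_copy2 (f : T -> R) : P.-integrable [set: T] (EFin \o f) ->
  PP.-integrable [set: T * T] (EFin \o (fun z => f z.2)).
Proof.
move=> /integrableP[mf fi].
have mf2 : measurable_fun [set: T * T] (EFin \o (fun z => f z.2)).
  exact: measurableT_comp mf measurable_snd.
apply/integrable12ltyP => //=.
rewrite integral_cst//= probability_setT mule1.
exact: fi.
Qed.

Lemma Rintegral_copy1 (f : T -> R) : P.-integrable [set: T] (EFin \o f) ->
  \int[PP]_z f z.1 = \int[P]_x f x.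
Proof.
move=> fi; congr fine; rewrite -(integral12_prod_meas1 (integrable_copy1 fi)).
by apply: eq_integral => x _; rewrite /fubini_F/= integral_cst//= probability_setT mule1.
Qed.

Lemma integrable_swap (F : T * T -> R) : PP.-integrable [set: T * T] (EFin \o F) ->
  PP.-integrable [set: T * T] (EFin \o (fun z => F (z.2, z.1))).
Proof.
move=> /integrableP[mF Fi].
have mS : measurable_fun [set: T * T] (EFin \o (fun z => F (z.2, z.1))).
  have mSw : measurable_fun [set: T * T] (fun z : T * T => (z.2, z.1)).
    by apply/measurable_fun_pairP; split; [exact: measurable_snd|exact: measurable_fst].
  exact: measurableT_comp mF mSw.
apply/integrable12ltyP => //=; move: Fi.
by rewrite fubini_tonelli2//; exact: measurableT_comp.
Qed.

Lemma Rintegral_swap (F : T * T -> R) : PP.-integrable [set: T * T] (EFin \o F) ->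
  \int[PP]_z F (z.2, z.1) = \int[PP]_z F z.
Proof.
move=> iF; congr fine.
rewrite -(integral12_prod_meas1 (integrable_swap iF)) -(integral21_prod_meas1 iF).
by [].
Qed.

Section bounded.
Variables (F : T * T -> R) (c : R).
Hypotheses (mF : measurable_fun [set: T * T] F) (Fc : forall z, `|F z| <= c).

Let iF : PP.-integrable [set: T * T] (EFin \o F).
Proof. exact: bounded_integrable mF Fc. Qed.

Lemma bounded_Fubini12 : \int[PP]_z F z = \int[P]_x \int[P]_y F (x, y).
Proof.
congr fine; rewrite -(integral12_prod_meas1 iF); apply: eq_integral => x _.
rewrite /fubini_F /Rintegral fineK//; apply: integrable_fin_num => //.
apply: (@bounded_integrable _ _ _ _ (c)) => //.
by apply: measurableT_comp mF _; exact: pair1_measurable.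
Qed.

Lemma bounded_Fubini21 : \int[PP]_z F z = \int[P]_y \int[P]_x F (x, y).
Proof.
congr fine; rewrite -(integral21_prod_meas1 iF); apply: eq_integral => y _.
rewrite /fubini_G /Rintegral fineK//; apply: integrable_fin_num => //.
apply: (@bounded_integrable _ _ _ _ (c)) => //.
by apply: measurableT_comp mF _; exact: pair2_measurable.
Qed.

End bounded.

Lemma Rintegral_eq0_ae (F : T * T -> R) : measurable_fun [set: T * T] F ->
  PP.-integrable [set: T * T] (EFin \o F) ->
  (forall z, 0 <= F z) -> \int[PP]_z F z = 0 ->
  forall W : T * T -> R, measurable_fun [set: T * T] W -> (forall z, F z = 0 -> W z = 0) ->
  \int[PP]_z W z = 0.
Proof.
move=> mF iF F0 IF W mW WF.
have I0 : (\int[PP]_z (F z)%:E = 0)%E.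
  by rewrite -[LHS]fineK ?integrable_fin_num//; congr EFin.
have aeF : ae_eq PP [set: T * T] (EFin \o F) (cst 0%E).
  apply/ae_eq_integral_abs => //; first exact/measurable_EFinP.
  by under eq_integral => z _ do rewrite /= ger0_norm//.
rewrite /Rintegral (ae_eq_integral (cst 0%E)) ?integral0//.
- exact/measurable_EFinP.
- by apply: filterS aeF => z h _; congr EFin; apply: WF; exact: (EFin_inj (h I)).
Qed.

End independent_copies.

Section conditioning.
Context {R : realType}.
Local Notation Om := (measurableTypeR R * measurableTypeR R)%type.
Variable P : probR2 R.
Local Notation PP := (P \x P)%E.

Lemma conditional_density_signed (Z : Om -> R) (f g : R -> R) (c C : R) :
  conditional_density P Z f -> measurable_fun [set: Om] Z -> (forall w, 0 <= Z w <= c) ->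
  measurable_fun [set: measurableTypeR R] g -> (forall x, `|g x| <= C) ->
  \int[P]_w (g (procX w) * Z w) = \int[P]_w (g (procX w) * f (procX w)).
Proof.
move=> [mf f0 hf] mZ Z0 mg gC.
have key (h : R -> R) : measurable_fun [set: measurableTypeR R] h ->
    (forall x, 0 <= h x <= C) ->
    [/\ P.-integrable [set: Om] (EFin \o (fun w => h (procX w) * Z w)),
        P.-integrable [set: Om] (EFin \o (fun w => h (procX w) * f (procX w))) &
    \int[P]_w (h (procX w) * Z w) = \int[P]_w (h (procX w) * f (procX w))].
  move=> mh h0.
  have h0' x : 0 <= h x by have /andP[] := h0 x.
  have Z0' w : 0 <= Z w by have /andP[] := Z0 w.
  have mhX : measurable_fun [set: Om] (fun w => h (procX w)).
    exact: measurableT_comp mh (@measurable_procX R).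
  have i1 : P.-integrable [set: Om] (EFin \o (fun w => h (procX w) * Z w)).
    apply: (@bounded_integrable _ _ _ _ _ (C * c)); first exact: measurable_funM.
    move=> w; rewrite ger0_norm ?mulr_ge0//.
    have /andP[_ ?] := h0 (procX w); have /andP[_ ?] := Z0 w.
    exact: ler_pM.
  have mhf : measurable_fun [set: Om] (fun w => h (procX w) * f (procX w)).
    by apply: measurable_funM => //; exact: measurableT_comp mf (@measurable_procX R).
  have e := hf h mh h0'.
  split => //; last by rewrite /Rintegral e.
  apply/integrableP; split; first exact/measurable_EFinP.
  have /integrableP[_] := i1.
  under eq_integral do rewrite /= ger0_norm ?mulr_ge0//.
  under [X in _ -> (X < _)%E]eq_integral do rewrite /= ger0_norm ?mulr_ge0//.
  by rewrite e.
have gpos x : 0 <= pos_part (g x) <= C.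
  rewrite pos_part_ge0 /pos_part ge_max (le_trans _ (gC x))//=.
  exact: le_trans (ler_norm _) (gC x).
have gneg x : 0 <= pos_part (- g x) <= C.
  rewrite pos_part_ge0 /pos_part ge_max (le_trans _ (gC x))//=.
  by apply: le_trans (gC x); rewrite -normrN ler_norm.
have gE x : g x = pos_part (g x) - pos_part (- g x).
  have [h|h] := leP 0 (g x).
    by rewrite pos_partE// pos_part0 ?subr0//; lra.
  by rewrite (pos_part0 (ltW h)) pos_partE; lra.
have mpos : measurable_fun [set: measurableTypeR R] (fun x => pos_part (g x)).
  exact: measurable_pos_part.
have mneg : measurable_fun [set: measurableTypeR R] (fun x => pos_part (- g x)).
  by apply: measurable_pos_part; exact: measurableT_comp.
have [p1 p2 p3] := key _ mpos gpos.
have [n1 n2 n3] := key _ mneg gneg.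
transitivity (\int[P]_w (pos_part (g (procX w)) * Z w - pos_part (- g (procX w)) * Z w)).
  by apply: eq_Rintegral => w _; rewrite -mulrBl -gE.
rewrite RintegralB// p3 n3 -RintegralB//.
by apply: eq_Rintegral => w _; rewrite -mulrBl -gE.
Qed.

(** One copy is conditioned at a time, by Fubini; the three bounds keep every
    intermediate integrand bounded. *)
Lemma condition_pair (Z Z' : Om -> R) (f f' : R -> R) (G : R * R -> R) (c C : R) :
  conditional_density P Z f -> conditional_density P Z' f' ->
  measurable_fun [set: Om] Z -> measurable_fun [set: Om] Z' ->
  (forall w, 0 <= Z w <= c) -> (forall w, 0 <= Z' w <= c) ->
  measurable_fun [set: Om] (G : Om -> R) ->
  (forall x x', `|G (x, x')| <= C) -> (forall x x', `|G (x, x') * f x| <= C) ->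
  (forall x x', `|G (x, x') * f x * f' x'| <= C) ->
  \int[PP]_z (G (procX z.1, procX z.2) * Z z.1 * Z' z.2) =
  \int[PP]_z (G (procX z.1, procX z.2) * f (procX z.1) * f' (procX z.2)).
Proof.
move=> hf hf' mZ mZ' Zc Z'c mG GC GfC GffC.
have [mf f0 _] := hf; have [mf' f'0 _] := hf'.
have C0 : 0 <= C by exact: le_trans (normr_ge0 _) (GC 0 0).
have c0 : 0 <= c by have /andP[h1 h2] := Zc (0, 0); exact: le_trans h2.
have mX1 : measurable_fun [set: Om * Om] (fun z => procX z.1 : measurableTypeR R).
  exact: measurableT_comp (@measurable_procX R) measurable_fst.
have mX2 : measurable_fun [set: Om * Om] (fun z => procX z.2 : measurableTypeR R).
  exact: measurableT_comp (@measurable_procX R) measurable_snd.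
have mGX : measurable_fun [set: Om * Om] (fun z => G (procX z.1, procX z.2)).
  have mXX : measurable_fun [set: Om * Om] (fun z : Om * Om => (procX z.1, procX z.2) : Om).
    by apply/measurable_fun_pairP; split.
  exact: measurableT_comp mG mXX.
have mZ1 : measurable_fun [set: Om * Om] (fun z => Z z.1) by exact: measurableT_comp mZ measurable_fst.
have mZ2 : measurable_fun [set: Om * Om] (fun z => Z' z.2) by exact: measurableT_comp mZ' measurable_snd.
have mf1 : measurable_fun [set: Om * Om] (fun z => f (procX z.1)) by exact: measurableT_comp mf mX1.
have mf2 : measurable_fun [set: Om * Om] (fun z => f' (procX z.2)) by exact: measurableT_comp mf' mX2.
have mG1 x' : measurable_fun [set: measurableTypeR R] (fun x : measurableTypeR R => G (x, x')).
  by apply: measurableT_comp mG _; exact: pair2_measurable.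
have mG2 x : measurable_fun [set: measurableTypeR R] (fun x' : measurableTypeR R => G (x, x')).
  by apply: measurableT_comp mG _; exact: pair1_measurable.
have nZ w : `|Z w| <= c by rewrite ger0_norm; have /andP[] := Zc w.
have nZ' w : `|Z' w| <= c by rewrite ger0_norm; have /andP[] := Z'c w.
transitivity (\int[PP]_z (G (procX z.1, procX z.2) * f (procX z.1) * Z' z.2)).
  rewrite (bounded_Fubini21 P (c := C * c * c)); first last.
  - by move=> z; rewrite !normrM; do 2 apply: ler_pM => //; rewrite ?mulr_ge0.
  - by do 2 apply: measurable_funM => //.
  rewrite (bounded_Fubini21 P (c := C * c)); first last.
  - by move=> z; rewrite normrM; apply: ler_pM => //.
  - by do 2 apply: measurable_funM => //.
  apply: eq_Rintegral => w' _ /=.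
  transitivity (\int[P]_w (G (procX w, procX w') * Z' w' * Z w)).
    by apply: eq_Rintegral => w _; rewrite mulrAC.
  rewrite (conditional_density_signed (C := C * c) hf mZ Zc
    (g := fun x => G (x, procX w') * Z' w')).
  - by apply: eq_Rintegral => w _; rewrite mulrAC.
  - by apply: measurable_funM => //; exact: measurable_cst.
  - by move=> x; rewrite normrM; apply: ler_pM.
rewrite (bounded_Fubini12 P (c := C * c)); first last.
- by move=> z; rewrite normrM; apply: ler_pM => //.
- by do 2 apply: measurable_funM => //.
rewrite (bounded_Fubini12 P (c := C)); first last.
- by move=> z; exact: GffC.
- by do 2 apply: measurable_funM => //.
apply: eq_Rintegral => w _ /=.
rewrite (conditional_density_signed (C := C) hf' mZ' Z'c
    (g := fun x' => G (procX w, x') * f (procX w)))//.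
by apply: measurable_funM => //; exact: measurable_cst.
Qed.

End conditioning.

(** * Payoffs around an interval *)

Section swap_weight.
Context {R : realType}.
Local Notation Om := (measurableTypeR R * measurableTypeR R)%type.
Variable P : probR2 R.
Local Notation PP := (P \x P)%E.

Lemma measurable_inv1 d (T : measurableType d) (g : T -> R) : measurable_fun [set: T] g ->
  (forall x, 0 <= g x) -> measurable_fun [set: T] (fun x => (1 + g x)^-1).
Proof.
move=> mg g0.
have -> : (fun x => (1 + g x)^-1) =
    (fun x => ((fun y : R => y^-1) \_ `]0, +oo[%classic) (1 + g x)).
  apply/funext => x; rewrite patchE mem_setE in_itv/= andbT.
  by have := g0 x; case: ltP => //; lra.
apply: measurableT_comp; first exact: measurable_inv_gt0.
by apply: measurable_funD => //; exact: measurable_cst.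
Qed.

Section scaled.
Variable r : R -> R.
Hypotheses (mr : measurable_fun [set: measurableTypeR R] r) (r01 : forall x, 0 <= r x <= 1).

(** The factor [r] of each abscissa is meant to compensate the size of the
    conditional densities of the payoffs. *)
Definition paired (V : Om -> R) (Z Z' : Om -> R) (z : Om * Om) : R :=
  V (procX z.1, procX z.2) * (r (procX z.1) * r (procX z.2)) * Z z.1 * Z' z.2.

Lemma paired_integral (V : Om -> R) (Z Z' : Om -> R) (f f' : R -> R) (B c k : R) :
  measurable_fun [set: Om] V -> (forall p, `|V p| <= B) ->
  conditional_density P Z f -> conditional_density P Z' f' ->
  measurable_fun [set: Om] Z -> measurable_fun [set: Om] Z' ->
  (forall w, 0 <= Z w <= c) -> (forall w, 0 <= Z' w <= c) ->
  1 <= k -> (forall x, r x * f x <= k) -> (forall x, r x * f' x <= k) ->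
  [/\ PP.-integrable [set: Om * Om] (EFin \o paired V Z Z'),
      PP.-integrable [set: Om * Om] (EFin \o (fun z => V (procX z.1, procX z.2) *
        (r (procX z.1) * f (procX z.1)) * (r (procX z.2) * f' (procX z.2)))) &
      \int[PP]_z paired V Z Z' z = \int[PP]_z (V (procX z.1, procX z.2) *
        (r (procX z.1) * f (procX z.1)) * (r (procX z.2) * f' (procX z.2)))].
Proof.
move=> mV VB hf hf' mZ mZ' Zc Z'c k1 fk f'k.
have [mf f0 _] := hf; have [mf' f'0 _] := hf'.
have r0 x : 0 <= r x by have /andP[] := r01 x.
have B0 : 0 <= B by exact: le_trans (normr_ge0 _) (VB (0, 0)).
have k0 : 0 <= k by lra.
have c0 : 0 <= c by have /andP[h1 h2] := Zc (0, 0); exact: le_trans h2.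
have rn x : `|r x| <= 1 by rewrite ger0_norm//; have /andP[] := r01 x.
have rfn x : `|r x * f x| <= k by rewrite ger0_norm ?mulr_ge0.
have rfn' x : `|r x * f' x| <= k by rewrite ger0_norm ?mulr_ge0.
have mX1 : measurable_fun [set: Om * Om] (fun z => procX z.1 : measurableTypeR R).
  exact: measurableT_comp (@measurable_procX R) measurable_fst.
have mX2 : measurable_fun [set: Om * Om] (fun z => procX z.2 : measurableTypeR R).
  exact: measurableT_comp (@measurable_procX R) measurable_snd.
have mXX : measurable_fun [set: Om * Om] (fun z : Om * Om => (procX z.1, procX z.2) : Om).
  by apply/measurable_fun_pairP; split.
have mVX : measurable_fun [set: Om * Om] (fun z => V (procX z.1, procX z.2)).
  exact: measurableT_comp mV mXX.
have mr1 := measurableT_comp mr mX1; have mr2 := measurableT_comp mr mX2.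
have mf1 := measurableT_comp mf mX1; have mf2 := measurableT_comp mf' mX2.
have nZ w : `|Z w| <= c by rewrite ger0_norm; have /andP[] := Zc w.
have nZ' w : `|Z' w| <= c by rewrite ger0_norm; have /andP[] := Z'c w.
split.
- apply: (@bounded_integrable _ _ _ _ _ (B * (1 * 1) * c * c)).
    apply: measurable_funM; last exact: measurableT_comp mZ' measurable_snd.
    apply: measurable_funM; last exact: measurableT_comp mZ measurable_fst.
    by apply: measurable_funM => //; exact: measurable_funM.
  move=> z; rewrite /paired !normrM.
  by do 2 apply: ler_pM => //; apply: ler_pM => //; rewrite ?mulr_ge0//; apply: ler_pM.
- apply: (@bounded_integrable _ _ _ _ _ (B * k * k)).
    by apply: measurable_funM; [apply: measurable_funM => //|]; exact: measurable_funM.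
  by move=> z; rewrite [X in X <= _]normrM; apply: ler_pM => //; rewrite normrM; apply: ler_pM.
- have mG : measurable_fun [set: Om] (fun p : Om => V p * (r p.1 * r p.2)).
    apply: measurable_funM => //; apply: measurable_funM.
      exact: measurableT_comp mr measurable_fst.
    exact: measurableT_comp mr measurable_snd.
  have h := @condition_pair R P Z Z' f f' (fun p => V p * (r p.1 * r p.2)) c (B * k * k)
    hf hf' mZ mZ' Zc Z'c mG.
  have B1 : B <= B * k * k by rewrite -mulrA; apply: ler_peMr => //; nra.
  have Bk : B * k <= B * k * k by apply: ler_peMr => //; exact: mulr_ge0.
  rewrite /paired h /=.
  + by apply: eq_Rintegral => z _; ring.
  + move=> x x'; apply: le_trans B1; rewrite !normrM -[leRHS]mulr1.
    by apply: ler_pM => //; rewrite ?mulr_ge0// -[leRHS]mulr1; apply: ler_pM.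
  + move=> x x'; apply: le_trans Bk.
    rewrite (_ : _ * f x = V (x, x') * (r x * f x) * r x'); last by ring.
    rewrite normrM -[leRHS]mulr1; apply: ler_pM => //.
    by rewrite normrM; apply: ler_pM.
  + move=> x x'.
    rewrite (_ : _ * f' x' = V (x, x') * (r x * f x) * (r x' * f' x')); last by ring.
    rewrite normrM; apply: ler_pM => //.
    by rewrite normrM; apply: ler_pM.
Qed.

End scaled.

Section five_terms.
Context d (T : measurableType d) (Q : probability T R).
Variables (g1 g2 g3 g4 g5 h1 h2 h3 h4 h5 : T -> R) (k : R).
Hypotheses (ig1 : Q.-integrable [set: T] (EFin \o g1)) (ig2 : Q.-integrable [set: T] (EFin \o g2))
  (ig3 : Q.-integrable [set: T] (EFin \o g3)) (ig4 : Q.-integrable [set: T] (EFin \o g4))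
  (ig5 : Q.-integrable [set: T] (EFin \o g5)).

Let comb (g1 g2 g3 g4 g5 : T -> R) t := g2 t + k * g3 t - (g1 t + g4 t + g5 t).

Lemma integrable_comb : Q.-integrable [set: T] (EFin \o comb g1 g2 g3 g4 g5).
Proof.
have i3 := integrableZl measurableT k ig3.
exact: (integrableB measurableT (integrableD measurableT ig2 i3)
  (integrableD measurableT (integrableD measurableT ig1 ig4) ig5)).
Qed.

Lemma Rintegral_comb : \int[Q]_t comb g1 g2 g3 g4 g5 t =
  \int[Q]_t g2 t + k * \int[Q]_t g3 t -
  (\int[Q]_t g1 t + \int[Q]_t g4 t + \int[Q]_t g5 t).
Proof.
have i3 := integrableZl measurableT k ig3.
have i14 := integrableD measurableT ig1 ig4.
rewrite RintegralB//; last 2 first.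
- exact: (integrableD measurableT ig2 i3).
- exact: (integrableD measurableT i14 ig5).
by rewrite RintegralD// RintegralZl// RintegralD// RintegralD.
Qed.

End five_terms.

Variables s t q : R.
Hypothesis st : s < t.
Local Notation D := (t - s).

(** The payoffs on both sides of the interval are divided by 1 plus the distance to
    it. This makes them and their products with this distance bounded, so that no
    moment of the coupling enters. *)
Definition below (w : Om) : R := (procY w <= s)%R%:R * (1 + pos_part (s - procY w))^-1.
Definition below_gap (w : Om) : R := pos_part (s - procY w) * below w.
Definition above (w : Om) : R := (t <= procY w)%R%:R * (1 + pos_part (procY w - t))^-1.
Definition above_gap (w : Om) : R := pos_part (procY w - t) * above w.
Definition inside (w : Om) : R := (s < procY w < t)%R%:R.
Definition inside_lo (w : Om) : R := pos_part (procY w - s) * inside w.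
Definition inside_hi (w : Om) : R := pos_part (t - procY w) * inside w.

Let damped (b : bool) (z : R) : 0 <= z ->
  0 <= b%:R * (1 + z)^-1 <= 1 /\ 0 <= z * (b%:R * (1 + z)^-1) <= 1.
Proof.
move=> z0; have z1 : 0 < 1 + z by lra.
have b01 : 0 <= (b%:R : R) <= 1 by case: b; rewrite /= ?lexx ler01.
have i0 : 0 <= (1 + z)^-1 by rewrite invr_ge0 ltW.
have /andP[b0 b1] := b01.
split; apply/andP; split.
- exact: mulr_ge0.
- rewrite -[leRHS]mulr1; apply: ler_pM => //; rewrite invf_le1//; lra.
- by apply: mulr_ge0 => //; exact: mulr_ge0.
- rewrite mulrCA -[leRHS]mulr1; apply: ler_pM => //; first exact: mulr_ge0.
  by rewrite ler_pdivrMr// mul1r; lra.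
Qed.

Lemma below01 w : 0 <= below w <= 1.
Proof. by have [] := damped (procY w <= s) (pos_part_ge0 (s - procY w)). Qed.

Lemma below_gap01 w : 0 <= below_gap w <= 1.
Proof. by have [] := damped (procY w <= s) (pos_part_ge0 (s - procY w)). Qed.

Lemma above01 w : 0 <= above w <= 1.
Proof. by have [] := damped (t <= procY w) (pos_part_ge0 (procY w - t)). Qed.

Lemma above_gap01 w : 0 <= above_gap w <= 1.
Proof. by have [] := damped (t <= procY w) (pos_part_ge0 (procY w - t)). Qed.

Lemma inside01 w : 0 <= inside w <= 1.
Proof. by rewrite /inside; case: (_ < _ < _); rewrite /= ?lexx ler01. Qed.

Lemma inside_lo_bound w : 0 <= inside_lo w <= D.
Proof.
rewrite /inside_lo /inside; case: (boolP (s < procY w < t)) => [/andP[sy yt]|_] /=.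
  by rewrite mulr1 pos_partE; [apply/andP; split|]; lra.
by rewrite mulr0 lexx subr_ge0 ltW.
Qed.

Lemma inside_hi_bound w : 0 <= inside_hi w <= D.
Proof.
rewrite /inside_hi /inside; case: (boolP (s < procY w < t)) => [/andP[sy yt]|_] /=.
  by rewrite mulr1 pos_partE; [apply/andP; split|]; lra.
by rewrite mulr0 lexx subr_ge0 ltW.
Qed.

Lemma below_moment w : (procY w - s) * below w = - below_gap w.
Proof.
rewrite /below_gap /below; case: (leP (procY w) s) => ys /=; last by rewrite !mul0r !mulr0 oppr0.
by rewrite !mul1r pos_partE; [ring|lra].
Qed.

Lemma above_moment w : (procY w - s) * above w = above_gap w + D * above w.
Proof.
rewrite /above_gap /above; case: (leP t (procY w)) => ty /=; last by rewrite !mul0r !mulr0 addr0.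
by rewrite !mul1r pos_partE; [ring|lra].
Qed.

Lemma inside_moment w : (procY w - s) * inside w = inside_lo w.
Proof.
rewrite /inside_lo /inside; case: (boolP (s < procY w < t)) => [/andP[sy yt]|_] /=; last by rewrite !mulr0.
by rewrite pos_partE; lra.
Qed.

Lemma inside_split w : D * inside w = inside_lo w + inside_hi w.
Proof.
rewrite /inside_lo /inside_hi /inside; case: (boolP (s < procY w < t)) => [/andP[sy yt]|_] /=; last by rewrite !mulr0 addr0.
by rewrite !pos_partE; lra.
Qed.

Let mY := @measurable_procY R.

Lemma measurable_below : measurable_fun [set: Om] below.
Proof.
apply: measurable_funM.
  by apply: measurable_bool_natr; apply: measurable_fun_ler => //; exact: measurable_cst.
apply: measurable_inv1 => [|w]; last exact: pos_part_ge0.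
by apply: measurable_pos_part; apply: measurable_funB => //; exact: measurable_cst.
Qed.

Lemma measurable_below_gap : measurable_fun [set: Om] below_gap.
Proof.
apply: measurable_funM; last exact: measurable_below.
by apply: measurable_pos_part; apply: measurable_funB => //; exact: measurable_cst.
Qed.

Lemma measurable_above : measurable_fun [set: Om] above.
Proof.
apply: measurable_funM.
  by apply: measurable_bool_natr; apply: measurable_fun_ler => //; exact: measurable_cst.
apply: measurable_inv1 => [|w]; last exact: pos_part_ge0.
by apply: measurable_pos_part; apply: measurable_funB => //; exact: measurable_cst.
Qed.

Lemma measurable_above_gap : measurable_fun [set: Om] above_gap.
Proof.
apply: measurable_funM; last exact: measurable_above.
by apply: measurable_pos_part; apply: measurable_funB => //; exact: measurable_cst.
Qed.

Lemma measurable_inside : measurable_fun [set: Om] inside.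
Proof.
apply: measurable_bool_natr; apply: measurable_and.
  by apply: measurable_fun_ltr => //; exact: measurable_cst.
by apply: measurable_fun_ltr => //; exact: measurable_cst.
Qed.

Lemma measurable_inside_lo : measurable_fun [set: Om] inside_lo.
Proof.
apply: measurable_funM; last exact: measurable_inside.
by apply: measurable_pos_part; apply: measurable_funB => //; exact: measurable_cst.
Qed.

Lemma measurable_inside_hi : measurable_fun [set: Om] inside_hi.
Proof.
apply: measurable_funM; last exact: measurable_inside.
by apply: measurable_pos_part; apply: measurable_funB => //; exact: measurable_cst.
Qed.

Lemma bounded_conditional_density (Z : Om -> R) (c : R) : measurable_fun [set: Om] Z ->
  (forall w, 0 <= Z w <= c) -> exists f, conditional_density P Z f.
Proof.
move=> mZ Zc; apply: conditional_density_exists => //.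
  by move=> w; have /andP[] := Zc w.
by apply: (bounded_integrable P (c := c)) => // w; rewrite ger0_norm; have /andP[] := Zc w.
Qed.

Lemma conditional_density_inside (e6 e7 : R -> R) :
  conditional_density P inside_lo e6 -> conditional_density P inside_hi e7 ->
  conditional_density P inside (fun x => D^-1 * (e6 x + e7 x)).
Proof.
move=> [me6 e60 h6] [me7 e70 h7]; have D0 : 0 < D by rewrite subr_gt0.
have iD : 0 <= D^-1 by rewrite invr_ge0 ltW.
split.
- by apply: measurable_funM; [exact: measurable_cst|exact: measurable_funD].
- by move=> x; apply: mulr_ge0 => //; exact: addr_ge0.
move=> g mg g0.
have mgX : measurable_fun [set: Om] (fun w => g (procX w)).
  exact: measurableT_comp mg (@measurable_procX R).
have m1 (f : Om -> R) : measurable_fun [set: Om] f ->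
    measurable_fun [set: Om] (fun w => (g (procX w) * f w)%:E).
  by move=> mf; apply/measurable_EFinP; exact: measurable_funM.
have me (e : R -> R) : measurable_fun [set: measurableTypeR R] e ->
   measurable_fun [set: Om] (fun w => e (procX w)).
  by move=> mE; exact: measurableT_comp mE (@measurable_procX R).
have split_int (Z1 Z2 : Om -> R) : measurable_fun [set: Om] Z1 -> measurable_fun [set: Om] Z2 ->
    (forall w, 0 <= Z1 w) -> (forall w, 0 <= Z2 w) ->
    (\int[P]_w (g (procX w) * (D^-1 * (Z1 w + Z2 w)))%:E =
     D^-1%:E * (\int[P]_w (g (procX w) * Z1 w)%:E + \int[P]_w (g (procX w) * Z2 w)%:E))%E.
  move=> mZ1 mZ2 Z10 Z20.
  rewrite -ge0_integralD//; try exact: m1; try by move=> w _; rewrite lee_fin mulr_ge0.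
  rewrite -ge0_integralZl//.
  - by apply: eq_integral => w _; rewrite -EFinD -EFinM; congr EFin; ring.
  - by apply: emeasurable_funD; exact: m1.
  - by move=> w _; rewrite -EFinD lee_fin addr_ge0 ?mulr_ge0.
have -> : inside = (fun w => D^-1 * (inside_lo w + inside_hi w)).
  by apply/funext => w; rewrite -inside_split mulrA mulVf ?mul1r// gt_eqF// subr_gt0.
rewrite !split_int//; try exact: me; try exact: measurable_inside_lo; try exact: measurable_inside_hi.
- by rewrite h6// h7.
- by move=> w; have /andP[] := inside_lo_bound w.
- by move=> w; have /andP[] := inside_hi_bound w.
Qed.

End swap_weight.

(** * A balanced exchange weight *)

Section events.
Context {R : realType}.
Local Notation Om := (measurableTypeR R * measurableTypeR R)%type.
Implicit Types (q : R) (f : R -> R).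

Let measurable_pos f : measurable_fun [set: measurableTypeR R] f ->
  measurable_fun [set: Om] (fun w => 0 < f (procX w) : bool).
Proof.
move=> mf; apply: measurable_fun_ltr; first exact: measurable_cst.
exact: measurableT_comp mf (@measurable_procX R).
Qed.

Lemma measurable_split_event q f f' :
  measurable_fun [set: measurableTypeR R] f -> measurable_fun [set: measurableTypeR R] f' ->
  measurable [set w : Om | [/\ procX w < q, 0 < f (procX w) & 0 < f' (procX w)]].
Proof.
move=> mf mf'.
rewrite (_ : [set w | _] = [set w | [&& procX w < q, 0 < f (procX w) & 0 < f' (procX w)]]).
  apply: measurable_bool_set; apply: measurable_and; last by apply: measurable_and; exact: measurable_pos.
  by apply: measurable_fun_ltr; [exact: measurable_procX|exact: measurable_cst].
by apply/seteqP; split => w /=; [move=> [-> -> ->]|move=> /and3P].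
Qed.

Lemma measurable_hit_event q f : measurable_fun [set: measurableTypeR R] f ->
  measurable [set w : Om | q < procX w /\ 0 < f (procX w)].
Proof.
move=> mf; rewrite (_ : [set w | _] = [set w | (q < procX w) && (0 < f (procX w))]).
  apply: measurable_bool_set; apply: measurable_and; last exact: measurable_pos.
  by apply: measurable_fun_ltr; [exact: measurable_cst|exact: measurable_procX].
by apply/seteqP; split => w /=; [move=> [-> ->]|move=> /andP].
Qed.

End events.

Section swap_balance.
Context {R : realType}.
Local Notation Om := (measurableTypeR R * measurableTypeR R)%type.
Variable P : probR2 R.
Local Notation PP := (P \x P)%E.
Variables s t q : R.
Hypothesis st : s < t.
Local Notation D := (t - s).

Variables f1 f2 f3 f4 e6 e7 : R -> R.
Hypotheses (hf1 : conditional_density P (below s) f1)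
  (hf2 : conditional_density P (below_gap s) f2)
  (hf3 : conditional_density P (above t) f3)
  (hf4 : conditional_density P (above_gap t) f4)
  (he6 : conditional_density P (inside_lo s t) e6)
  (he7 : conditional_density P (inside_hi s t) e7).
Variable r : R -> R.
Hypotheses (mr : measurable_fun [set: measurableTypeR R] r) (r01 : forall x, 0 < r x <= 1).
Hypotheses (rf1 : forall x, r x * f1 x <= 1) (rf2 : forall x, r x * f2 x <= 1)
  (rf3 : forall x, r x * f3 x <= 1) (rf4 : forall x, r x * f4 x <= 1)
  (re6 : forall x, r x * e6 x <= 1) (re7 : forall x, r x * e7 x <= 1).

Definition e5 x := D^-1 * (e6 x + e7 x).

Let he5 : conditional_density P (inside s t) e5.
Proof. exact: conditional_density_inside. Qed.

Let k := 1 + 2 * D^-1.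
Let D0 : 0 < D. Proof. by rewrite subr_gt0. Qed.
Let iD0 : 0 < D^-1. Proof. by rewrite invr_gt0. Qed.
Let k1 : 1 <= k. Proof. by have := iD0; rewrite /k; lra. Qed.

Let le_k x : x <= 1 -> x <= k. Proof. by move=> h; exact: le_trans k1. Qed.

Let re5 x : r x * e5 x <= k.
Proof.
rewrite /e5 mulrCA mulrDr; have := re6 x; have := re7 x => h7 h6.
have : D^-1 * (r x * e6 x + r x * e7 x) <= D^-1 * 2 by apply: ler_wpM2l; have := iD0; lra.
by rewrite /k; lra.
Qed.

Let dens_ge0 Z f : conditional_density P Z f -> forall x, 0 <= f x.
Proof. by move=> []. Qed.
Let dens_meas Z f : conditional_density P Z f -> measurable_fun [set: measurableTypeR R] f.
Proof. by move=> []. Qed.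

Let scaled01 f : (forall x, 0 <= f x) -> (forall x, r x * f x <= k) ->
  forall x, `|r x * f x| <= k.
Proof.
move=> f0 rf x; rewrite ger0_norm//; apply: mulr_ge0 => //.
by have /andP[/ltW] := r01 x.
Qed.

Definition ordered (p : Om) : R := (p.1 < q)%R%:R * (q < p.2)%R%:R.
(** Write [f1], [f2], [f3], [f4] for the conditional masses and first moments below
    and above the interval, and [e5], [e6], [e7] for the mass inside it and its first
    moments from [s] and to [t]. Exchanging a point inside, over [x'], with a point
    over [x] that lies below, or above, the interval shifts the barycentre over [x]
    by [f2 * e5 + f1 * e6] upwards, or by [f4 * e5 + f3 * e7] downwards. Weighting
    each kind of exchange by the shift of the other kind makes them cancel. *)
Definition core_below (p : Om) : R :=
  (r p.2 * e5 p.2) * (r p.1 * f4 p.1) + (r p.2 * e7 p.2) * (r p.1 * f3 p.1).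
Definition core_above (p : Om) : R :=
  (r p.2 * e5 p.2) * (r p.1 * f2 p.1) + (r p.2 * e6 p.2) * (r p.1 * f1 p.1).

(** Both the martingale property and the affine part of the cost integrate the
    shift against functions of the two abscissae, here [phi] and [psi]. *)
Definition tested (phi psi : R -> R) (core : Om -> R) (p : Om) : R :=
  ordered p * ((r p.1 * phi p.1) * (r p.2 * psi p.2)) * core p.

Let m1 (f : R -> R) : measurable_fun [set: measurableTypeR R] f ->
  measurable_fun [set: Om] (fun p => f p.1).
Proof. by move=> mf; exact: measurableT_comp mf measurable_fst. Qed.
Let m2 (f : R -> R) : measurable_fun [set: measurableTypeR R] f ->
  measurable_fun [set: Om] (fun p => f p.2).
Proof. by move=> mf; exact: measurableT_comp mf measurable_snd. Qed.
Let mrf (f : R -> R) : measurable_fun [set: measurableTypeR R] f ->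
  measurable_fun [set: measurableTypeR R] (fun x => r x * f x).
Proof. by move=> mf; exact: measurable_funM. Qed.

Lemma measurable_ordered : measurable_fun [set: Om] ordered.
Proof.
apply: measurable_funM; apply: measurable_bool_natr; apply: measurable_fun_ltr; try exact: measurable_cst.
- exact: measurable_fst.
- exact: measurable_snd.
Qed.

Let ordered01 p : 0 <= ordered p <= 1.
Proof.
by rewrite /ordered; do 2 case: (_ < _); rewrite /= ?(mulr0, mul0r, mulr1) ?lexx ?ler01.
Qed.

Let measurable_core_below : measurable_fun [set: Om] core_below.
Proof.
exact: (measurable_funD
  (measurable_funM (m2 (mrf (dens_meas he5))) (m1 (mrf (dens_meas hf4))))
  (measurable_funM (m2 (mrf (dens_meas he7))) (m1 (mrf (dens_meas hf3))))).
Qed.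

Let measurable_core_above : measurable_fun [set: Om] core_above.
Proof.
exact: (measurable_funD
  (measurable_funM (m2 (mrf (dens_meas he5))) (m1 (mrf (dens_meas hf2))))
  (measurable_funM (m2 (mrf (dens_meas he6))) (m1 (mrf (dens_meas hf1))))).
Qed.

Let core_bound (f f' e e' : R -> R) (p : Om) :
  (forall x, `|r x * f x| <= k) -> (forall x, `|r x * f' x| <= k) ->
  (forall x, `|r x * e x| <= k) -> (forall x, `|r x * e' x| <= k) ->
  `|(r p.2 * e p.2) * (r p.1 * f p.1) + (r p.2 * e' p.2) * (r p.1 * f' p.1)| <= k * k + k * k.
Proof.
move=> hf hf' he he'; apply: le_trans (ler_normD _ _) _.
by apply: lerD; rewrite normrM; apply: ler_pM.
Qed.

Let n1 := scaled01 (dens_ge0 hf1) (fun x => le_k (rf1 x)).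
Let n2 := scaled01 (dens_ge0 hf2) (fun x => le_k (rf2 x)).
Let n3 := scaled01 (dens_ge0 hf3) (fun x => le_k (rf3 x)).
Let n4 := scaled01 (dens_ge0 hf4) (fun x => le_k (rf4 x)).
Let n5 := scaled01 (dens_ge0 he5) re5.
Let n6 := scaled01 (dens_ge0 he6) (fun x => le_k (re6 x)).
Let n7 := scaled01 (dens_ge0 he7) (fun x => le_k (re7 x)).

Let core_below_bound p : `|core_below p| <= k * k + k * k.
Proof. exact: (core_bound p n4 n3 n5 n7). Qed.

Let core_above_bound p : `|core_above p| <= k * k + k * k.
Proof. exact: (core_bound p n2 n1 n5 n6). Qed.

Let c := 1 + D.
Let c1 : 1 <= c. Proof. by have := D0; rewrite /c; lra. Qed.
Let cD : D <= c. Proof. by rewrite /c; lra. Qed.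

Let upto (Z : Om -> R) (b : R) : b <= c -> (forall w, 0 <= Z w <= b) -> forall w, 0 <= Z w <= c.
Proof. by move=> bc h w; have /andP[-> /le_trans ->] := h w. Qed.

Section test_functions.
Variables (phi psi : R -> R) (C : R).
Hypotheses (mphi : measurable_fun [set: measurableTypeR R] phi)
  (mpsi : measurable_fun [set: measurableTypeR R] psi)
  (rphi : forall x, `|r x * phi x| <= C) (rpsi : forall x, `|r x * psi x| <= C).

Local Notation B := (C * C * (k * k + k * k)).

Lemma measurable_tested core : measurable_fun [set: Om] core ->
  measurable_fun [set: Om] (tested phi psi core).
Proof.
move=> mc; apply: measurable_funM => //; apply: measurable_funM; first exact: measurable_ordered.
by apply: measurable_funM; [exact: m1 (mrf mphi)|exact: m2 (mrf mpsi)].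
Qed.

Lemma tested_bound core : (forall p, `|core p| <= k * k + k * k) ->
  forall p, `|tested phi psi core p| <= B.
Proof.
move=> hc p; have /andP[p0 p1] := ordered01 p.
have h1 : `|ordered p| <= 1 by rewrite ger0_norm.
have h2 : `|(r p.1 * phi p.1) * (r p.2 * psi p.2)| <= C * C.
  by rewrite normrM; exact: ler_pM.
have h3 : `|ordered p * ((r p.1 * phi p.1) * (r p.2 * psi p.2))| <= C * C.
  by rewrite normrM -[leRHS]mul1r; exact: ler_pM.
by rewrite /tested normrM; exact: ler_pM.
Qed.

Lemma pairI (core Z Z' : Om -> R) (f f' : R -> R) : measurable_fun [set: Om] core ->
  (forall p, `|core p| <= k * k + k * k) ->
  conditional_density P Z f -> conditional_density P Z' f' ->
  measurable_fun [set: Om] Z -> measurable_fun [set: Om] Z' ->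
  (forall w, 0 <= Z w <= c) -> (forall w, 0 <= Z' w <= c) ->
  (forall x, r x * f x <= k) -> (forall x, r x * f' x <= k) ->
  [/\ PP.-integrable [set: Om * Om] (EFin \o paired r (tested phi psi core) Z Z'),
      PP.-integrable [set: Om * Om] (EFin \o (fun z => tested phi psi core (procX z.1, procX z.2) *
        (r (procX z.1) * f (procX z.1)) * (r (procX z.2) * f' (procX z.2)))) &
      \int[PP]_z paired r (tested phi psi core) Z Z' z =
      \int[PP]_z (tested phi psi core (procX z.1, procX z.2) *
        (r (procX z.1) * f (procX z.1)) * (r (procX z.2) * f' (procX z.2)))].
Proof.
move=> mc hc hf hf' mZ mZ' Zc Z'c rf rf'.
have r01' x : 0 <= r x <= 1 by have /andP[/ltW -> ->] := r01 x.
exact: (paired_integral mr r01' (measurable_tested mc) (tested_bound hc) hf hf' mZ mZ' Zc Z'c k1 rf rf').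
Qed.

Let b1 := upto c1 (@below01 R s).
Let b2 := upto c1 (@below_gap01 R s).
Let b3 := upto c1 (@above01 R t).
Let b4 := upto c1 (@above_gap01 R t).
Let b5 := upto c1 (@inside01 R s t).
Let b6 := upto cD (@inside_lo_bound R s t st).

Definition tested_increment (z : Om * Om) : R :=
  paired r (tested phi psi core_above) (above_gap t) (inside s t) z +
  D * paired r (tested phi psi core_above) (above t) (inside s t) z -
  (paired r (tested phi psi core_below) (below_gap s) (inside s t) z +
   paired r (tested phi psi core_below) (below s) (inside_lo s t) z +
   paired r (tested phi psi core_above) (above t) (inside_lo s t) z).

(** After conditioning, the five terms cancel by the choice of the weights and by
    [D * e5 = e6 + e7]. *)
Lemma tested_increment_balanced :
  PP.-integrable [set: Om * Om] (EFin \o tested_increment) /\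
  \int[PP]_z tested_increment z = 0.
Proof.
have [i1 j1 h1] := pairI measurable_core_below core_below_bound hf2 he5
  (@measurable_below_gap R s) (@measurable_inside R s t) b2 b5 (fun x => le_k (rf2 x)) re5.
have [i2 j2 h2] := pairI measurable_core_above core_above_bound hf4 he5
  (@measurable_above_gap R t) (@measurable_inside R s t) b4 b5 (fun x => le_k (rf4 x)) re5.
have [i3 j3 h3] := pairI measurable_core_above core_above_bound hf3 he5
  (@measurable_above R t) (@measurable_inside R s t) b3 b5 (fun x => le_k (rf3 x)) re5.
have [i4 j4 h4] := pairI measurable_core_below core_below_bound hf1 he6
  (@measurable_below R s) (@measurable_inside_lo R s t) b1 b6 (fun x => le_k (rf1 x)) (fun x => le_k (re6 x)).
have [i5 j5 h5] := pairI measurable_core_above core_above_bound hf3 he6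
  (@measurable_above R t) (@measurable_inside_lo R s t) b3 b6 (fun x => le_k (rf3 x)) (fun x => le_k (re6 x)).
split; first exact: (integrable_comb D i1 i2 i3 i4 i5).
rewrite (Rintegral_comb D i1 i2 i3 i4 i5) h1 h2 h3 h4 h5.
rewrite -(Rintegral_comb D j1 j2 j3 j4 j5).
rewrite -[RHS](Rintegral_cst_prob PP 0); apply: eq_Rintegral => z _.
set x := procX z.1; set x' := procX z.2.
have de5 : D * (r x' * e5 x') = r x' * e6 x' + r x' * e7 x'.
  by rewrite /e5 mulrCA (mulrA D) divff ?mul1r ?gt_eqF// mulrDr.
rewrite /tested /core_above /core_below /=.
set o := ordered _ * _.
set F1 := r x * f1 x; set F2 := r x * f2 x; set F3 := r x * f3 x; set F4 := r x * f4 x.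
move: de5; set E5 := r x' * e5 x'; set E6 := r x' * e6 x'; set E7 := r x' * e7 x' => de5.
have -> : E7 = D * E5 - E6 by rewrite de5 addrC addKr.
by ring.
Qed.

End test_functions.

(** The weight of the exchange: the first point lies outside the interval on the
    left of [q], the second one inside it on the right of [q]. *)
Definition swap_density (z : Om * Om) : R :=
  paired r (tested (cst 1) (cst 1) core_below) (below s) (inside s t) z +
  paired r (tested (cst 1) (cst 1) core_above) (above t) (inside s t) z.

Lemma tested_incrementE phi psi z :
  phi (procX z.1) * psi (procX z.2) * swap_density z * (procY z.1 - procY z.2) =
  tested_increment phi psi z.
Proof.
have h1 := below_moment s z.1; have h3 := @above_moment R s t z.1.
have h5 := @inside_moment R s t z.2.
rewrite /tested_increment /swap_density /paired /tested /=.
set x := procX z.1; set x' := procX z.2.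
set vb := core_below _; set va := core_above _; set o := ordered _.
transitivity (phi x * psi x' * o * (r x * r x') * (r x * r x') *
  (vb * ((procY z.1 - s) * below s z.1) * inside s t z.2
   + va * ((procY z.1 - s) * above t z.1) * inside s t z.2
   - vb * below s z.1 * ((procY z.2 - s) * inside s t z.2)
   - va * above t z.1 * ((procY z.2 - s) * inside s t z.2))).
  by rewrite /cst; ring.
by rewrite h1 h3 h5; ring.
Qed.

Lemma swap_density_ge0 z : 0 <= swap_density z.
Proof.
have r0 x : 0 <= r x by have /andP[/ltW] := r01 x.
have rf f : (forall x, 0 <= f x) -> forall x, 0 <= r x * f x.
  by move=> f0 x; exact: mulr_ge0.
have c0 Z f Z' f' : conditional_density P Z f -> conditional_density P Z' f' -> forall x x',
    0 <= (r x' * f' x') * (r x * f x).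
  by move=> [_ h _] [_ h' _] x x'; apply: mulr_ge0; exact: rf.
have t0 core Z Z' : (forall p, 0 <= core p) -> (forall w, 0 <= Z w) -> (forall w, 0 <= Z' w) ->
    0 <= paired r (tested (cst 1) (cst 1) core) Z Z' z.
  move=> hc hZ hZ'; have /andP[ord0 _] := ordered01 (procX z.1, procX z.2).
  rewrite /paired /tested /cst; apply: mulr_ge0 => //; apply: mulr_ge0 => //.
  by apply: mulr_ge0; [apply: mulr_ge0 => //; apply: mulr_ge0 => //; rewrite !mulr1|]; exact: mulr_ge0.
apply: addr_ge0; apply: t0.
- move=> p; exact: (addr_ge0 (c0 _ _ _ _ hf4 he5 p.1 p.2) (c0 _ _ _ _ hf3 he7 p.1 p.2)).
- by move=> w; have /andP[] := below01 s w.
- by move=> w; have /andP[] := inside01 s t w.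
- move=> p; exact: (addr_ge0 (c0 _ _ _ _ hf2 he5 p.1 p.2) (c0 _ _ _ _ hf1 he6 p.1 p.2)).
- by move=> w; have /andP[] := above01 t w.
- by move=> w; have /andP[] := inside01 s t w.
Qed.


Let one_bound x : `|r x * cst 1 x| <= 1.
Proof. by have /andP[r0 r1] := r01 x; rewrite /cst mulr1 gtr0_norm. Qed.

Let mone : measurable_fun [set: measurableTypeR R] (cst (1 : R)).
Proof. exact: measurable_cst. Qed.

Lemma measurable_swap_density : measurable_fun [set: Om * Om] swap_density.
Proof.
have [/integrableP[h1 _] _ _] := pairI mone mone one_bound one_bound measurable_core_below
  core_below_bound hf1 he5 (@measurable_below R s) (@measurable_inside R s t)
  (upto c1 (@below01 R s)) (upto c1 (@inside01 R s t)) (fun x => le_k (rf1 x)) re5.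
have [/integrableP[h2 _] _ _] := pairI mone mone one_bound one_bound measurable_core_above
  core_above_bound hf3 he5 (@measurable_above R t) (@measurable_inside R s t)
  (upto c1 (@above01 R t)) (upto c1 (@inside01 R s t)) (fun x => le_k (rf3 x)) re5.
by apply: measurable_funD; apply/measurable_EFinP.
Qed.

Lemma swap_density_bound : exists2 K, 0 < K & forall z, swap_density z <= K.
Proof.
pose B := 1 * 1 * (k * k + k * k).
have B0 : 0 < B by rewrite /B !mul1r; apply: addr_gt0; apply: mulr_gt0; have := k1; lra.
exists (B + B); first exact: addr_gt0.
move=> z.
have rr : 0 <= r (procX z.1) * r (procX z.2) <= 1.
  have /andP[u0 u1] := r01 (procX z.1); have /andP[v0 v1] := r01 (procX z.2).
  by apply/andP; split; [apply: mulr_ge0; exact: ltW|rewrite -[leRHS]mulr1; apply: ler_pM => //; exact: ltW].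
have le_B core (Z Z' : Om -> R) : (forall p, `|core p| <= k * k + k * k) ->
    (forall w, 0 <= Z w <= 1) -> (forall w, 0 <= Z' w <= 1) ->
    paired r (tested (cst 1) (cst 1) core) Z Z' z <= B.
  move=> hc hZ hZ'; apply: le_trans (ler_norm _) _.
  have hV := tested_bound one_bound one_bound hc (procX z.1, procX z.2).
  have /andP[rr0 rr1] := rr; have /andP[z0 z1] := hZ z.1; have /andP[z'0 z'1] := hZ' z.2.
  move: hV; rewrite /paired -/B; set V := tested _ _ _ _ => hV.
  rewrite (normrM _ (Z' z.2)) (normrM _ (Z z.1)) (normrM V).
  rewrite (ger0_norm rr0) (ger0_norm z0) (ger0_norm z'0).
  rewrite -[leRHS]mulr1 -[B * 1]mulr1 -[B * 1 * 1]mulr1.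
  have V0 := normr_ge0 V.
  apply: ler_pM => //; first by apply: mulr_ge0 => //; exact: mulr_ge0.
  apply: ler_pM => //; first exact: mulr_ge0.
  exact: ler_pM.
by apply: lerD; apply: le_B => //; move=> w; (exact: below01 || exact: above01 || exact: inside01).
Qed.

Lemma swap_density_support z : swap_density z != 0 ->
  [/\ procX z.1 < q < procX z.2, s < procY z.2 < t & (procY z.1 <= s) || (t <= procY z.1)].
Proof.
rewrite /swap_density /paired /tested /ordered /below /above /inside /=.
case: (procX z.1 < q); last by rewrite !(mul0r, mulr0, addr0) eqxx.
case: (q < procX z.2); last by rewrite !(mul0r, mulr0, addr0) eqxx.
case: (s < procY z.2 < t); last by rewrite !(mul0r, mulr0, addr0) eqxx.
case: (procY z.1 <= s); case: (t <= procY z.1) => //.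
by rewrite !(mul0r, mulr0, addr0) eqxx.
Qed.

Lemma null_of_Rintegral_eq0 (f : Om -> R) (N : set Om) : measurable_fun [set: Om] f ->
  (forall w, 0 <= f w) -> P.-integrable [set: Om] (EFin \o f) ->
  \int[P]_w f w = 0 -> measurable N -> (forall w, N w -> 0 < f w) -> P N = 0%E.
Proof.
move=> mf f0 fi If mN Nf.
have I0 : (\int[P]_w (f w)%:E = 0)%E.
  by rewrite -[LHS]fineK ?integrable_fin_num//; congr EFin.
have : ae_eq P [set: Om] (EFin \o f) (cst 0%E).
  apply/ae_eq_integral_abs => //; first exact/measurable_EFinP.
  by under eq_integral => z _ do rewrite /= ger0_norm//.
move=> [M [mM M0 hM]].
apply: (subset_measure0 mN mM _ M0) => w Nw; apply: hM => /= /(_ I) h.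
by have := Nf w Nw; rewrite (EFin_inj h) ltxx.
Qed.

Let left_factor (w : Om) : R := (procX w < q)%R%:R * r (procX w) * ((r (procX w) * f1 (procX w)) * (r (procX w) * f3 (procX w))).
Let right_factor (w : Om) : R := (q < procX w)%R%:R * r (procX w) * ((r (procX w) * e5 (procX w)) * (r (procX w) * e5 (procX w))).

(** The terms [e7 * f3 * f1] and [e6 * f1 * f3] add up to [D * e5 * f1 * f3]. Hence
    the conditional weight dominates a function of [x] times a function of [x'],
    and one of these two functions must vanish almost surely. *)
Lemma swap_density_integral0 : \int[PP]_z swap_density z = 0 ->
  P [set w | [/\ procX w < q, 0 < f1 (procX w) & 0 < f3 (procX w)]] = 0%E \/
  P [set w | q < procX w /\ 0 < e5 (procX w)] = 0%E.
Proof.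
move=> W0.
have [i1 j1 h1] := pairI mone mone one_bound one_bound measurable_core_below
  core_below_bound hf1 he5 (@measurable_below R s) (@measurable_inside R s t)
  (upto c1 (@below01 R s)) (upto c1 (@inside01 R s t)) (fun x => le_k (rf1 x)) re5.
have [i2 j2 h2] := pairI mone mone one_bound one_bound measurable_core_above
  core_above_bound hf3 he5 (@measurable_above R t) (@measurable_inside R s t)
  (upto c1 (@above01 R t)) (upto c1 (@inside01 R s t)) (fun x => le_k (rf3 x)) re5.
have mX := @measurable_procX R.
have mrX (f : R -> R) : measurable_fun [set: measurableTypeR R] f ->
    measurable_fun [set: Om] (fun w => r (procX w) * f (procX w)).
  by move=> mf; exact: measurableT_comp (mrf mf) mX.
have mrX0 : measurable_fun [set: Om] (fun w => r (procX w)) by exact: measurableT_comp mr mX.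
have mltq : measurable_fun [set: Om] (fun w => procX w < q : bool).
  by apply: measurable_fun_ltr => //; exact: measurable_cst.
have mgtq : measurable_fun [set: Om] (fun w => q < procX w : bool).
  by apply: measurable_fun_ltr => //; exact: measurable_cst.
have mL : measurable_fun [set: Om] left_factor.
  apply: measurable_funM; first by apply: measurable_funM => //; exact: measurable_bool_natr.
  by apply: measurable_funM; apply: mrX; [exact: dens_meas hf1|exact: dens_meas hf3].
have mR : measurable_fun [set: Om] right_factor.
  apply: measurable_funM; first by apply: measurable_funM => //; exact: measurable_bool_natr.
  by apply: measurable_funM; apply: mrX; exact: dens_meas he5.
have r0 x : 0 <= r x by have /andP[/ltW] := r01 x.
have F0 f : (forall x, 0 <= f x) -> forall x, 0 <= r x * f x by move=> f0 x; exact: mulr_ge0.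
have F1 := F0 _ (dens_ge0 hf1); have F2 := F0 _ (dens_ge0 hf2).
have F3 := F0 _ (dens_ge0 hf3); have F4 := F0 _ (dens_ge0 hf4).
have E5 := F0 _ (dens_ge0 he5); have E6 := F0 _ (dens_ge0 he6); have E7 := F0 _ (dens_ge0 he7).
have b01 (b : bool) : 0 <= (b%:R : R) <= 1 by case: b; rewrite /= ?lexx ler01.
have L0 w : 0 <= left_factor w.
  rewrite /left_factor; apply: mulr_ge0; last exact: mulr_ge0.
  by apply: mulr_ge0 => //; have /andP[] := b01 (procX w < q).
have R0 w : 0 <= right_factor w.
  rewrite /right_factor; apply: mulr_ge0; last exact: mulr_ge0.
  by apply: mulr_ge0 => //; have /andP[] := b01 (q < procX w).
have br (b : bool) x : b%:R * r x <= 1.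
  have /andP[? ?] := b01 b; rewrite -[leRHS]mulr1; apply: ler_pM => //.
  by have /andP[] := r01 x.
have br0 (b : bool) x : 0 <= b%:R * r x by apply: mulr_ge0 => //; have /andP[] := b01 b.
have Lb w : `|left_factor w| <= 1 * (k * k).
  rewrite ger0_norm// /left_factor; apply: ler_pM => //; first exact: mulr_ge0.
  by apply: ler_pM => //; exact: le_k.
have Rb w : `|right_factor w| <= 1 * (k * k).
  rewrite ger0_norm// /right_factor; apply: ler_pM => //; first exact: mulr_ge0.
  by apply: ler_pM.
have iL := @bounded_integrable R _ Om P left_factor _ mL Lb.
have iR := @bounded_integrable R _ Om P right_factor _ mR Rb.
have mLR : measurable_fun [set: Om * Om] (fun z => left_factor z.1 * right_factor z.2).
  apply: measurable_funM; first exact: measurableT_comp mL measurable_fst.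
  exact: measurableT_comp mR measurable_snd.
have bLR (z : Om * Om) : `|left_factor z.1 * right_factor z.2| <= 1 * (k * k) * (1 * (k * k)).
  by rewrite normrM; exact: ler_pM.
have iLR := @bounded_integrable R _ _ PP _ _ mLR bLR.
have prod0 : \int[PP]_z (left_factor z.1 * right_factor z.2) = 0.
  apply/eqP; rewrite eq_le; apply/andP; split; last first.
    by apply: Rintegral_ge0 => z _; exact: mulr_ge0.
  have D0' := D0.
  rewrite -(ler_pM2l D0') mulr0 -RintegralZl//.
  rewrite -W0 RintegralD// h1 h2 -RintegralD//.
  apply: le_Rintegral => //.
  - exact: (integrableZl measurableT D iLR).
  - exact: (integrableD measurableT j1 j2).
  move=> z _; rewrite /left_factor /right_factor /tested /ordered /core_below /core_above /cst /=.
  set x := procX z.1; set x' := procX z.2.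
  have := b01 (x < q); set bl : R := (x < q)%R%:R => /andP[bl0 _].
  have := b01 (q < x'); set bg : R := (q < x')%R%:R => /andP[bg0 _].
  have de5 : D * (r x' * e5 x') = r x' * e6 x' + r x' * e7 x'.
    by rewrite /e5 mulrCA (mulrA D) divff ?mul1r ?gt_eqF// mulrDr.
  have := F1 x; have := F2 x; have := F3 x; have := F4 x.
  have := E5 x'; have := E6 x'; have := E7 x'.
  move: de5.
  set G1 := r x * f1 x; set G2 := r x * f2 x; set G3 := r x * f3 x; set G4 := r x * f4 x.
  set H5 := r x' * e5 x'; set H6 := r x' * e6 x'; set H7 := r x' * e7 x'.
  move=> de5 H7p H6p H5p G4p G3p G2p G1p.
  have o0' : 0 <= bl * bg * (r x * r x') by apply: mulr_ge0; exact: mulr_ge0.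
  have extra : 0 <= bl * bg * (r x * r x') * (H5 * H5 * (G4 * G1 + G2 * G3)).
    apply: mulr_ge0 => //; apply: mulr_ge0; first exact: mulr_ge0.
    by apply: addr_ge0; exact: mulr_ge0.
  rewrite -subr_ge0; apply: le_trans extra _; rewrite le_eqVlt; apply/orP; left; apply/eqP.
  have -> : H7 = D * H5 - H6 by rewrite de5 addrC addKr.
  by ring.
have : \int[P]_w left_factor w * \int[P]_w right_factor w = 0.
  rewrite -prod0 (bounded_Fubini12 P mLR bLR) -RintegralZr//.
  by apply: eq_Rintegral => w _; rewrite /= RintegralZl.
move/eqP; rewrite mulf_eq0 => /orP[/eqP IL|/eqP IR]; [left|right].
  apply: (null_of_Rintegral_eq0 mL L0 iL IL).
    by apply: measurable_split_event; [exact: dens_meas hf1|exact: dens_meas hf3].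
  move=> w [xq h h']; rewrite /left_factor xq mul1r; have /andP[rp _] := r01 (procX w).
  by apply: mulr_gt0 => //; apply: mulr_gt0; exact: mulr_gt0.
apply: (null_of_Rintegral_eq0 mR R0 iR IR).
  by apply: measurable_hit_event; exact: dens_meas he5.
move=> w [xq h]; rewrite /right_factor xq mul1r; have /andP[rp _] := r01 (procX w).
by apply: mulr_gt0 => //; apply: mulr_gt0; exact: mulr_gt0.
Qed.

End swap_balance.

(** * Existence of balanced exchanges *)

Section balanced_swap.
Context {R : realType}.
Local Notation Om := (measurableTypeR R * measurableTypeR R)%type.

(** The damping factor is the inverse of 1 plus all the densities and [`|beta x|];
    this makes room for [beta] among the test functions, where it will be the slope
    of the cost in the second variable. A multiple of the weight below 1/2 can be
    added to its mirror image and still be a probability. *)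
Lemma balanced_swap_exists (P : probR2 R) (s t q : R) (beta : R -> R) : s < t ->
  measurable_fun [set: measurableTypeR R] beta ->
  exists (W : Om * Om -> R) (f1 f3 f5 : R -> R),
  [/\ [/\ conditional_density P (below s) f1, conditional_density P (above t) f3 &
          conditional_density P (inside s t) f5],
      [/\ measurable_fun [set: Om * Om] W, forall z, 0 <= W z <= 2^-1 &
          forall z, W z != 0 -> [/\ procX z.1 < q < procX z.2, s < procY z.2 < t &
                                    (procY z.1 <= s) || (t <= procY z.1)]],
      forall phi psi : R -> R,
        measurable_fun [set: measurableTypeR R] phi -> measurable_fun [set: measurableTypeR R] psi ->
        (forall x, `|phi x| <= 1 + `|beta x|) -> (forall x, `|psi x| <= 1 + `|beta x|) ->
        let F z := W z * (phi (procX z.1) * psi (procX z.2) * (procY z.1 - procY z.2)) in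
        (P \x P)%E.-integrable [set: Om * Om] (EFin \o F) /\ \int[(P \x P)%E]_z F z = 0 &
      \int[(P \x P)%E]_z W z = 0 ->
        P [set w | [/\ procX w < q, 0 < f1 (procX w) & 0 < f3 (procX w)]] = 0%E \/
        P [set w | q < procX w /\ 0 < f5 (procX w)] = 0%E].
Proof.
move=> st mbeta.
have [f1 hf1] := bounded_conditional_density P (@measurable_below R s) (@below01 R s).
have [f2 hf2] := bounded_conditional_density P (@measurable_below_gap R s) (@below_gap01 R s).
have [f3 hf3] := bounded_conditional_density P (@measurable_above R t) (@above01 R t).
have [f4 hf4] := bounded_conditional_density P (@measurable_above_gap R t) (@above_gap01 R t).
have [e6 he6] := bounded_conditional_density P (@measurable_inside_lo R s t) (inside_lo_bound st).
have [e7 he7] := bounded_conditional_density P (@measurable_inside_hi R s t) (inside_hi_bound st).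
have [[mf1 p1 _] [mf2 p2 _]] := (hf1, hf2); have [[mf3 p3 _] [mf4 p4 _]] := (hf3, hf4).
have [[me6 p6 _] [me7 p7 _]] := (he6, he7).
pose M x := f1 x + f2 x + f3 x + f4 x + e6 x + e7 x + `|beta x|.
have M0 x : 0 <= M x by rewrite /M !addr_ge0.
have mM : measurable_fun [set: measurableTypeR R] M.
  apply: measurable_funD; last exact: measurableT_comp.
  by do 4 (apply: measurable_funD => //); exact: measurable_funD.
pose r x := (1 + M x)^-1.
have mr : measurable_fun [set: measurableTypeR R] r by exact: measurable_inv1.
have M1 x : 0 < 1 + M x by have := M0 x; lra.
have r01 x : 0 < r x <= 1.
  by rewrite invr_gt0 M1 invf_le1//; have := M0 x; lra.
have rle x y : y <= 1 + M x -> r x * y <= 1.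
  by move=> h; rewrite mulrC ler_pdivrMr ?mul1r.
have sum x := (p1 x, p2 x, p3 x, p4 x, p6 x, p7 x, normr_ge0 (beta x)).
have rf1 x : r x * f1 x <= 1 by apply: rle; have [[[[[[? ?] ?] ?] ?] ?] ?] := sum x; rewrite /M; lra.
have rf2 x : r x * f2 x <= 1 by apply: rle; have [[[[[[? ?] ?] ?] ?] ?] ?] := sum x; rewrite /M; lra.
have rf3 x : r x * f3 x <= 1 by apply: rle; have [[[[[[? ?] ?] ?] ?] ?] ?] := sum x; rewrite /M; lra.
have rf4 x : r x * f4 x <= 1 by apply: rle; have [[[[[[? ?] ?] ?] ?] ?] ?] := sum x; rewrite /M; lra.
have re6 x : r x * e6 x <= 1 by apply: rle; have [[[[[[? ?] ?] ?] ?] ?] ?] := sum x; rewrite /M; lra.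
have re7 x : r x * e7 x <= 1 by apply: rle; have [[[[[[? ?] ?] ?] ?] ?] ?] := sum x; rewrite /M; lra.
have rphi phi : (forall x, `|phi x| <= 1 + `|beta x|) -> forall x, `|r x * phi x| <= 1.
  move=> h x; rewrite normrM ger0_norm; last by have /andP[/ltW] := r01 x.
  by apply: rle; have := h x; have [[[[[[? ?] ?] ?] ?] ?] ?] := sum x; rewrite /M; lra.
have [K K0 hK] := swap_density_bound q st hf1 hf2 hf3 hf4 he6 he7 r01 rf1 rf2 rf3 rf4 re6 re7.
pose V := swap_density s t q f1 f2 f3 f4 e6 e7 r.
have mV : measurable_fun [set: Om * Om] V.
  exact: (measurable_swap_density q st hf1 hf2 hf3 hf4 he6 he7 mr r01 rf1 rf2 rf3 rf4 re6 re7).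
have V0 z : 0 <= V z by exact: (swap_density_ge0 q st hf1 hf2 hf3 hf4 he6 he7 r01).
have K2 : 0 < (2 * K)^-1 by rewrite invr_gt0; lra.
exists (fun z => (2 * K)^-1 * V z), f1, f3, (fun x => (t - s)^-1 * (e6 x + e7 x)); split.
- by split => //; exact: conditional_density_inside.
- split.
  + by apply: measurable_funM => //; exact: measurable_cst.
  + move=> z; apply/andP; split; first by apply: mulr_ge0 => //; exact: ltW.
    rewrite invfM -mulrA ler_piMr ?invr_ge0 ?ler0n//.
    by rewrite mulrC ler_pdivrMr ?mul1r//; exact: hK.
  + move=> z; rewrite mulf_eq0 negb_or => /andP[_ h].
    exact: swap_density_support h.
- move=> phi psi mphi mpsi hphi hpsi /=.
  have [ti t0] := tested_increment_balanced q st hf1 hf2 hf3 hf4 he6 he7 mr r01 rf1 rf2 rf3 rf4 re6 re7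
    mphi mpsi (rphi _ hphi) (rphi _ hpsi).
  have E z : (2 * K)^-1 * V z * (phi (procX z.1) * psi (procX z.2) * (procY z.1 - procY z.2)) =
      (2 * K)^-1 * tested_increment s t q f1 f2 f3 f4 e6 e7 r phi psi z.
    by rewrite -tested_incrementE// -/V; ring.
  split.
    by have := integrableZl measurableT ((2 * K)^-1) ti; apply: eq_integrable => // z _; rewrite /= E.
  by under eq_Rintegral do rewrite E; rewrite RintegralZl// t0 mulr0.
- rewrite RintegralZl//; last first.
    by apply: (bounded_integrable _ (c := K)) => // z; rewrite ger0_norm.
  move/eqP; rewrite mulf_eq0 gt_eqF//= => /eqP.
  exact: (swap_density_integral0 st hf1 hf2 hf3 hf4 he6 he7 mr r01 rf1 rf2 rf3 rf4 re6 re7).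
Qed.

End balanced_swap.

(** * Exchanging second coordinates *)

Section swapping.
Context {R : realType}.
Local Notation Om := (measurableTypeR R * measurableTypeR R)%type.
Variables (P : probR2 R) (W : Om * Om -> R).
Local Notation PP := (P \x P)%E.
Hypotheses (mW : measurable_fun [set: Om * Om] W) (W01 : forall z, 0 <= W z <= 2^-1).

Definition swap_rate (z : Om * Om) : R := W z + W (z.2, z.1).
Definition crossed (z : Om * Om) : Om := (procX z.1, procY z.2).

Let msw : measurable_fun [set: Om * Om] (fun z : Om * Om => (z.2, z.1)).
Proof. by apply/measurable_fun_pairP; split; [exact: measurable_snd|exact: measurable_fst]. Qed.

Lemma measurable_swap_rate : measurable_fun [set: Om * Om] swap_rate.
Proof. by apply: measurable_funD => //; exact: measurableT_comp mW msw. Qed.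

Lemma measurable_crossed : measurable_fun [set: Om * Om] crossed.
Proof.
apply/measurable_fun_pairP; split.
  exact: measurableT_comp (@measurable_procX R) measurable_fst.
exact: measurableT_comp (@measurable_procY R) measurable_snd.
Qed.

Lemma swap_rate01 z : 0 <= swap_rate z <= 1.
Proof.
have /andP[? ?] := W01 z; have /andP[? ?] := W01 (z.2, z.1).
by rewrite /swap_rate; apply/andP; split; lra.
Qed.

(** Two independent points of law [P] exchange their second coordinates with
    probability [W]. By symmetry either resulting point may be kept, so the first
    one is, with the symmetrized rate. *)
Definition swapped : probR2 R :=
  coin_mixture PP measurable_swap_rate measurable_fst measurable_crossed.

Let W1 z : 0 <= W z <= 1.
Proof. by have /andP[-> h] := W01 z; apply: le_trans h _; rewrite invf_le1 ?ler1n. Qed.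

Section payoff.
Variable phi : Om -> R.
Hypotheses (mphi : measurable_fun [set: Om] phi)
  (iphi : P.-integrable [set: Om] (EFin \o phi))
  (i12 : PP.-integrable [set: Om * Om] (EFin \o (fun z => W z * phi (procX z.1, procY z.2))))
  (i21 : PP.-integrable [set: Om * Om] (EFin \o (fun z => W z * phi (procX z.2, procY z.1)))).

Let ip1 : PP.-integrable [set: Om * Om] (EFin \o (fun z => phi z.1)).
Proof. exact: (integrable_copy1 (P := P) iphi). Qed.
Let ip2 : PP.-integrable [set: Om * Om] (EFin \o (fun z => phi z.2)).
Proof. exact: (integrable_copy2 (P := P) iphi). Qed.

Let iw1 : PP.-integrable [set: Om * Om] (EFin \o (fun z => swap_rate z * phi (crossed z))).
Proof.
have := integrableD measurableT i12 (integrable_swap i21).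
by apply: eq_integrable => // z _; rewrite /= -EFinD /swap_rate mulrDl.
Qed.

Let iw0 : PP.-integrable [set: Om * Om] (EFin \o (fun z => (1 - swap_rate z) * phi z.1)).
Proof.
apply: (integrable_mul01 _ _ ip1).
  by apply: measurable_funB; [exact: measurable_cst|exact: measurable_swap_rate].
by move=> z; have /andP[? ?] := swap_rate01 z; apply/andP; split; lra.
Qed.

Lemma integrable_swapped : swapped.-integrable [set: Om] (EFin \o phi).
Proof. exact: (integrable_coin_mixture measurable_swap_rate measurable_fst measurable_crossed swap_rate01 mphi iw1 iw0). Qed.

Definition swap_gain z := phi (procX z.1, procY z.2) + phi (procX z.2, procY z.1) - phi z.1 - phi z.2.

Lemma integrable_swap_gain : PP.-integrable [set: Om * Om] (EFin \o (fun z => W z * swap_gain z)).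
Proof.
have := integrableB measurableT (integrableB measurableT (integrableD measurableT i12 i21)
  (integrable_mul01 mW W1 ip1)) (integrable_mul01 mW W1 ip2).
by apply: eq_integrable => // z _; congr EFin; rewrite /swap_gain/=; ring.
Qed.

Lemma Rintegral_swapped :
  \int[swapped]_w phi w = \int[P]_w phi w + \int[PP]_z (W z * swap_gain z).
Proof.
rewrite (Rintegral_coin_mixture measurable_swap_rate measurable_fst measurable_crossed swap_rate01 mphi iw1 iw0).
have iW1 := integrable_mul01 mW W1 ip1; have iW2 := integrable_mul01 mW W1 ip2.
have iA := integrableB measurableT i12 iW1.
have iB := integrableB measurableT i21 iW2.
have iS := integrable_swap iB.
rewrite -(Rintegral_copy1 iphi).
transitivity (\int[PP]_z (phi z.1 + ((W z * phi (procX z.1, procY z.2) - W z * phi z.1) +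
   (W (z.2, z.1) * phi (procX z.1, procY z.2) - W (z.2, z.1) * phi z.1)))).
  by apply: eq_Rintegral => z _; rewrite /swap_rate /crossed; ring.
rewrite RintegralD//; last exact: (integrableD measurableT iA iS).
congr (_ + _); rewrite RintegralD//.
rewrite (Rintegral_swap iB) -RintegralD//.
by apply: eq_Rintegral => z _; rewrite /swap_gain; ring.
Qed.

End payoff.

Let mp21 : measurable_fun [set: Om * Om] (fun z : Om * Om => (procX z.2, procY z.1) : Om).
Proof. exact: measurableT_comp measurable_crossed msw. Qed.

Let W_dominated (phi : Om -> R) (f : Om * Om -> Om) (g : Om * Om -> R) :
  measurable_fun [set: Om] phi -> measurable_fun [set: Om * Om] f ->
  PP.-integrable [set: Om * Om] (EFin \o g) -> (forall z, `|phi (f z)| <= `|g z|) ->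
  PP.-integrable [set: Om * Om] (EFin \o (fun z => W z * phi (f z))).
Proof.
move=> mphi mf ig hg; apply: (integrable_dominated _ _ (integrable_abse ig)).
  by apply: measurable_funM => //; exact: measurableT_comp mphi mf.
move=> z /=; rewrite normrM; have /andP[v0 v1] := W01 z.
rewrite (ger0_norm v0) -[leRHS]mul1r; apply: ler_pM => //; lra.
Qed.

(** This applies to the two marginals: the exchange permutes the values of each
    coordinate between the two points. *)
Lemma swapped_same_probability (A : set Om) : measurable A ->
  (forall z, swap_gain \1_A z = 0) -> swapped A = P A.
Proof.
move=> mA h.
have mphi : measurable_fun [set: Om] (\1_A : Om -> R) by exact: measurable_indic.
have b1 w : `|\1_A w : R| <= 1.
  by rewrite indicE; case: (_ \in _); rewrite /= ?normr1 ?normr0.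
have iphi := bounded_integrable P mphi b1.
have ic : PP.-integrable [set: Om * Om] (EFin \o cst (1 : R)).
  by apply: (bounded_integrable PP (c := 1)) => [|z]; [exact: measurable_cst|rewrite normr1].
have i12 := W_dominated mphi measurable_crossed ic.
have i21 := W_dominated mphi mp21 ic.
have := Rintegral_swapped mphi iphi (i12 _) (i21 _).
have -> : \int[PP]_z (W z * swap_gain \1_A z) = 0.
  by rewrite -[RHS](Rintegral_cst_prob PP 0); apply: eq_Rintegral => z _; rewrite h mulr0.
rewrite addr0 /Rintegral !integral_indic// !setIT => H.
rewrite -(fineK (fin_num_measure swapped A mA)) -(fineK (fin_num_measure P A mA)).
by congr EFin; apply: H => z; rewrite normr1.
Qed.


Lemma integrable_squeezed d (T : measurableType d) (Q : probability T R) (lo f up : T -> R) :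
  measurable_fun [set: T] f -> (forall t, lo t <= f t <= up t) ->
  Q.-integrable [set: T] (EFin \o lo) -> Q.-integrable [set: T] (EFin \o up) ->
  Q.-integrable [set: T] (EFin \o f).
Proof.
move=> mf h il iu.
apply: (integrable_dominated mf _ (integrableD measurableT (integrable_abse il) (integrable_abse iu))).
move=> t /=; have /andP[h1 h2] := h t.
have := ler_norm (up t); have := ler_norm (- lo t); rewrite normrN.
have := normr_ge0 (up t); have := normr_ge0 (lo t).
by rewrite ler_norml => ? ? ? ?; apply/andP; split; lra.
Qed.

Section bounded_above_payoff.
Variables (phi : Om -> R) (a b : R -> R) (H : Om * Om -> R).
Hypotheses (mphi : measurable_fun [set: Om] phi) (iphi : P.-integrable [set: Om] (EFin \o phi))
  (ia : P.-integrable [set: Om] (EFin \o (fun w => a (procX w))))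
  (ib : P.-integrable [set: Om] (EFin \o (fun w => b (procY w))))
  (phi_le : forall w, phi w <= a (procX w) + b (procY w))
  (iH : PP.-integrable [set: Om * Om] (EFin \o H))
  (H_le : forall z, H z <= W z * swap_gain phi z).

Let i1 := integrable_mul01 mW W1 (integrable_copy1 (P := P) iphi).
Let i2 := integrable_mul01 mW W1 (integrable_copy2 (P := P) iphi).
Let u12 := integrable_mul01 mW W1 (integrableD measurableT (integrable_copy1 (P := P) ia) (integrable_copy2 (P := P) ib)).
Let u21 := integrable_mul01 mW W1 (integrableD measurableT (integrable_copy2 (P := P) ia) (integrable_copy1 (P := P) ib)).

(** Each crossed payoff is bounded above through [a] and [b]; as their sum is
    bounded below through [H], each is also bounded below. *)
Lemma integrable_crossed_payoff :
  PP.-integrable [set: Om * Om] (EFin \o (fun z => W z * phi (procX z.1, procY z.2))).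
Proof.
have il := integrableB measurableT (integrableD measurableT (integrableD measurableT iH i1) i2) u21.
apply: (integrable_squeezed _ _ il u12).
  by apply: measurable_funM => //; exact: measurableT_comp mphi measurable_crossed.
move=> z /=; have /andP[W0 _] := W01 z.
have h := H_le z; have h1 := ler_wpM2l W0 (phi_le (procX z.1, procY z.2)).
have h2 := ler_wpM2l W0 (phi_le (procX z.2, procY z.1)).
rewrite /swap_gain in h; rewrite /= in h1 h2 *.
by apply/andP; split; lra.
Qed.

Lemma integrable_crossed_payoff_swap :
  PP.-integrable [set: Om * Om] (EFin \o (fun z => W z * phi (procX z.2, procY z.1))).
Proof.
have il := integrableB measurableT (integrableD measurableT (integrableD measurableT iH i1) i2) u12.
apply: (integrable_squeezed _ _ il u21).
  by apply: measurable_funM => //; exact: measurableT_comp mphi mp21.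
move=> z /=; have /andP[W0 _] := W01 z.
have h := H_le z; have h1 := ler_wpM2l W0 (phi_le (procX z.1, procY z.2)).
have h2 := ler_wpM2l W0 (phi_le (procX z.2, procY z.1)).
rewrite /swap_gain in h; rewrite /= in h1 h2 *.
by apply/andP; split; lra.
Qed.

End bounded_above_payoff.

Lemma swapped_coupling (mu nu : probR R) : finite_first_moment mu -> finite_first_moment nu ->
  martingale_couplings mu nu P ->
  (forall B : set (measurableTypeR R), measurable B ->
    \int[PP]_z (W z * ((\1_B (procX z.1) - \1_B (procX z.2)) * (procY z.2 - procY z.1))) = 0) ->
  martingale_couplings mu nu swapped.
Proof.
move=> fmu fnu [lX lY lM] bal.
have indic_pre (Z : Om -> measurableTypeR R) (A : set (measurableTypeR R)) w :
  \1_(Z @^-1` A) w = \1_A (Z w) :> R by [].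
have lX' : has_law swapped (@procX R) mu.
  move=> A mA; rewrite -lX// /pushforward; apply: swapped_same_probability.
    by rewrite -[X in measurable X]setTI; exact: measurable_procX.
  by move=> z; rewrite /swap_gain !indic_pre/=; ring.
have lY' : has_law swapped (@procY R) nu.
  move=> A mA; rewrite -lY// /pushforward; apply: swapped_same_probability.
    by rewrite -[X in measurable X]setTI; exact: measurable_procY.
  by move=> z; rewrite /swap_gain !indic_pre/=; ring.
have mX := @measurable_procX R; have mY := @measurable_procY R.
have iX := integrable_law (f := id) mX lX fmu; have iY := integrable_law (f := id) mY lY fnu.
have iX' := integrable_law (f := id) mX lX' fmu; have iY' := integrable_law (f := id) mY lY' fnu.
split => //; apply/(condexp_incrementP iX' iY') => B mB.
pose phi (w : Om) : R := \1_B (procX w) * (procY w - procX w).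
have mphi : measurable_fun [set: Om] phi.
  by apply: measurable_funM; [exact: measurable_indic_X|exact: measurable_funB].
have iphi : P.-integrable [set: Om] (EFin \o phi) by exact: integrable_indic_increment.
have le_increment w : `|phi w| <= `|procY w - procX w|.
  rewrite /phi normrM; have /andP[b0 b1] := indicX_le1 B w.
  by rewrite (ger0_norm b0) ler_piMl.
have i12 : PP.-integrable [set: Om * Om] (EFin \o (fun z => procY z.2 - procX z.1 : R)).
  exact: (integrableB measurableT (integrable_copy2 (P := P) iY) (integrable_copy1 (P := P) iX)).
have i21 : PP.-integrable [set: Om * Om] (EFin \o (fun z => procY z.1 - procX z.2 : R)).
  exact: (integrableB measurableT (integrable_copy1 (P := P) iY) (integrable_copy2 (P := P) iX)).
have j12 := W_dominated mphi measurable_crossed i12 (fun z => le_increment (crossed z)).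
have j21 := W_dominated mphi mp21 i21 (fun z => le_increment (procX z.2, procY z.1)).
rewrite (Rintegral_swapped mphi iphi j12 j21).
have /(condexp_incrementP iX iY)/(_ B mB) -> := lM; rewrite add0r.
rewrite -[RHS](bal B mB); apply: eq_Rintegral => z _.
by rewrite /swap_gain /phi /=; ring.
Qed.

End swapping.

(** * Strict convexity and chords *)

Section chord.
Context {R : realType}.

(** The convexity defect of [c u] is differentiable in [u], with derivative the
    defect of [partial_x c u], which has a sign; the mean value theorem concludes. *)
Lemma increment_strictly_convex (c : R -> R -> R) x x' : spence_mirrlees c -> x < x' ->
  strictly_convex (fun y => c x' y - c x y).
Proof.
move=> [_ dc _ sc] xx' l y0 y1 l01 y01.
pose ym := l * y0 + (1 - l) * y1.
pose phi u := l * c u y0 + (1 - l) * c u y1 - c u ym.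
pose dphi u := l * partial_x c u y0 + (1 - l) * partial_x c u y1 - partial_x c u ym.
have dP (u y : R) : is_derive u (1 : R) (c ^~ y : R -> R) (partial_x c u y).
  by apply: DeriveDef; [exact: dc|rewrite /partial_x derive1E].
have dphiP (u : R) : is_derive u (1 : R) (phi : R -> R) (dphi u).
  have h0 := is_deriveZ l (dP u y0); have h1 := is_deriveZ (1 - l) (dP u y1).
  exact: (is_deriveB (is_deriveD h0 h1) (dP u ym)).
have [u _ E] : exists2 u, u \in `]x, x'[ & phi x' - phi x = dphi u * (x' - x).
  apply: MVT => //.
  by apply: derivable_within_continuous => u _; have [] := dphiP u.
have : 0 < phi x' - phi x.
  rewrite E mulr_gt0 ?subr_gt0//.
  exact: sc.
by rewrite /phi /ym; lra.
Qed.

Definition slope (h : R -> R) s t := (h t - h s) / (t - s).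

Lemma strictly_convex_inside (h : R -> R) s t y : strictly_convex h -> s < y < t ->
  h y < h s + slope h s t * (y - s).
Proof.
move=> sc /andP[sy yt]; have D0 : 0 < t - s by lra.
have := sc ((t - y) / (t - s)) s t; set l := (t - y) / (t - s).
have l01 : 0 < l < 1.
  by apply/andP; split; [apply: divr_gt0; lra|rewrite /l ltr_pdivrMr ?mul1r//; lra].
have ly : l * s + (1 - l) * t = y by rewrite /l; field; lra.
move=> /(_ l01); rewrite ly => H; apply: lt_le_trans (H _) _; first by move=> ?; lra.
rewrite le_eqVlt; apply/orP; left; apply/eqP.
by rewrite /slope /l; field; lra.
Qed.

Lemma strictly_convex_outside (h : R -> R) s t y : strictly_convex h -> s < t ->
  (y <= s) || (t <= y) -> h s + slope h s t * (y - s) <= h y.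
Proof.
move=> sc st; have D0 : 0 < t - s by lra.
have slopeD : slope h s t * (t - s) = h t - h s by rewrite /slope; field; lra.
case/orP; rewrite le_eqVlt => /orP[/eqP yE|ys].
- by rewrite yE subrr mulr0 addr0.
- have /(strictly_convex_inside sc) : y < s < t by rewrite ys st.
  set m := slope h y t => H.
  have mD : m * (t - y) = h t - h y by rewrite /m /slope; field; lra.
  rewrite -(ler_pM2l D0); nra.
- by rewrite -yE slopeD; lra.
- have /(strictly_convex_inside sc) : s < t < y by rewrite ys st.
  set m := slope h s y => H.
  have mD : m * (y - s) = h y - h s by rewrite /m /slope; field; lra.
  rewrite -(ler_pM2l D0); nra.
Qed.

Lemma strictly_convex_gap (h : R -> R) s t y y' : strictly_convex h -> s < y' < t ->
  (y <= s) || (t <= y) -> slope h s t * (y - y') < h y - h y'.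
Proof.
move=> sc y'st yst; have st : s < t by case/andP: y'st => /lt_trans; exact.
have := strictly_convex_inside sc y'st; have := strictly_convex_outside sc st yst.
by rewrite !mulrBr; lra.
Qed.

End chord.

(** * Optimal couplings are left-monotone *)

Section optimality.
Context {R : realType}.
Local Notation Om := (measurableTypeR R * measurableTypeR R)%type.

Lemma integrable_of_lt_integral d (T : measurableType d) (Q : probability T R) (f g : T -> R) :
  measurable_fun [set: T] f -> Q.-integrable [set: T] (EFin \o g) -> (forall t, f t <= g t) ->
  (-oo < \int[Q]_t (f t)%:E)%E -> Q.-integrable [set: T] (EFin \o f).
Proof.
move=> mf ig fg; rewrite integralE => h.
have mEf : measurable_fun [set: T] (EFin \o f) by exact/measurable_EFinP.
have pos_fin : (\int[Q]_t ((EFin \o f)^\+ t) < +oo)%E.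
  have /integrableP[_] := ig; apply: le_lt_trans; apply: ge0_le_integral => //.
  - exact: measurable_funepos.
  - by apply: measurableT_comp => //; case/integrableP: ig.
  - move=> t _; rewrite funeposE /= ge_max lee_fin; apply/andP; split => //.
    by apply: le_trans (fg t) (ler_norm _).
have neg_fin : (\int[Q]_t ((EFin \o f)^\- t) < +oo)%E.
  rewrite ltey; apply/eqP => E; move: h; rewrite [X in (_ - X)%E]E.
  by rewrite addeNy ?ltxx//; apply: lt_eqF.
apply/integrableP; split => //.
rewrite -[X in (X < _)%E]/(\int[Q]_t ((abse \o (EFin \o f)) t))%E fune_abse.
rewrite ge0_integralD//; [exact: lte_add_pinfty|exact: measurable_funepos|exact: measurable_funeneg].
Qed.

Lemma density_zero_null (P : probR2 R) (Z : Om -> R) (f : R -> R) :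
  measurable_fun [set: Om] Z -> (forall w, 0 <= Z w) -> conditional_density P Z f ->
  measurable [set w | 0 < Z w /\ f (procX w) <= 0] /\
  P [set w | 0 < Z w /\ f (procX w) <= 0] = 0%E.
Proof.
move=> mZ Z0 [mf f0 hf].
have mX := @measurable_procX R.
have mfX : measurable_fun [set: Om] (fun w => f (procX w)) by exact: measurableT_comp mf mX.
have mN : measurable [set w | 0 < Z w /\ f (procX w) <= 0].
  rewrite (_ : [set w | _] = [set w | (0 < Z w) && (f (procX w) <= 0)]).
    apply: measurable_bool_set; apply: measurable_and.
      exact: (measurable_fun_ltr (measurable_cst _) mZ).
    exact: (measurable_fun_ler mfX (measurable_cst _)).
  by apply/seteqP; split => w /=; [move=> [-> ->]|move=> /andP].
split => //.
pose g (x : R) : R := if f x <= 0 then 1 else 0.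
have mg : measurable_fun [set: measurableTypeR R] g.
  apply: measurable_fun_ifT; try exact: measurable_cst.
  by apply: measurable_fun_ler => //; exact: measurable_cst.
have g0 x : 0 <= g x by rewrite /g; case: ifP; rewrite ?ler01 ?lexx.
have I0 : (\int[P]_w (g (procX w) * Z w)%:E = 0)%E.
  rewrite hf// -[RHS](integral0 P [set: Om]); apply: eq_integral => w _.
  rewrite /g; case: ifPn => [fx|_]; last by rewrite mul0r.
  have /eqP -> : f (procX w) == 0 by rewrite eq_le fx f0.
  by rewrite mulr0.
have mgZ : measurable_fun [set: Om] (fun w => g (procX w) * Z w).
  by apply: measurable_funM => //; exact: measurableT_comp mg mX.
have gZ0 w : 0 <= g (procX w) * Z w by exact: mulr_ge0.
apply: (null_of_Rintegral_eq0 mgZ gZ0) => //.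
- apply/integrableP; split; first exact/measurable_EFinP.
  under eq_integral => w _ do rewrite /= ger0_norm//.
  by rewrite I0.
- by rewrite /Rintegral I0.
- by move=> w [zp fx]; rewrite /g fx mul1r.
Qed.

Section solution.
Variables (c : R -> R -> R) (mu nu : probR R) (a b : R -> R) (P : probR2 R).
Hypotheses (smc : spence_mirrlees c) (fmu : finite_first_moment mu) (fnu : finite_first_moment nu)
  (ia : mu.-integrable [set: measurableTypeR R] (fun x => (a x)%:E))
  (ib : nu.-integrable [set: measurableTypeR R] (fun y => (b y)%:E))
  (c_le : forall x y : R, c x y <= a x + b y)
  (value_gt : (-oo < mot_value mu nu c)%E) (sol : mot_solution mu nu c P).
Local Notation PP := (P \x P)%E.

Let phi (w : Om) : R := c (procX w) (procY w).

Let mphi : measurable_fun [set: Om] phi.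
Proof. by case: smc. Qed.

Let iaX : P.-integrable [set: Om] (EFin \o (fun w => a (procX w))).
Proof. by have [[lX _ _] _] := sol; exact: integrable_law (@measurable_procX R) lX ia. Qed.

Let ibY : P.-integrable [set: Om] (EFin \o (fun w => b (procY w))).
Proof. by have [[_ lY _] _] := sol; exact: integrable_law (@measurable_procY R) lY ib. Qed.

Let iphi : P.-integrable [set: Om] (EFin \o phi).
Proof.
apply: (integrable_of_lt_integral mphi (integrableD measurableT iaX ibY)).
  by move=> w; exact: c_le.
have [_ eqv] := sol; move: value_gt; rewrite -eqv /expected_cost.
by rewrite unlock.
Qed.

(** The exchange yields an admissible coupling, so it cannot increase the expected
    cost. Its pointwise gain exceeds, strictly where [W] does not vanish, an affine
    term [H] that integrates to 0 by balance with [phi] and [psi] among 1 and the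
    slope of the cost. Hence [W] vanishes almost everywhere. *)
Lemma optimal_swap_null (s t q : R) (W : Om * Om -> R) : s < t ->
  measurable_fun [set: Om * Om] W -> (forall z, 0 <= W z <= 2^-1) ->
  (forall z, W z != 0 -> [/\ procX z.1 < q < procX z.2, s < procY z.2 < t &
                            (procY z.1 <= s) || (t <= procY z.1)]) ->
  (forall phi psi : R -> R,
        measurable_fun [set: measurableTypeR R] phi -> measurable_fun [set: measurableTypeR R] psi ->
        (forall x, `|phi x| <= 1 + `|slope (c x) s t|) -> (forall x, `|psi x| <= 1 + `|slope (c x) s t|) ->
        let F z := W z * (phi (procX z.1) * psi (procX z.2) * (procY z.1 - procY z.2)) in
        PP.-integrable [set: Om * Om] (EFin \o F) /\ \int[PP]_z F z = 0) ->
  measurable_fun [set: measurableTypeR R] (fun x => slope (c x) s t) ->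
  \int[PP]_z W z = 0.
Proof.
move=> st mW W01 Wsupp bal mbeta.
pose beta x := slope (c x) s t.
have one_le (x : R) : `|cst (1 : R) x| <= 1 + `|beta x| by rewrite normr1 lerDl.
have beta_le (x : R) : `|beta x| <= 1 + `|beta x| by rewrite lerDr.
have m1 : measurable_fun [set: measurableTypeR R] (cst (1 : R)) by exact: measurable_cst.
have indic_le (B : set (measurableTypeR R)) (x : R) : `|\1_B x : R| <= 1 + `|beta x|.
  apply: (@le_trans _ _ 1); last by rewrite lerDl.
  by rewrite indicE; case: (_ \in _); rewrite /= ?normr1 ?normr0.
have [ib1 b1] := bal _ _ m1 mbeta one_le beta_le.
have [ib2 b2] := bal _ _ mbeta m1 beta_le one_le.
pose H z := W z * ((beta (procX z.2) - beta (procX z.1)) * (procY z.1 - procY z.2)).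
have HE z : H z = W z * (1 * beta (procX z.2) * (procY z.1 - procY z.2)) -
    W z * (beta (procX z.1) * 1 * (procY z.1 - procY z.2)) by rewrite /H; ring.
have iH : PP.-integrable [set: Om * Om] (EFin \o H).
  by have := integrableB measurableT ib1 ib2; apply: eq_integrable => // z _; rewrite /= HE.
have H0 : \int[PP]_z H z = 0.
  under eq_Rintegral do rewrite HE.
  by rewrite RintegralB// [X in X - _]b1 [X in _ - X]b2 subrr.
have gain_gt z : W z != 0 ->
    (beta (procX z.2) - beta (procX z.1)) * (procY z.1 - procY z.2) < swap_gain phi z.
  move=> /Wsupp[/andP[xq qx'] y' y].
  have sc := increment_strictly_convex smc (lt_trans xq qx').
  have sE : slope (fun y => c (procX z.2) y - c (procX z.1) y) s t = beta (procX z.2) - beta (procX z.1).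
    by rewrite /beta /slope -mulrBl; congr (_ / _); ring.
  have gE : swap_gain phi z = (c (procX z.2) (procY z.1) - c (procX z.1) (procY z.1)) -
      (c (procX z.2) (procY z.2) - c (procX z.1) (procY z.2)) by rewrite /swap_gain /phi /=; ring.
  by rewrite gE -sE; exact: strictly_convex_gap sc y' y.
have H_le z : H z <= W z * swap_gain phi z.
  have [W0|Wn0] := eqVneq (W z) 0; first by rewrite /H W0 !mul0r.
  by apply: ler_wpM2l; [have /andP[] := W01 z|exact/ltW/gain_gt].
have i12 := integrable_crossed_payoff mW W01 mphi iphi iaX ibY (fun w => c_le _ _) iH H_le.
have i21 := integrable_crossed_payoff_swap mW W01 mphi iphi iaX ibY (fun w => c_le _ _) iH H_le.
have iG := integrable_swap_gain mW W01 iphi i12 i21.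
have [Pmn Pval] := sol.
have coupling : martingale_couplings mu nu (swapped P mW).
  apply: swapped_coupling => // B mB.
  have mB1 : measurable_fun [set: measurableTypeR R] (\1_B : R -> R) by exact: measurable_indic.
  have [i1 e1] := bal _ _ m1 mB1 one_le (indic_le B).
  have [i2 e2] := bal _ _ mB1 m1 (indic_le B) one_le.
  transitivity (\int[PP]_z (W z * (cst 1 (procX z.1) * \1_B (procX z.2) * (procY z.1 - procY z.2)) -
     W z * (\1_B (procX z.1) * cst 1 (procX z.2) * (procY z.1 - procY z.2)))).
    by apply: eq_Rintegral => z _; rewrite /cst; ring.
  by rewrite RintegralB// [X in X - _]e1 [X in _ - X]e2 subrr.
have iS := integrable_swapped mW W01 mphi iphi i12 i21.
have no_gain : \int[PP]_z (W z * swap_gain phi z) <= 0.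
  have : (expected_cost c (swapped P mW) <= expected_cost c P)%E.
    by rewrite Pval; apply: ereal_sup_ubound; exists (swapped P mW).
  rewrite /expected_cost unlock.
  rewrite -(fineK (integrable_fin_num measurableT iS)) -(fineK (integrable_fin_num measurableT iphi)).
  rewrite lee_fin -[X in X <= _]/(\int[swapped P mW]_w phi w).
  by rewrite (Rintegral_swapped mW W01 mphi iphi i12 i21) gerDl.
have iF := integrableB measurableT iG iH.
have mF : measurable_fun [set: Om * Om] (fun z => W z * swap_gain phi z - H z).
  by apply/measurable_EFinP; case/integrableP: iF.
apply: (Rintegral_eq0_ae mF iF _ _ mW).
- by move=> z; rewrite subr_ge0.
- apply/eqP; rewrite eq_le; apply/andP; split.
    by rewrite RintegralB// H0 subr0.
  by apply: Rintegral_ge0 => z _; rewrite subr_ge0.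
- move=> z; have [//|Wn0] := eqVneq (W z) 0; rewrite /H -mulrBr => /eqP.
  by rewrite mulf_eq0 (negbTE Wn0)/= subr_eq0 gt_eqF// gain_gt.
Qed.

Lemma measurable_section (y : R) : measurable_fun [set: measurableTypeR R] (c ^~ y).
Proof.
have [mc _ _ _] := smc.
exact: measurableT_comp mc (pair2_measurable y).
Qed.

Lemma measurable_slope s t : measurable_fun [set: measurableTypeR R] (fun x => slope (c x) s t).
Proof.
apply: measurable_funM; last exact: measurable_cst.
by apply: measurable_funB; exact: measurable_section.
Qed.

(** The vanishing of the exchange leaves two cases. Either almost no [x] below [q]
    has mass on both sides of the interval, or almost no [x] above [q] has mass
    inside it. The null sets also collect the points that lie in a region to which
    their own conditional law gives no mass. *)
Theorem optimal_left_monotone : left_monotone P.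
Proof.
apply: left_monotone_of_null_sets => s t q st.
have [W [f1 [f3 [f5 [[h1 h3 h5] [mW W01 Wsupp] bal null]]]]] :=
  balanced_swap_exists P q st (measurable_slope s t).
have [m1 n1] := density_zero_null (@measurable_below R s) (fun w => proj1 (andP (below01 s w))) h1.
have [m3 n3] := density_zero_null (@measurable_above R t) (fun w => proj1 (andP (above01 t w))) h3.
have [m5 n5] := density_zero_null (@measurable_inside R s t) (fun w => proj1 (andP (inside01 s t w))) h5.
have below_gt0 (x y : R) : y < s -> 0 < below s (x, y).
  move=> ys; rewrite /below /= (ltW ys) mul1r invr_gt0.
  by have := pos_part_ge0 (s - y); rewrite /procY/=; lra.
have above_gt0 (x y : R) : t < y -> 0 < above t (x, y).
  move=> ys; rewrite /above /= (ltW ys) mul1r invr_gt0.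
  by have := pos_part_ge0 (y - t); rewrite /procY/=; lra.
have inside_gt0 (x y : R) : s < y -> y < t -> 0 < inside s t (x, y).
  by move=> sy yt; rewrite /inside /= sy yt.
have null3 (A B C : set Om) : measurable A -> measurable B -> measurable C ->
    P A = 0%E -> P B = 0%E -> P C = 0%E -> P (A `|` B `|` C) = 0%E.
  move=> mA mB mC A0 B0 C0; apply: null_set_setU => //; first exact: measurableU.
  exact: null_set_setU.
have [[mf1 _ _] [mf3 _ _] [mf5 _ _]] := And3 h1 h3 h5.
have [A0|A0] := null (optimal_swap_null st mW W01 Wsupp bal (measurable_slope s t)).
- have mA := measurable_split_event q mf1 mf3.
  eexists; split; [exact: measurableU (measurableU _ _ m1 m3) mA|exact: null3|].
  move=> x y0 y1 x' y' y0s sy' y't ty1 xq qx' /=.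
  have [f1x|f1x] := leP (f1 x) 0.
    by apply: Or31; left; left; split => //; exact: below_gt0.
  have [f3x|f3x] := leP (f3 x) 0.
    by apply: Or32; left; right; split => //; exact: above_gt0.
  by apply: Or31; right.
- have mA := measurable_hit_event q mf5.
  eexists; split; [exact: measurableU m5 mA|exact: null_set_setU|].
  move=> x y0 y1 x' y' y0s sy' y't ty1 xq qx' /=.
  apply: Or33; have [f5x|f5x] := leP (f5 x') 0; [left|by right].
  by split => //; exact: inside_gt0.
Qed.

End solution.

End optimality.

Theorem theorem3p3 (R : realType) :
  (forall (c : R -> R -> R) (mu nu : probR R) (a b : R -> R),
      spence_mirrlees c ->
      finite_first_moment mu -> finite_first_moment nu ->
      convex_order mu nu ->
      mu.-integrable [set: measurableTypeR R] (fun x => (a x)%:E) ->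
      nu.-integrable [set: measurableTypeR R] (fun y => (b y)%:E) ->
      (forall x y : R, c x y <= a x + b y) ->
      (-oo < mot_value mu nu c)%E ->
      forall Pstar : probR2 R,
        mot_solution mu nu c Pstar -> left_monotone Pstar)
  /\
  (forall mu nu : probR R,
      finite_first_moment mu -> finite_first_moment nu ->
      convex_order mu nu ->
      exists P : probR2 R,
        martingale_couplings mu nu P /\ left_monotone P).
Proof.
split.
  move=> c mu nu a b smc fmu fnu _ ia ib c_le value_gt P sol.
  exact: optimal_left_monotone smc fmu fnu ia ib c_le value_gt sol.
move=> mu nu fmu fnu mn; exists (left_curtain fmu fnu mn); split.
  exact: left_curtain_coupling.
exact: left_curtain_left_monotone.
Qed.
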